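(* Let $a\ge 0$ and $\lambda>0$. (i) Let $\alpha\in(1,2)$ and $\theta=2-\alpha$. Then the density $u(x,t)$ of the process $\mathcal{Y}_\alpha^\theta(t)=\mathcal{S}_\alpha^\theta(at+B(t))$, $t\ge0$, satisfies the equation $$\partial_t u(x,t)=a\left[\mathcal{D}_x^{\alpha,\theta}+\lambda t\left(I-\mathcal{O}_{1,x}^{\alpha,\theta}\right)\right]u(x,t)+\frac{\lambda}{\alpha}\left(I-\mathcal{O}_{1,x}^{\alpha,\theta}\right)I_{1-\alpha}^{\alpha-1}\left[x\,u(x,t)\right],$$ with initial condition $u(x,0)=p_\alpha^\theta(x,1)$. (ii) For $\alpha=2$, $\theta=0$, the density $u(x,t)$ of $\mathcal{Y}_2^0(t)$ satisfies instead $$\partial_t u(x,t)=a\left[\partial_x^2+\lambda t\left(I-e^{\partial_x^2}\right)\right]u(x,t)+\frac{\lambda}{2}\left(I-e^{\partial_x^2}\right)\int_{-\infty}^{x}z\,u(z,t)\,dz,$$ with initial condition $u(x,0)=p_2^0(x,1)=\frac{1}{\sqrt{4\pi}}e^{-x^2/4}$.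
   Context: Fourier transform: $\mathcal{F}\{f(x);\xi\}=\widetilde f(\xi)=\int_{-\infty}^{+\infty}e^{ix\xi}f(x)\,dx$. An operator $\mathcal{A}$ has symbol $\widehat{\mathcal{A}}(\xi)$ if $\mathcal{F}\{\mathcal{A}f(x);\xi\}=\widehat{\mathcal{A}}(\xi)\widetilde f(\xi)$. For $\alpha\in(0,2]$ and $|\theta|\le\min\{\alpha,2-\alpha\}$ put $\psi_{\alpha,\theta}(\xi)=|\xi|^{\alpha}e^{i\,\mathrm{sign}(\xi)\theta\pi/2}$. The Riesz-Feller fractional derivative $\mathcal{D}_x^{\alpha,\theta}$ is the operator with symbol $-\psi_{\alpha,\theta}(\xi)$; for $\alpha=2,\theta=0$ it is $\partial_x^2$. The fractional shift (exponential) operator is $\mathcal{O}_{c,x}^{\alpha,\theta}f(x)=\sum_{n=0}^{\infty}\frac{c^n}{n!}(\mathcal{D}_x^{\alpha,\theta})^{n}f(x)$, $c\in\mathbb{R}$ (with $(\mathcal{D}_x^{\alpha,\theta})^n$ the $n$-fold iteration, and provided that the series converges uniformly); its symbol is $e^{-c\psi_{\alpha,\theta}(\xi)}$. For $\alpha=2$, $\theta=0$ one writes $\mathcal{O}_{1,x}^{2,0}=e^{\partial_x^2}$, with symbol $e^{-\xi^2}$. $I$ (without indices) is the identity operator. $I_\gamma^\nu$ denotes the Feller integral, with symbol $\widehat{I_\gamma^\nu}(\xi)=|\xi|^{-\nu}e^{-i\pi\gamma\,\mathrm{sign}(\xi)/2}$, where $|\gamma|\le\nu$ for $0<\nu<1$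 (and $|\gamma|\le 2-\nu$ for $1<\nu<2$); for $0<\nu<1$ it is defined for functions in $L^1_{loc}(\mathbb{R})$. $\mathcal{S}_\alpha^\theta(t)$, $t\ge0$, is the $\alpha$-stable Lévy process with $\mathbb{E}e^{i\xi\mathcal{S}_\alpha^\theta(t)}=\exp\{-t\,\psi_{\alpha,\theta}(\xi)\}$, and $p_\alpha^\theta(x,t)$ is its transition density. $B(t)$, $t\ge0$, is a linear birth (Yule-Furry) process with one progenitor and parameter $\lambda$, independent of $\mathcal{S}_\alpha^\theta$: $\Pr\{B(t)=k\mid B(0)=1\}=e^{-\lambda t}(1-e^{-\lambda t})^{k-1}$, $k=1,2,\dots$. The density of $\mathcal{Y}_\alpha^\theta(t)$ is therefore $u(x,t)=\sum_{k=1}^\infty e^{-\lambda t}(1-e^{-\lambda t})^{k-1}p_\alpha^\theta(x,k+at)$. *)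

(* Defs.v *)
From HB Require Import structures.
From mathcomp Require Import all_boot all_order all_algebra.
From mathcomp Require Import all_classical all_reals all_analysis.
From mathcomp.real_closed Require Import complex.

Set Implicit Arguments.
Unset Strict Implicit.
Unset Printing Implicit Defensive.

Import Order.TTheory GRing.Theory Num.Theory.
Import numFieldNormedType.Exports.

Local Open Scope classical_set_scope.
Local Open Scope ring_scope.

Section FourierMultipliers.
Context {R : realType}.
Implicit Types (f g : R -> R) (m : R -> R[i]) (alpha theta gamma nu c xi : R).

Local Notation mu := (@lebesgue_measure R).

Definition expi (y : R) : R[i] := Complex (cos y) (sin y).

Definition cexp (z : R[i]) : R[i] :=
  real_complex R (expR (complex.Re z)) * expi (complex.Im z).

(* int e^{i x xi} f(x) dx for real-valued f, split into real and imaginary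
   parts because the library integrates (extended) real functions only. *)
Definition fourier f xi : R[i] :=
  Complex (\int[mu]_x (cos (x * xi) * f x)) (\int[mu]_x (sin (x * xi) * f x)).

(* g is the continuous integrable image of f under the operator with symbol m.
   Continuity singles out one representative of the class of g in L^1, so that
   values at points make sense.  The frequency 0 is left out because symbols
   such as |xi|^{-nu} are singular there; as g is integrable, its transform is
   continuous and is determined by its values at xi <> 0. *)
Definition symbol_image m f g : Prop :=
  [/\ mu.-integrable setT (EFin \o f),
      mu.-integrable setT (EFin \o g),
      continuous g &
      forall xi, xi != 0 -> fourier g xi = m xi * fourier f xi].

(* There is at most one such image; the value is 0 when there is none. *)
Definition symbol_op m f : R -> R := xget (fun=> 0) [set g | symbol_image m f g].

Definition psi alpha theta xi : R[i] :=
  real_complex R (`|xi| `^ alpha) * expi (Num.sg xi * theta * pi / 2).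

Definition riesz_feller_symbol alpha theta xi : R[i] := - psi alpha theta xi.

Definition riesz_feller alpha theta : (R -> R) -> (R -> R) :=
  symbol_op (riesz_feller_symbol alpha theta).

Definition feller_symbol gamma nu xi : R[i] :=
  real_complex R (`|xi| `^ (- nu)) * expi (- (pi * gamma * Num.sg xi / 2)).

Definition feller_integral gamma nu : (R -> R) -> (R -> R) :=
  symbol_op (feller_symbol gamma nu).

Definition shift_series alpha theta c f (N : nat) (x : R) : R :=
  \sum_(n < N) c ^+ n / n`!%:R * iter n (riesz_feller alpha theta) f x.

Definition shift_series_cvg alpha theta c f g : Prop :=
  (forall n, symbol_image (riesz_feller_symbol alpha theta)
               (iter n (riesz_feller alpha theta) f)
               (iter n.+1 (riesz_feller alpha theta) f)) /\
  {uniform, shift_series alpha theta c f @ \oo --> g}.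

Definition frac_shift_symbol alpha theta c xi : R[i] :=
  cexp (- (real_complex R c * psi alpha theta xi)).

(* The sum of the exponential series of the Riesz-Feller derivative when this
   series converges uniformly on R; for all other f, the operator with symbol
   e^{- c psi}.  For alpha < 2 and |theta| close to its bound, the series of a
   stable density at time s need not converge for small s, whereas its image
   under the symbol always exists. *)
Definition frac_shift alpha theta c f : R -> R :=
  xget (symbol_op (frac_shift_symbol alpha theta c) f)
       [set g | shift_series_cvg alpha theta c f g].

(* l is the derivative at t of f restricted to [0, +oo[: two-sided for t > 0,
   right-sided for t = 0. *)
Definition is_halfline_derive (f : R -> R) (t l : R) : Prop :=
  h^-1 * (f (t + h) - f t) @[h --> within [set h | 0 <= t + h] (0 : R)^'] --> l.

End FourierMultipliers.

Section Processes.
Context {d : measure_display} {T : measurableType d} {R : realType}.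
Variable P : probability T R.

Local Notation mu := (@lebesgue_measure R).

Definition is_density (X : T -> R) (f : R -> R) : Prop :=
  [/\ measurable_fun setT X, measurable_fun setT f, (forall x, 0 <= f x) &
      forall A : set R, measurable A ->
        P (X @^-1` A) = (\int[mu]_(x in A) (f x)%:E)%E].

(* The Levy process with E e^{i xi S(t)} = e^{- t psi(xi)}; only the times
   t >= 0 matter. *)
Definition is_stable_levy (alpha theta : R) (S : R -> {RV P >-> R}) : Prop :=
  [/\ P [set w | S 0 w = 0] = 1%E,
      (forall (n : nat) (t : nat -> R) (A : nat -> set R),
         0 <= t 0%N -> (forall i, t i <= t i.+1) ->
         (forall i, measurable (A i)) ->
         P (\bigcap_(i < n) [set w | A i (S (t i.+1) w - S (t i) w)]) =
         (\prod_(i < n) P [set w | A i (S (t i.+1) w - S (t i) w)%R])%E),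
      (forall (s t : R) (A : set R), 0 <= s -> 0 <= t -> measurable A ->
         P [set w | A (S (s + t) w - S s w)] = P [set w | A (S t w)]),
      (forall s e : R, 0 <= s -> 0 < e ->
         P [set w | e < `|S t w - S s w|]
           @[t --> within [set t | 0 <= t] (nbhs s)] --> (0%E : \bar R)) &
      forall t xi : R, 0 <= t ->
        Complex (\int[P]_w cos (xi * S t w)) (\int[P]_w sin (xi * S t w)) =
        cexp (- (real_complex R t * psi alpha theta xi))].

(* The continuous version of the density of S(t), t > 0; by stationarity of
   the increments, this is the transition density. *)
Definition is_transition_density (S : R -> {RV P >-> R}) (p : R -> R -> R) :=
  forall t : R, 0 < t ->
    is_density (S t) (p^~ t) /\ continuous (p^~ t : R -> R).

(* Probability for the linear birth process of going from i to j in time t. *)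
Definition yule_transition (lambda t : R) (i j : nat) : R :=
  if (0 < i <= j)%N then
    'C(j.-1, i.-1)%:R * expR (- (lambda * t)) ^+ i
      * (1 - expR (- (lambda * t))) ^+ (j - i)
  else 0.

Definition is_yule (lambda : R) (B : R -> {RV P >-> nat}) : Prop :=
  P [set w | B 0 w = 1%N] = 1%E /\
  forall (n : nat) (t : nat -> R) (k : nat -> nat),
    t 0%N = 0 -> k 0%N = 1%N -> (forall i, t i <= t i.+1) ->
    P (\bigcap_(i < n) [set w | B (t i.+1) w = k i.+1]) =
    (\prod_(i < n) yule_transition lambda (t i.+1 - t i) (k i) (k i.+1))%:E.

Definition independent_processes
    (S : R -> {RV P >-> R}) (B : R -> {RV P >-> nat}) : Prop :=
  forall (m n : nat) (s t : nat -> R) (A : nat -> set R) (E : nat -> set nat),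
    (forall i, 0 <= s i) -> (forall j, 0 <= t j) ->
    (forall i, measurable (A i)) ->
    P (\bigcap_(i < m) (S (s i) @^-1` A i) `&`
       \bigcap_(j < n) (B (t j) @^-1` E j)) =
    (P (\bigcap_(i < m) (S (s i) @^-1` A i)) *
     P (\bigcap_(j < n) (B (t j) @^-1` E j)))%E.

Definition time_changed (a : R) (S : R -> {RV P >-> R}) (B : R -> {RV P >-> nat})
    (t : R) : T -> R :=
  fun w => S (a * t + (B t w)%:R) w.

End Processes.

(* The density of S(a t + B(t)), by conditioning on B(t). *)
Definition yule_density {R : realType} (a lambda : R) (p : R -> R -> R)
    (x t : R) : R :=
  \big[+%R/0]_(1 <= k <oo)
    (expR (- (lambda * t)) * (1 - expR (- (lambda * t))) ^+ k.-1
       * p x (k%:R + a * t)).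

(* Main.v *)
Require Import Defs.
From HB Require Import structures.
From mathcomp Require Import all_boot all_order all_algebra.
From mathcomp Require Import all_classical all_reals all_analysis.
From mathcomp.real_closed Require Import complex.
From mathcomp Require Import measurable_realfun ring lra.

Set Implicit Arguments.
Unset Strict Implicit.
Unset Printing Implicit Defensive.

Import Order.TTheory GRing.Theory Num.Theory.
Import numFieldNormedType.Exports.

Local Open Scope classical_set_scope.
Local Open Scope ring_scope.

(** The proof works on the frequency side. Put omega = theta pi / 2, so that
    cos omega > 0, and let the kernel of order m be the integral over xi > 0 of

      xi^m e^{- s cos(omega) xi^alpha}
        cos (x xi + s sin(omega) xi^alpha + phi).

    For phi = 0 and m = 0 this is pi times the inverse Fourier transform p_s of
    e^{- s psi}, and other values of m and phi give p_s after any of the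
    operations in the two equations: d/dx and d/ds change m and phi
    (is_derive_kernel_x, is_derive_kernel_s), and integration by parts turns a
    factor x into a combination of kernels (kernel_recurrence). Hence

      d/ds p_s = D p_s   and   the Feller integral of x p_s is - alpha s p_s,

    the latter because - i psi' is, for theta = 2 - alpha, a multiple of the
    inverse of the Feller symbol. For alpha = 2 it reads x p_s = - 2 s p_s', and
    - 2 s p_s is the integral from - oo. The same recurrence, with a cut at 1/|x|
    where the exponent is singular, shows that all these functions decay like
    |x|^{- alpha}; as alpha > 1, they are integrable, and their transforms are
    known (fourier_kernel) by inversion of the Hartley transform, that is the sum
    of the real and imaginary parts of the Fourier transform of a real function.
    Inversion also shows that a continuous integrable function is determined by
    its transform, which identifies the transition density of the process with
    p_s (transition_densityE) and makes every operator with a symbol computable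
    from a candidate (symbol_opE).

    With q = 1 - e^{- lambda t}, w_k = e^{- lambda t} q^k and s_k = k + 1 + a t,
    the density is u = sum_k w_k p_{s_k}. The weights decay geometrically and the
    bounds grow polynomially in s, so symbols act termwise
    (symbol_image_mixture):

      D u = sum_k w_k D p_{s_k},      O u = sum_k w_k p_{s_k + 1},
      J = - alpha sum_k w_k s_k p_{s_k},
      O J = - alpha sum_k w_k s_k p_{s_k + 1}.

    The termwise derivative in t uses w_k' = lambda (k w_{k-1} - (k + 1) w_k). As
    s_k + 1 = s_{k+1}, the terms lambda k w_{k-1} p_{s_k} sum to the same value as
    lambda (k + 1) w_k p_{s_k + 1}, and writing k + 1 = s_k - a t gives the
    equation (is_derive_yule_mixture). At t = 0 the series is differentiated on a
    two-sided neighbourhood, where it still converges.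

    The value of the fractional shift O f is the sum of its exponential series
    when that series converges uniformly, and the image of f under the symbol
    otherwise. The two agree (frac_shiftE): the partial sums, averaged against a
    Gaussian, converge to the averages of the image, because the transform of f
    decays like e^{- cos(omega) |xi|^alpha} and the Gaussian absorbs what is left
    of e^{|xi|^alpha}; for alpha = 2 nothing is left, as omega = 0. *)

(** * Real-valued Lebesgue integrals *)

Section real_integrals.
Context d (T : measurableType d) (R : realType) (mu : {measure set T -> \bar R}).
Implicit Types (A : set T) (f g : T -> R).

Local Notation L1 A f := (mu.-integrable A (EFin \o f)).

Lemma integrable_measurable A f : L1 A f -> measurable_fun A f.
Proof. by move=> /(measurable_int mu)/measurable_EFinP. Qed.

Lemma le_Rintegrable A f g : measurable A -> measurable_fun A f ->
  (forall x, A x -> `|f x| <= g x) -> L1 A g -> L1 A f.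
Proof.
move=> mA mf fg; apply: le_integrable => //; first exact/measurable_EFinP.
by move=> x Ax /=; rewrite lee_fin (le_trans (fg _ Ax))// ler_norm.
Qed.

Lemma RintegrableZ A f k : measurable A -> L1 A f -> L1 A (fun x => k * f x).
Proof. by move=> mA /(@integrableZl _ _ _ mu A mA k). Qed.

Lemma RintegrableD A f g : measurable A ->
  L1 A f -> L1 A g -> L1 A (fun x => f x + g x).
Proof. by move=> mA if_ ig; have := integrableD mA if_ ig. Qed.

Lemma RintegrableB A f g : measurable A ->
  L1 A f -> L1 A g -> L1 A (fun x => f x - g x).
Proof. by move=> mA if_ ig; have := integrableB mA if_ ig. Qed.

Lemma RintegrableM A f g M : measurable A -> measurable_fun A g ->
  (forall x, A x -> `|g x| <= M) -> L1 A f -> L1 A (fun x => g x * f x).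
Proof.
move=> mA mg gM if_; apply: (@le_Rintegrable _ _ (fun x => M * `|f x|)) => //.
- by apply: measurable_funM => //; exact: integrable_measurable.
- by move=> x Ax; rewrite normrM ler_wpM2r// gM.
- by apply: RintegrableZ => //; exact: integrable_norm.
Qed.

Lemma normr_Rintegral_le A f g : measurable A -> measurable_fun A f ->
  (forall x, A x -> `|f x| <= g x) -> L1 A g ->
  `|\int[mu]_(x in A) f x| <= \int[mu]_(x in A) g x.
Proof.
move=> mA mf fg ig; have if_ := le_Rintegrable mA mf fg ig.
apply: le_trans (le_normr_Rintegral mA if_) _.
by apply: le_Rintegral => //; exact: integrable_norm.
Qed.

Lemma subset_Rintegral_le A A' f : measurable A -> measurable A' -> A `<=` A' ->
  (forall x, 0 <= f x) -> L1 A' f -> \int[mu]_(x in A) f x <= \int[mu]_(x in A') f x.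
Proof.
move=> mA mA' AA' f0 if_; rewrite Rintegral_mkcond [leRHS]Rintegral_mkcond.
apply: le_Rintegral => //.
- rewrite -restrict_EFin; apply/(integrable_mkcond _ _).1 => //.
  exact: integrableS if_.
- by rewrite -restrict_EFin; apply/(integrable_mkcond _ _).1.
- move=> x _; rewrite !patchE; case: ifPn => xA; last by case: ifP.
  by rewrite ifT// inE; apply: AA'; rewrite inE in xA.
Qed.

Lemma Rdominated_cvg A (f_ : nat -> T -> R) f g : measurable A ->
  (forall n, measurable_fun A (f_ n)) ->
  (forall x, A x -> f_ n x @[n --> \oo] --> f x) ->
  (forall n x, A x -> `|f_ n x| <= g x) -> L1 A g ->
  L1 A f /\ \int[mu]_(x in A) f_ n x @[n --> \oo] --> \int[mu]_(x in A) f x.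
Proof.
move=> mA mf_ f_f fg ig.
have mf : measurable_fun A f by apply: (measurable_fun_cvg mf_).
have [//| | | | |if_ _ ff] := @dominated_convergence _ _ _ mu A mA
  (fun n => EFin \o f_ n) (EFin \o f) (EFin \o g).
- by move=> n; exact/measurable_EFinP.
- exact/measurable_EFinP.
- apply: aeW => x Ax; apply: cvg_EFin; first exact: nearW.
  exact: f_f.
- exact: ig.
- by apply: aeW => x n Ax /=; rewrite lee_fin fg.
split => //; rewrite /Rintegral; apply: fine_cvg.
by rewrite fineK//; exact: integrable_fin_num.
Qed.

End real_integrals.

(** * Half-line integrals *)

Section half_line.
Context {R : realType}.
Local Notation mu := (@lebesgue_measure R).
Local Notation L1 A f := (mu.-integrable A (EFin \o f)).
Implicit Types (f F : R -> R) (b l : R).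

(** Compact subintervals of ]b, +oo[ that stay away from b, where the
    integrand may be singular. *)
Definition exhaust b (n : nat) : set R := `[b + n.+1%:R^-1, b + n.+2%:R]%classic.

Lemma exhaust_lt b n : b + n.+1%:R^-1 < b + n.+2%:R.
Proof.
rewrite ltrD2l (@le_lt_trans _ _ 1) ?ltr1n//.
by rewrite invf_le1 ?ler1n.
Qed.

Lemma exhaust_near b x : b < x -> \forall n \near \oo, exhaust b n x.
Proof.
move=> bx; near=> n; rewrite /exhaust/= in_itv/=; apply/andP; split.
- rewrite -lerBrDl invf_ple ?posrE ?subr_gt0//.
  rewrite (@le_trans _ _ n%:R) ?ler_nat//.
  by near: n; exact: nbhs_infty_ger.
- rewrite -lerBlDl (@le_trans _ _ n%:R) ?ler_nat//.
  by near: n; exact: nbhs_infty_ger.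
  by rewrite -addn2 leq_addr.
Unshelve. all: by end_near. Qed.

Lemma exhaust_sub b n : exhaust b n `<=` `]b, +oo[.
Proof.
move=> x; rewrite /exhaust/= !in_itv/= andbT => /andP[+ _].
by apply: lt_le_trans; rewrite ltrDl.
Qed.

Lemma continuous_halfline_measurable b f :
  (forall x, b < x -> {for x, continuous f}) -> measurable_fun `]b, +oo[ f.
Proof.
move=> cf; apply: open_continuous_measurable_fun => //.
by move=> x; rewrite inE/= in_itv/= andbT; exact: cf.
Qed.

Lemma FTC_exhaust b F f n :
  (forall x, b < x -> is_derive x 1 F (f x)) ->
  (forall x, b < x -> {for x, continuous f}) ->
  (\int[mu]_(x in exhaust b n) (f x)%:E
     = (F (b + n.+2%:R) - F (b + n.+1%:R^-1))%:E)%E.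
Proof.
move=> dF cf; have H x : b + n.+1%:R^-1 <= x -> b < x.
  by apply: lt_le_trans; rewrite ltrDl.
have cF x : b < x -> {for x, continuous F}.
  move=> bx; have [+ _] := dF _ bx.
  by move=> /derivable1_diffP/differentiable_continuous.
rewrite (continuous_FTC2 (F := F)) ?EFinB//.
- exact: exhaust_lt.
- apply: continuous_in_subspaceT => x; rewrite inE/= in_itv/= => /andP[/H bx _].
  exact: cf.
- split.
  + by move=> x; rewrite in_itv/= => /andP[/ltW/H bx _]; have [] := dF _ bx.
  + by apply: cvg_at_right_filter; apply: cF; exact: H.
  + apply: cvg_at_left_filter; apply: cF; apply: H; apply: ltW.
    exact: exhaust_lt.
- move=> x; rewrite in_itv/= => /andP[/ltW/H bx _].
  by rewrite derive1E; have [_ ->] := dF _ bx.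
Qed.

Lemma exhaust_cvg b F l0 l1 : F x @[x --> b^'+] --> l0 ->
  F x @[x --> +oo] --> l1 ->
  F (b + n.+2%:R) - F (b + n.+1%:R^-1) @[n --> \oo] --> l1 - l0.
Proof.
move=> F0 F1; apply: cvgB.
  apply: (cvg_comp _ _ _ F1).
  apply/cvgryPge => A; near=> n.
  rewrite -lerBlDl (@le_trans _ _ n%:R)//; last by rewrite ler_nat -addn2 leq_addr.
  by near: n; exact: nbhs_infty_ger.
move/cvg_at_rightP : F0; apply; split; first by move=> n; rewrite ltrDl.
rewrite -[X in _ --> X]addr0; apply: cvgD; first exact: cvg_cst.
exact: cvg_harmonic.
Unshelve. all: by end_near. Qed.

(** Exhausting ]b, +oo[ from inside allows integrands that blow up at b. *)
Lemma FTC_halfline b F f l0 l1 :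
  (forall x, b < x -> is_derive x 1 F (f x)) ->
  (forall x, b < x -> {for x, continuous f}) ->
  F x @[x --> b^'+] --> l0 -> F x @[x --> +oo] --> l1 ->
  L1 `]b, +oo[ f -> \int[mu]_(x in `]b, +oo[) f x = l1 - l0.
Proof.
move=> dF cf F0 F1 if_.
have mf := continuous_halfline_measurable cf.
have [|||||_] := @Rdominated_cvg _ _ _ mu `]b, +oo[ (fun n => f \_ (exhaust b n)) f
   (fun x => `|f x|).
- by [].
- move=> n; apply/(measurable_restrict f); [exact: measurable_itv|by []|].
  by apply: measurable_funS mf => //; exact: subIsetl.
- move=> x /=; rewrite in_itv/= andbT => bx; apply: cvg_near_cst.
  near=> n; rewrite patchE mem_set//; near: n; exact: exhaust_near.
- by move=> n x _ /=; rewrite patchE; case: ifP; rewrite ?normr0.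
- exact: integrable_norm.
move=> h; apply/esym; have := exhaust_cvg F0 F1.
move=> /cvg_lim <-//; apply/cvg_lim => //.
apply: cvg_trans h; apply: near_eq_cvg; near=> n.
rewrite -Rintegral_mkcondr setIidr; last exact: exhaust_sub.
by rewrite /Rintegral (FTC_exhaust _ dF cf).
Unshelve. all: by end_near. Qed.

(** For a nonnegative integrand the existence of the two limits of the
    primitive already gives integrability, by monotone convergence. *)
Lemma ge0_FTC_integrable b F f l0 l1 :
  (forall x, b < x -> is_derive x 1 F (f x)) ->
  (forall x, b < x -> {for x, continuous f}) ->
  (forall x, b < x -> 0 <= f x) ->
  F x @[x --> b^'+] --> l0 -> F x @[x --> +oo] --> l1 ->
  L1 `]b, +oo[ f.
Proof.
move=> dF cf f0 F0 F1.
have mf := continuous_halfline_measurable cf.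
apply/integrableP; split; first exact/measurable_EFinP.
have -> : (\int[mu]_(x in `]b, +oo[) `|(EFin \o f) x|
  = \int[mu]_(x in `]b, +oo[) (EFin \o f) x)%E.
  apply: eq_integral => x; rewrite inE/= in_itv/= andbT => bx.
  by rewrite ger0_norm// f0.
have eqU : (`]b, +oo[ = \bigcup_n exhaust b n)%classic.
  apply/seteqP; split => [x /=|x [n _ /exhaust_sub]//].
  rewrite in_itv/= andbT => /exhaust_near[N _ NH].
  by exists N => //; apply: NH => /=.
rewrite eqU.
have := @ge0_nondecreasing_set_cvg_integral _ (measurableTypeR R) R (exhaust b) (EFin \o f) mu.
have Hm : {homo exhaust b : n m / (n <= m)%N >-> (n <= m)%O}.
  move=> n m nm; apply/subsetPset => x; rewrite /exhaust/= !in_itv/=.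
  move=> /andP[h1 h2]; apply/andP; split.
    by rewrite (le_trans _ h1)// lerD2l lef_pV2 ?posrE// ler_nat.
  by rewrite (le_trans h2)// lerD2l ler_nat.
move=> /(_ Hm) h.
have {}h : (\int[mu]_(x in exhaust b i) (EFin \o f) x)%E @[i --> \oo] -->
  (\int[mu]_(x in \bigcup_i exhaust b i) (EFin \o f) x)%E.
  apply: h.
  - by move=> i; exact: measurable_itv.
  - move=> i; apply: (@measurable_funS _ _ _ _ `]b, +oo[) => //.
      exact: exhaust_sub.
    exact/measurable_EFinP.
  - move=> i x /exhaust_sub/=; rewrite in_itv/= andbT => bx.
    by rewrite lee_fin f0.
have h2 : (\int[mu]_(x in exhaust b i) (EFin \o f) x)%E @[i --> \oo] -->
   (l1 - l0)%:E.
  under eq_fun do rewrite (FTC_exhaust _ dF cf).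
  apply: cvg_EFin; first exact: nearW.
  exact: exhaust_cvg.
by rewrite -(cvg_lim _ h)//= (cvg_lim _ h2)//= ltry.
Qed.

Let preimageN : -%R @^-1` `]-oo, (0:R)[%classic = `]0, +oo[%classic.
Proof.
by apply/seteqP; split => x; rewrite /= !in_itv/= ?andbT oppr_lt0.
Qed.

Let line_split : [set: R] = (`]-oo, 0[ `|` `[0, +oo[)%classic.
Proof.
apply/seteqP; split => // x _ /=; rewrite !in_itv/= andbT.
by case: (ltP x 0); [left|right].
Qed.

Let line_disj : [disjoint `]-oo, (0:R)[%classic & `[0, +oo[%classic].
Proof.
apply/disj_setPS => x [] /=; rewrite !in_itv/= andbT => x0.
by rewrite leNgt x0.
Qed.

Let integralN (g : R -> \bar R) (A := `]-oo, (0 : R)[%classic) :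
  (\int[mu]_(x in A) g x = \int[pushforward mu
     (-%R : measurableTypeR R -> measurableTypeR R)]_(x in A) g x)%E.
Proof. by apply: eq_measure_integral => C mC _; exact/esym/lebesgue_measureN. Qed.

Let oppr_mfun : measurable_fun setT (-%R : measurableTypeR R -> measurableTypeR R).
Proof. exact: oppr_measurable. Qed.

(** Lebesgue measure is invariant under reflection, so the negative half-line
    can be folded onto the positive one; the point 0 is negligible. *)
Lemma reflect_integrable f : measurable_fun setT f ->
  L1 `]0, +oo[ f -> L1 `]0, +oo[ (fun x => f (- x)) -> L1 setT f.
Proof.
move=> mf /integrableP[_ fp] /integrableP[_ fn].
have mnf : measurable_fun setT (fun x => `|(f x)%:E|)%E.
  by apply: measurableT_comp => //; exact/measurable_EFinP.
apply/integrableP; split; first exact/measurable_EFinP.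
rewrite line_split ge0_integral_setU//=; first last.
  exact: measurable_funTS.
apply: lte_add_pinfty; last first.
  by rewrite -integral_itv_obnd_cbnd//; exact: measurable_funTS.
rewrite integralN (@ge0_integral_pushforward _ _ _ _ _ _ oppr_mfun mu) ?preimageN//.
exact: measurable_funTS.
Qed.

Lemma reflect_Rintegral f : L1 setT f ->
  \int[mu]_x f x = \int[mu]_(x in `]0, +oo[) (f x + f (- x)).
Proof.
move=> if_; have mf := integrable_measurable if_.
have ifS A : measurable A -> L1 A f by move=> mA; exact: integrableS if_.
have ifN : L1 `]0, +oo[ (fun x => f (- x)).
  apply/integrableP; split.
    apply/measurable_EFinP/measurable_funTS.
    exact: (measurableT_comp mf oppr_mfun).
  have /integrableP[_] : L1 `]-oo, 0[ f by apply: ifS.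
  rewrite integralN (@ge0_integral_pushforward _ _ _ _ _ _ oppr_mfun mu) ?preimageN//.
  apply: measurable_funTS; apply: measurableT_comp => //.
  exact/measurable_EFinP.
rewrite RintegralD//; last exact: ifS.
rewrite [in LHS]line_split Rintegral_setU//; last by rewrite -line_split.
rewrite addrC; congr (_ + _).
  by rewrite -Rintegral_itv_obnd_cbnd//; apply: ifS.
rewrite {1}/Rintegral integralN (@integral_pushforward _ _ _ _ _ _ oppr_mfun mu) ?preimageN//.
exact/measurable_EFinP.
Qed.

End half_line.

(** * Powers and exponentials *)

Section powers.
Context {R : realType}.
Local Notation mu := (@lebesgue_measure R).
Local Notation L1 A f := (mu.-integrable A (EFin \o f)).
Implicit Types (m r kappa alpha x : R).

Lemma powR_cvgy0 r : 0 < r -> x `^ (- r) @[x --> +oo] --> (0 : R).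
Proof.
move=> r0; apply/cvgrPdist_le => e e0; near=> x.
have x0 : 0 < x by near: x; exact: nbhs_pinfty_gt.
rewrite sub0r normrN ger0_norm ?powR_ge0//.
have hx : e `^ (- r^-1) <= x by near: x; exact: nbhs_pinfty_ge.
have : (e `^ (- r^-1)) `^ r <= x `^ r.
  by apply: ge0_ler_powR; rewrite ?nnegrE ?powR_ge0 ?(ltW x0) ?(ltW r0).
rewrite -powRrM mulNr mulVf ?gt_eqF// (powR_inv1 (ltW e0)) powRN => h.
by rewrite -[leRHS]invrK lef_pV2 ?posrE ?invr_gt0 ?powR_gt0.
Unshelve. all: by end_near. Qed.

Lemma powRDpos x m r : 0 < x -> x `^ (m + r) = x `^ m * x `^ r.
Proof. by move=> x0; rewrite powRD// (gt_eqF x0) implybT. Qed.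

(** One term of the exponential series beats any power; the second summand
    makes the bound trivial on ]0, 1], where x^m may be unbounded. *)
Lemma powR_expR_bound alpha kappa m : 0 < alpha -> 0 < kappa ->
  exists2 C, 0 < C & forall x, 0 < x -> x `^ m <= C * expR (kappa * x `^ alpha)
    + (x <= 1)%R%:R * x `^ m.
Proof.
move=> a0 k0; pose n := (Num.truncn (`|m| / alpha)).
have hn : m <= n.+1%:R * alpha.
  rewrite -ler_pdivrMr// ltW//; apply: le_lt_trans (truncnS_gt _).
  by rewrite ler_pM2r ?invr_gt0// ler_norm.
exists (n.+1`!%:R / kappa ^+ n.+1).
  by rewrite divr_gt0 ?exprn_gt0// ltr0n fact_gt0.
move=> x x0; have [x1|x1] := leP x 1.
  rewrite mul1r lerDr mulr_ge0 ?expR_ge0// divr_ge0 ?exprn_ge0//.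
  exact: ltW.
rewrite mul0r addr0.
apply: (@le_trans _ _ (x `^ (n.+1%:R * alpha))).
  by apply: ler_powR => //; exact: ltW.
rewrite mulrC powRrM powR_mulrn ?powR_ge0//.
have y0 : 0 <= kappa * x `^ alpha by rewrite mulr_ge0 ?powR_ge0// ltW.
have := expR_ge1Dxn n y0 => h.
have {}h : (kappa * x `^ alpha) ^+ n.+1 / n.+1`!%:R <= expR (kappa * x `^ alpha).
  by rewrite (le_trans _ h)// lerDr.
rewrite mulrAC ler_pdivlMr ?exprn_gt0//.
rewrite -exprMn [_ * kappa]mulrC -ler_pdivrMl ?ltr0n ?fact_gt0//.
by rewrite [X in X <= _]mulrC.
Qed.

Lemma is_derive_powR_pos m x : 0 < x ->
  is_derive x 1 (fun y => y `^ m) (m * x `^ (m - 1)).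
Proof. exact: is_derive1_powR. Qed.

Lemma continuous_powR m x : 0 < x -> {for x, continuous (fun y => y `^ m)}.
Proof.
move=> x0; have [+ _] := is_derive_powR_pos m x0.
by move=> /derivable1_diffP/differentiable_continuous.
Qed.

(** This integrand is the exact derivative of a bounded function: it behaves
    like x^m at 0 and is integrable at infinity. *)
Lemma bump_integral q m : 0 < q -> -1 < m ->
  L1 `]0, +oo[ (fun x => x `^ m / (1 + x `^ (m + 1) / q) ^+ 2) /\
  \int[mu]_(x in `]0, +oo[) (x `^ m / (1 + x `^ (m + 1) / q) ^+ 2) = q / (m + 1).
Proof.
move=> q0 m1; have m0 : 0 < m + 1 by lra.
have den0 x : 1 + x `^ (m + 1) / q != 0.
  by rewrite gt_eqF// ltr_wpDr// divr_ge0 ?powR_ge0// ltW.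
pose F x := - (q / (m + 1)) * (1 + x `^ (m + 1) / q)^-1.
pose f x := x `^ m / (1 + x `^ (m + 1) / q) ^+ 2.
have dF x : 0 < x -> is_derive x 1 F (f x).
  move=> x0; have := is_derive_powR_pos (m + 1) x0 => dp.
  apply: is_derive_eq; rewrite /GRing.scale/= addrK /f.
  have z0 : 0 <= x `^ (m + 1) by exact: powR_ge0.
  by field; rewrite !gt_eqF//= ltr_wpDr.
have cf x : 0 < x -> {for x, continuous f}.
  move=> x0; apply: cvgM; first exact: continuous_powR.
  apply: cvgV; first by rewrite expf_neq0.
  apply: (@continuous_comp _ _ _ (fun x : R => 1 + x `^ (m + 1) / q) (fun y => y ^+ 2)).
    by apply: cvgD; [exact: cvg_cst|apply: cvgMl; exact: continuous_powR].
  exact: exprn_continuous.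
have f0 x : 0 < x -> 0 <= f x by move=> x0; rewrite divr_ge0 ?powR_ge0 ?sqr_ge0.
have F0 : F x @[x --> 0^'+] --> - (q / (m + 1)) * (1 + 0 / q)^-1.
  apply: cvgMr; apply: cvgV; first by rewrite mul0r addr0 oner_eq0.
  apply: cvgD; first exact: cvg_cst.
  by apply: cvgMl; exact: powR_cvg0.
have F1 : F x @[x --> +oo] --> - (q / (m + 1)) * 0.
  apply: cvgMr; apply/cvgrPdist_le => e e0; near=> x.
  have x0 : 0 < x by near: x; exact: nbhs_pinfty_gt.
  have : `|0 - x `^ (- (m + 1))| <= e / q.
    by near: x; have /cvgrPdist_le := powR_cvgy0 m0; apply; rewrite divr_gt0.
  rewrite !sub0r !normrN ger0_norm ?powR_ge0// powRN ler_pdivlMr//.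
  have zq : 0 < x `^ (m + 1) / q by rewrite divr_gt0 ?powR_gt0.
  rewrite ger0_norm; last by rewrite invr_ge0 addr_ge0// (ltW zq).
  apply: le_trans; rewrite -[X in _ <= _ * X]invrK -invfM.
  by rewrite lef_pV2 ?posrE ?ltr_wpDl// lerDr.
have int := ge0_FTC_integrable dF cf f0 F0 F1.
split => //; rewrite (FTC_halfline dF cf F0 F1 int).
by rewrite mul0r addr0 invr1; ring.
Unshelve. all: by end_near. Qed.

Lemma powR_expR_integrable alpha kappa m : 0 < alpha -> 0 < kappa -> -1 < m ->
  L1 `]0, +oo[ (fun x => x `^ m * expR (- (kappa * x `^ alpha))).
Proof.
move=> a0 k0 m1; have m0 : 0 < m + 1 by lra.
have [C C0 hC] := powR_expR_bound (2 * (m + 1)) a0 k0.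
have mf : measurable_fun `](0:R), +oo[ (fun x => x `^ m * expR (- (kappa * x `^ alpha))).
  apply: continuous_halfline_measurable => x x0; apply: cvgM.
    exact: continuous_powR.
  apply: continuous_comp; last exact: continuous_expR.
  by apply: cvgN; apply: cvgMr; exact: continuous_powR.
apply: (@le_Rintegrable _ _ _ mu _ _ (fun x => (2 * (C + 2)) *
    (x `^ m / (1 + x `^ (m + 1) / 1) ^+ 2))) => //; last first.
  by apply: RintegrableZ => //; have [] := bump_integral ltr01 m1.
move=> x /=; rewrite in_itv/= andbT => x0.
rewrite ger0_norm ?mulr_ge0 ?powR_ge0 ?expR_ge0// mulrCA.
rewrite ler_wpM2l ?powR_ge0// divr1.
set z := x `^ (m + 1); have z0 : 0 <= z by exact: powR_ge0.
rewrite ler_pdivlMr ?exprn_gt0 ?ltr_wpDr//.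
rewrite expRN mulrC ler_pdivrMr ?expR_gt0//.
have := hC _ x0.
rewrite mulrC powRrM -/z (powR_mulrn 2)// => h.
have h1 : (x <= 1)%R%:R * z ^+ 2 <= 1.
  have [x1|] := leP x 1; last by rewrite mul0r.
  rewrite mul1r expr_le1// -[leRHS](powRr0 x).
  by apply: ger_powR; rewrite ?x0//= ltW.
have e1 : 1 <= expR (kappa * x `^ alpha).
  by rewrite -expR0 ler_expR mulr_ge0 ?powR_ge0// ltW.
have : z ^+ 2 <= C * expR (kappa * x `^ alpha) + 1 by lra.
have : (z - 1) ^+ 2 >= 0 by exact: sqr_ge0.
nra.
Qed.

Lemma tail_powR_integral b m : 0 < b -> m < -1 ->
  L1 `]b, +oo[ (fun x => x `^ m) /\
  \int[mu]_(x in `]b, +oo[) (x `^ m) = b `^ (m + 1) / - (m + 1).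
Proof.
move=> b0 m1.
have dF x : b < x -> is_derive x 1 (fun x => (m + 1)^-1 * x `^ (m + 1)) (x `^ m).
  move=> bx; have dp := is_derive_powR_pos (m + 1) (lt_trans b0 bx).
  apply: is_derive_eq; rewrite /GRing.scale/= addrK; field; lra.
have cf x : b < x -> {for x, continuous (fun x => x `^ m)}.
  by move=> bx; apply: continuous_powR; exact: lt_trans bx.
have F0 : ((m + 1)^-1 * x `^ (m + 1)) @[x --> b^'+] --> (m + 1)^-1 * b `^ (m + 1).
  apply: cvgMr; apply: cvg_at_right_filter; exact: continuous_powR.
have F1 : ((m + 1)^-1 * x `^ (m + 1)) @[x --> +oo] --> (m + 1)^-1 * 0.
  by apply: cvgMr; rewrite -(opprK (m + 1)); apply: powR_cvgy0; lra.
have int : L1 `]b, +oo[ (fun x => x `^ m).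
  by apply: (ge0_FTC_integrable dF cf _ F0 F1) => x _; exact: powR_ge0.
split => //; rewrite (FTC_halfline dF cf F0 F1 int).
by field; lra.
Qed.

(** On ]0, b] the bump with q = b^(m + 1) is at least a quarter of x^m. *)
Lemma head_powR_integral b m : 0 < b -> -1 < m ->
  L1 `]0, b] (fun x => x `^ m) /\
  \int[mu]_(x in `]0, b]) (x `^ m) <= 4 * (b `^ (m + 1) / (m + 1)).
Proof.
move=> b0 m1; have q0 : 0 < b `^ (m + 1) by rewrite powR_gt0.
have [int intE] := bump_integral q0 m1.
set g := fun x => _ in int; rewrite -/g in intE.
have sub : `](0:R), b] `<=` `]0, +oo[.
  by move=> x; rewrite /= !in_itv/= => /andP[->].
have int4 : L1 `]0, b] (fun x => 4 * g x).
  apply: RintegrableZ => //; apply: integrableS int => //; exact: measurable_itv.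
have g0 x : 0 <= g x by rewrite divr_ge0 ?powR_ge0 ?sqr_ge0.
have le x : `](0:R), b]%classic x -> `|x `^ m| <= 4 * g x.
  rewrite /= in_itv/= => /andP[x0 xb]; rewrite ger0_norm ?powR_ge0// /g mulrCA.
  rewrite ler_peMr ?powR_ge0// ler_pdivlMr ?mul1r; last first.
    by rewrite exprn_gt0// ltr_wpDr// divr_ge0 ?powR_ge0.
  set z := _ / _; have z0 : 0 <= z by rewrite divr_ge0 ?powR_ge0.
  have z1 : z <= 1.
    rewrite ler_pdivrMr// mul1r; apply: ge0_ler_powR; rewrite ?nnegrE; lra.
  by nra.
have mf : measurable_fun `](0:R), b] (fun x => x `^ m).
  by apply: measurable_funTS; exact: measurable_powR.
split; first exact: (@le_Rintegrable _ _ _ mu _ _ _ (measurable_itv _) mf le int4).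
apply: (@le_trans _ _ (\int[mu]_(x in `]0, b]) (4 * g x))).
  apply: le_trans (@normr_Rintegral_le _ _ _ mu _ _ _ (measurable_itv _) mf le int4).
  exact: ler_norm.
rewrite RintegralZl//; last first.
  by apply: integrableS int => //; exact: measurable_itv.
rewrite ler_wpM2l// -intE.
by apply: subset_Rintegral_le => //; exact: measurable_itv.
Qed.

Lemma weight_integrable alpha : 1 < alpha ->
  L1 setT (fun x => (1 + `|x|) `^ (- alpha)).
Proof.
move=> a1.
have ipos : L1 `]0, +oo[ (fun x => (1 + `|x|) `^ (- alpha)).
  have /= h := @ge0_FTC_integrable _ 0
    (fun x => (1 - alpha)^-1 * (1 + x) `^ (1 - alpha)) (fun x => (1 + x) `^ (- alpha))
    ((1 - alpha)^-1 * (1 + 0) `^ (1 - alpha)) ((1 - alpha)^-1 * 0).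
  apply: (@le_Rintegrable _ _ _ mu _ _ (fun x => (1 + x) `^ (- alpha))) => //.
  + apply: continuous_halfline_measurable => x x0.
    apply: (@continuous_comp _ _ _ (fun x : R => 1 + `|x|) (fun y => y `^ (- alpha))).
      by apply: cvgD; [exact: cvg_cst|exact: norm_continuous].
    by apply: continuous_powR; rewrite ltr_wpDr.
  + by move=> x /=; rewrite in_itv/= andbT => x0; rewrite (gtr0_norm x0) ger0_norm ?powR_ge0.
  + apply: h => [x x0|x x0|x x0||].
    * have dp := @is_derive_powR_pos (1 - alpha) (1 + x) ltac:(lra).
      have d1 : is_derive x 1 (fun x : R => 1 + x) 1.
        by apply: is_derive_eq; rewrite add0r mulr1.
      have := @is_derive1_comp _ (fun y => y `^ (1 - alpha)) (fun x => 1 + x) x _ _ dp d1.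
      move=> dc; apply: is_derive_eq; rewrite /GRing.scale/=.
      rewrite mulr1 (_ : 1 - alpha - 1 = - alpha); last lra.
      by field; lra.
    * apply: (@continuous_comp _ _ _ (fun x : R => 1 + x) (fun y => y `^ (- alpha))).
        by apply: cvgD; [exact: cvg_cst|exact: cvg_id].
      by apply: continuous_powR; lra.
    * exact: powR_ge0.
    * apply: cvgMr; apply: cvg_at_right_filter.
      apply: (@continuous_comp _ _ _ (fun x : R => 1 + x) (fun y => y `^ (1 - alpha))).
        by apply: cvgD; [exact: cvg_cst|exact: cvg_id].
      by apply: continuous_powR; lra.
    * apply: cvgMr.
      apply: (@cvg_comp _ _ _ (fun x : R => 1 + x) (fun y => y `^ (1 - alpha)) _ +oo%R).
        apply/cvgryPge => A; near=> x; rewrite -lerBlDl.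
        by near: x; apply: nbhs_pinfty_ge; exact: num_real.
      by rewrite -(opprK (1 - alpha)); apply: powR_cvgy0; lra.
apply: reflect_integrable => //.
- apply: continuous_measurable_fun => x.
  apply: (@continuous_comp _ _ _ (fun x : R => 1 + `|x|) (fun y => y `^ (- alpha))).
    by apply: cvgD; [exact: cvg_cst|exact: norm_continuous].
  by apply: continuous_powR; rewrite ltr_wpDr.
- by under [X in EFin \o X]eq_fun do rewrite normrN.
Unshelve. all: by end_near. Qed.

End powers.

(** * Differentiation under the integral sign *)

Section derivative_of_integral.
Context d (T : measurableType d) (R : realType) (mu : {measure set T -> \bar R}).
Local Notation L1 A f := (mu.-integrable A (EFin \o f)).

Lemma is_derive_Rintegral (A : set T) (f df : R -> T -> R) (G : T -> R)
    (u v x : R) : measurable A -> u < x < v ->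
  (forall y t, u < y < v -> A t -> is_derive y 1 (f ^~ t) (df y t)) ->
  (forall y, u < y < v -> L1 A (f y)) ->
  (forall y t, u < y < v -> A t -> `|df y t| <= G t) -> L1 A G ->
  is_derive x 1 (fun y => \int[mu]_(t in A) f y t) (\int[mu]_(t in A) df x t).
Proof.
move=> mA xuv df_ if_ dfG iG.
have itv y : `]u, v[%classic y <-> u < y < v by rewrite /= in_itv/=.
have d1 y t : u < y < v -> A t -> partial1of2 f y t = df y t.
  by move=> yuv At; rewrite partial1of2E; have [_ ->] := df_ _ _ yuv At.
have Ix : `]u, v[%classic x by exact/itv.
have if' y : `]u, v[%classic y -> L1 A (f y) by move=> /itv; exact: if_.
have derf y t : `]u, v[%classic y -> A t -> derivable (f ^~ t) y 1.
  by move=> /itv yuv At; have [] := df_ _ _ yuv At.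
have ub y t : `]u, v[%classic y -> A t -> `|partial1of2 f y t| <= `|G t|.
  by move=> /itv yuv At; rewrite d1// (le_trans (dfG _ _ yuv At))// ler_norm.
have h := @cvg_differentiation_under_integral R _ _ mu f A mA x u v Ix if' derf
  (fun t => `|G t|) (fun t => normr_ge0 _) (integrable_norm iG) ub.
have -> : \int[mu]_(t in A) df x t = \int[mu]_(t in A) partial1of2 f x t.
  by apply: eq_Rintegral => t; rewrite inE => At; rewrite d1.
have h2 : e^-1 *: (\int[mu]_(t in A) f (e *: 1 + x) t - \int[mu]_(t in A) f x t)
    @[e --> 0^'] --> \int[mu]_(t in A) partial1of2 f x t.
  by under eq_fun do rewrite {2}/GRing.scale/= mulr1.
split; first by apply/cvg_ex; eexists; exact: h2.
by rewrite /derive; apply/cvg_lim => //; exact: h2.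
Qed.

End derivative_of_integral.

(** * Series as integrals over the counting measure *)

Section series_as_integral.
Context {R : realType}.
Local Notation count := (@counting nat R).
Local Notation L1 a := (count.-integrable setT (EFin \o a)).
Implicit Types a M : nat -> R.

Lemma nneseries_lim a : (forall k, 0 <= a k) -> cvgn (series a) ->
  (\sum_(0 <= k <oo) (a k)%:E = (limn (series a))%:E)%E.
Proof.
move=> a0 ca; rewrite -EFin_lim//; congr (limn _); apply/funext => n /=.
by rewrite /series/= sumEFin.
Qed.

Lemma series_integrable a : cvgn (series (fun k => `|a k|)) -> L1 a.
Proof.
move=> ca; apply/integrableP; split => //.
rewrite ge0_integral_count//.
by rewrite (@nneseries_lim (fun k => `|a k|))//= ltry.
Qed.

Lemma series_Rintegral a : cvgn (series (fun k => `|a k|)) ->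
  \int[count]_k a k = limn (series a).
Proof.
move=> ca; rewrite /Rintegral.
have sa : summable setT (EFin \o a).
  rewrite /summable (_ : setT = [set x | predT x])//; last exact/seteqP.
  rewrite -(@nneseries_esum _ _ predT)//.
  by rewrite (@nneseries_lim (fun k => `|a k|))//= ltry.
rewrite (integral_count sa).
have ca' := normed_cvg ca.
rewrite (_ : (\sum_(0 <= k <oo) _)%E = (limn (series a))%:E)//.
rewrite -EFin_lim//; congr (limn _); apply/funext => n /=.
by rewrite /series/= sumEFin.
Qed.

Lemma le_cvg_series a M : (forall k, `|a k| <= M k) -> cvgn (series M) ->
  cvgn (series (fun k => `|a k|)).
Proof.
move=> aM; apply: series_le_cvg => // k.
by rewrite (le_trans _ (aM k)).
Qed.

Lemma normr_lim_series_le a M : (forall k, `|a k| <= M k) -> cvgn (series M) ->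
  `|limn (series a)| <= limn (series M).
Proof.
move=> aM cM; have ca := le_cvg_series aM cM.
apply: (le_trans (lim_series_norm ca)).
exact: lim_series_le.
Qed.

(** Termwise differentiation, as differentiation under the integral sign for
    the counting measure. *)
Lemma is_derive_series (f df : nat -> R -> R) M (u v x : R) : u < x < v ->
  (forall k y, u < y < v -> is_derive y 1 (f k) (df k y)) ->
  (forall y, u < y < v -> cvgn (series (fun k => `|f k y|))) ->
  (forall k y, u < y < v -> `|df k y| <= M k) -> cvgn (series M) ->
  is_derive x 1 (fun y => limn (series (f ^~ y))) (limn (series (df ^~ x))).
Proof.
move=> xuv df_ cf dfM cM.
have M0 k : 0 <= M k by rewrite (le_trans _ (dfM k x xuv)).
have cdf y : u < y < v -> cvgn (series (fun k => `|df k y|)).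
  by move=> yuv; apply: (@le_cvg_series _ M) => // k; exact: dfM.
rewrite -series_Rintegral; last exact: cdf.
apply: (@near_eq_is_derive _ _ _ (fun y => \int[count]_k f k y)).
  near=> y; apply: series_Rintegral; apply: cf.
  near: y; have : x \in `]u, v[ by rewrite in_itv/=.
  by move=> /near_in_itvoo; apply: filterS => y; rewrite in_itv.
apply: (is_derive_Rintegral (mu := count) (f := fun y k => f k y)
  (df := fun y k => df k y) (G := M) measurableT xuv).
- by move=> y k yuv _; exact: df_.
- by move=> y yuv; apply: series_integrable; exact: cf.
- by move=> y k yuv _; exact: dfM.
- by apply: series_integrable; under eq_fun do rewrite ger0_norm//.
Unshelve. all: by end_near. Qed.

End series_as_integral.

Section dominated_series.
Context d (T : measurableType d) (R : realType) (mu : {measure set T -> \bar R}).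
Local Notation L1 A f := (mu.-integrable A (EFin \o f)).

Lemma series_sumE (f : nat -> T -> R) n x :
  series (f ^~ x) n.+1 = series (f ^~ x) n + f n x.
Proof. by rewrite /series/= big_nat_recr. Qed.

Lemma Rintegral_partial_sum (A : set T) (f : nat -> T -> R) n : measurable A ->
  (forall k, L1 A (f k)) ->
  L1 A (fun x => series (f ^~ x) n) /\
  \int[mu]_(x in A) series (f ^~ x) n
    = series (fun k => \int[mu]_(x in A) f k x) n.
Proof.
move=> mA if_; elim: n => [|n [ih1 ih2]].
  have -> : (fun x => series (f ^~ x) 0%N) = fun=> 0.
    by apply/funext => x; rewrite /series/= big_geq.
  split; first exact: integrable0.
  by rewrite Rintegral_cst// mul0r /series/= big_geq.
have E : (fun x => series (f ^~ x) n.+1) = (fun x => series (f ^~ x) n + f n x).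
  by apply/funext => x; rewrite series_sumE.
split; first by rewrite E; exact: RintegrableD.
by rewrite E RintegralD// ih2 [RHS]/series/= big_nat_recr.
Qed.

(** Dominated convergence of the partial sums, under the total of M times w.
    *)
Lemma Rintegral_series (A : set T) (f : nat -> T -> R) (M : nat -> R) (w : T -> R) :
  measurable A -> (forall k, measurable_fun A (f k)) ->
  (forall k x, A x -> `|f k x| <= M k * w x) -> cvgn (series M) ->
  (forall k, 0 <= M k) -> L1 A w ->
  L1 A (fun x => limn (series (f ^~ x))) /\
  series (fun k => \int[mu]_(x in A) f k x) @ \oo -->
    \int[mu]_(x in A) limn (series (f ^~ x)).
Proof.
move=> mA mf fM cM M0 iw.
have if_ k : L1 A (f k).
  apply: (@le_Rintegrable _ _ _ mu _ _ (fun x => M k * w x)) => //.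
  - by move=> x Ax; exact: fM.
  - exact: RintegrableZ.
have part n := Rintegral_partial_sum n mA if_.
have cMx x : cvgn (series (fun k => M k * w x)).
  rewrite (_ : series _ = (fun n => series M n * w x)); last first.
    by apply/funext => n; rewrite /series/= mulr_suml.
  exact: is_cvgMl.
have abs x : A x -> cvgn (series (fun k => `|f k x|)).
  by move=> Ax; apply: (@le_cvg_series _ _ (fun k => M k * w x)) => // k; exact: fM.
have [||||iS cS] := @Rdominated_cvg _ _ _ mu A (fun n x => series (f ^~ x) n)
   (fun x => limn (series (f ^~ x))) (fun x => limn (series M) * w x) mA.
- by move=> n; apply: integrable_measurable (part n).1.
- by move=> x Ax; apply: normed_cvg; exact: abs.
- move=> n x Ax; apply: (@le_trans _ _ (series M n * w x)).
    rewrite /series/= mulr_suml; apply: le_trans (ler_norm_sum _ _ _) _.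
    by apply: ler_sum => k _; exact: fM.
  have [w0|w0] := ltP (w x) 0; last first.
    by rewrite ler_wpM2r//; apply: nondecreasing_cvgn_le => //; exact: nondecreasing_series.
  (* w x may be negative only if every M k vanishes *)
  have Mz k : M k = 0.
    have := fM k x Ax; move/(le_trans (normr_ge0 _)) => h.
    by apply/eqP; rewrite eq_le M0 andbT; rewrite nmulr_lge0 in h.
  have -> : series M = fun=> 0 by apply/funext => m; rewrite /series/= big1.
  by rewrite lim_cst.
- exact: RintegrableZ.
split => //; apply: cvg_trans cS; apply: near_eq_cvg; near=> n.
by rewrite (part n).2.
Unshelve. all: by end_near. Qed.

End dominated_series.

Section poly_geometric.
Context {R : realType}.

(** Bounding r by e^{-b}, half of the exponent absorbs the polynomial and
    e^{-b/2} remains as the ratio of a geometric series. The maximum with 1/2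
    keeps b finite when r = 0. *)
Lemma poly_geometric_cvg (r C : R) n : 0 <= r < 1 -> 0 <= C ->
  cvgn (series (fun k => (k%:R + C) ^+ n * r ^+ k)).
Proof.
move=> /andP[r0 r1] C0; pose b := - ln (Num.max r 2^-1).
have m0 : 0 < Num.max r 2^-1 by rewrite lt_max; apply/orP; right; lra.
have m1 : Num.max r 2^-1 < 1 by rewrite gt_max r1/=; lra.
have b0 : 0 < b by rewrite oppr_gt0 ln_lt0// m0.
pose K := n`!%:R * (2 / b) ^+ n * expR (b / 2 * C).
apply: (@series_le_cvg _ _ (geometric K (expR (- (b / 2))))).
- by move=> k; rewrite mulr_ge0 ?exprn_ge0// addr_ge0.
- move=> k; rewrite /geometric/= !mulr_ge0 ?exprn_ge0 ?expR_ge0//.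
  by rewrite divr_ge0// ltW.
- move=> k; rewrite /geometric/=.
  have h1 : r ^+ k <= expR (- b * k%:R).
    rewrite expRM_natr /b opprK lnK ?posrE//.
    by rewrite lerXn2r ?nnegrE ?(ltW m0)// le_max lexx.
  pose y := b / 2 * (k%:R + C).
  have y0 : 0 <= y by rewrite mulr_ge0 ?addr_ge0// divr_ge0// ltW.
  have h2 : y ^+ n <= n`!%:R * expR y.
    case: (n) => [|j]; first by rewrite expr0 mul1r -expR0 ler_expR.
    rewrite -ler_pdivrMl ?ltr0n ?fact_gt0// mulrC.
    by rewrite (le_trans _ (expR_ge1Dxn j y0))// lerDr.
  have h3 : (k%:R + C) ^+ n <= (2 / b) ^+ n * (n`!%:R * expR y).
    have -> : k%:R + C = (2 / b) * y by rewrite /y; field; lra.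
    by rewrite exprMn ler_wpM2l// exprn_ge0// divr_ge0// ltW.
  apply: (@le_trans _ _ ((2 / b) ^+ n * (n`!%:R * expR y) * expR (- b * k%:R))).
    by apply: ler_pM => //; rewrite ?exprn_ge0// addr_ge0.
  rewrite -expRM_natr /K (_ : y = b / 2 * C + b / 2 * k%:R); last by rewrite /y; ring.
  rewrite expRD (_ : - (b / 2) * k%:R = b / 2 * k%:R + (- b * k%:R)); last by field.
  by rewrite expRD le_eqVlt; apply/orP; left; apply/eqP; ring.
- apply: is_cvg_geometric_series.
  by rewrite ger0_norm ?expR_ge0// expR_lt1 oppr_lt0 divr_gt0.
Qed.

End poly_geometric.

(** * Oscillatory kernels of the stable laws *)

Section stable_kernels.
Context {R : realType}.
Local Notation mu := (@lebesgue_measure R).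
Local Notation L1 A f := (mu.-integrable A (EFin \o f)).
Variables alpha omega : R.
Implicit Types m s phi x xi b : R.

Definition envelope m s xi : R := xi `^ m * expR (- (s * cos omega * xi `^ alpha)).

Definition phase s phi x xi : R := x * xi + s * sin omega * xi `^ alpha + phi.

(** For m > -1, s > 0 this is the real part of the half-line integral of
    xi^m exp(- i phi - i x xi - s e^{i omega} xi^alpha). *)
Definition kernel m s phi x : R :=
  \int[mu]_(xi in `]0, +oo[) (envelope m s xi * cos (phase s phi x xi)).

Definition envelope_mass m s : R := \int[mu]_(xi in `]0, +oo[) envelope m s xi.

Hypothesis alpha12 : 1 < alpha <= 2.
Hypothesis cos_gt0 : 0 < cos omega.

Let alpha_gt0 : 0 < alpha. Proof. by case/andP: alpha12; lra. Qed.

Lemma envelope_ge0 m s xi : 0 <= envelope m s xi.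
Proof. by rewrite mulr_ge0 ?powR_ge0 ?expR_ge0. Qed.

Lemma envelope_integrable m s : -1 < m -> 0 < s -> L1 `]0, +oo[ (envelope m s).
Proof. by move=> m1 s0; apply: powR_expR_integrable => //; rewrite mulr_gt0. Qed.

Lemma envelope_anti m s s' xi : s <= s' -> envelope m s' xi <= envelope m s xi.
Proof.
move=> ss; rewrite ler_wpM2l ?powR_ge0// ler_expR lerN2.
by rewrite ler_wpM2r ?powR_ge0// ler_wpM2r// ltW.
Qed.

Lemma envelope_mass_anti m s s' : -1 < m -> 0 < s -> s <= s' ->
  envelope_mass m s' <= envelope_mass m s.
Proof.
move=> m1 s0 ss; apply: le_Rintegral => //.
- by apply: envelope_integrable => //; exact: lt_le_trans ss.
- exact: envelope_integrable.
- by move=> xi _; exact: envelope_anti.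
Qed.

Lemma envelope_mass_ge0 m s : 0 <= envelope_mass m s.
Proof. by apply: Rintegral_ge0 => xi _; exact: envelope_ge0. Qed.

Lemma continuous_envelope m s xi : 0 < xi -> {for xi, continuous (envelope m s)}.
Proof.
move=> xi0; apply: cvgM; first exact: continuous_powR.
apply: continuous_comp; last exact: continuous_expR.
by apply: cvgN; apply: cvgMr; exact: continuous_powR.
Qed.

Lemma continuous_phase s phi x xi : 0 < xi -> {for xi, continuous (phase s phi x)}.
Proof.
move=> xi0; apply: cvgD; last exact: cvg_cst.
by apply: cvgD; apply: cvgMr; [exact: cvg_id|exact: continuous_powR].
Qed.

Lemma continuous_kernel_integrand m s phi x xi : 0 < xi ->
  {for xi, continuous (fun xi => envelope m s xi * cos (phase s phi x xi))}.
Proof.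
move=> xi0; apply: cvgM; first exact: continuous_envelope.
by apply: continuous_comp; [exact: continuous_phase|exact: continuous_cos].
Qed.

Lemma norm_envelope_cos m s xi y : `|envelope m s xi * cos y| <= envelope m s xi.
Proof.
by rewrite normrM (ger0_norm (envelope_ge0 _ _ _)) ler_piMr ?envelope_ge0// cos_max.
Qed.

Lemma kernel_integrand_measurable m s phi x :
  measurable_fun `](0 : R), +oo[ (fun xi => envelope m s xi * cos (phase s phi x xi)).
Proof.
by apply: continuous_halfline_measurable => xi; exact: continuous_kernel_integrand.
Qed.

Lemma kernel_integrand_integrable m s phi x : -1 < m -> 0 < s ->
  L1 `]0, +oo[ (fun xi => envelope m s xi * cos (phase s phi x xi)).
Proof.
move=> m1 s0; apply: (@le_Rintegrable _ _ _ mu _ _ (envelope m s)) => //.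
- exact: kernel_integrand_measurable.
- by move=> xi _; exact: norm_envelope_cos.
- exact: envelope_integrable.
Qed.

Lemma kernel_le m s phi x : -1 < m -> 0 < s -> `|kernel m s phi x| <= envelope_mass m s.
Proof.
move=> m1 s0; apply: normr_Rintegral_le => //.
- exact: kernel_integrand_measurable.
- by move=> xi _; exact: norm_envelope_cos.
- exact: envelope_integrable.
Qed.

Lemma kernel_le_mass m s0 s phi x : -1 < m -> 0 < s0 -> s0 <= s ->
  `|kernel m s phi x| <= envelope_mass m s0.
Proof.
move=> m1 s0_gt0 ss; apply: le_trans (kernel_le _ _ _ _) _ => //.
  exact: lt_le_trans ss.
exact: envelope_mass_anti.
Qed.

Lemma envelopeD m n s xi : 0 < xi -> xi `^ n * envelope m s xi = envelope (m + n) s xi.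
Proof.
by move=> x0; rewrite /envelope mulrA -powRDpos// addrC.
Qed.

Lemma cosDpihalf (y : R) : cos (y + pi / 2) = - sin y.
Proof. by rewrite cosD cos_pihalf sin_pihalf mulr0 mulr1 sub0r. Qed.

Lemma is_derive_cos_comp (g : R -> R) (y dg : R) : is_derive y 1 g dg ->
  is_derive y 1 (fun z => cos (g z)) (cos (g y + pi / 2) * dg).
Proof.
by move=> h; have := is_derive1_comp (@is_derive_cos R (g y)) h; rewrite cosDpihalf.
Qed.

(** Differentiating in x multiplies the frequency side by -i xi. *)
Lemma is_derive_kernel_x m s phi x : -1 < m -> 0 < s ->
  is_derive x 1 (kernel m s phi) (kernel (m + 1) s (phi + pi / 2) x).
Proof.
move=> m1 s0.
apply: (is_derive_Rintegral (mu := mu) (A := `]0, +oo[%classic)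
  (f := fun x xi => envelope m s xi * cos (phase s phi x xi))
  (df := fun x xi => envelope (m + 1) s xi * cos (phase s (phi + pi / 2) x xi))
  (G := envelope (m + 1) s) (u := x - 1) (v := x + 1)).
- exact: measurable_itv.
- lra.
- move=> y xi _; rewrite /= in_itv/= andbT => xi0.
  have dphase : is_derive y 1 (fun y => phase s phi y xi) xi.
    by apply: is_derive_eq; rewrite /GRing.scale/=; ring.
  have dcos := is_derive_cos_comp dphase.
  apply: is_derive_eq; rewrite /GRing.scale/=.
  rewrite -envelopeD// powRr1 ?(ltW xi0)//.
  have -> : phase s (phi + pi / 2) y xi = phase s phi y xi + pi / 2.
    by rewrite /phase addrA.
  by ring.
- by move=> y _; exact: kernel_integrand_integrable.
- by move=> y xi _ _; exact: norm_envelope_cos.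
- by apply: envelope_integrable => //; lra.
Qed.

Lemma continuous_kernel m s phi : -1 < m -> 0 < s -> continuous (kernel m s phi).
Proof.
move=> m1 s0 x; have [+ _] := is_derive_kernel_x phi x m1 s0.
by move=> /derivable1_diffP/differentiable_continuous.
Qed.

(** Differentiating in s multiplies the frequency side by minus xi^alpha times
    a constant phase, which is absorbed in phi. *)
Lemma is_derive_kernel_s m s phi x : -1 < m -> 0 < s ->
  is_derive s 1 (fun s => kernel m s phi x) (- kernel (m + alpha) s (phi - omega) x).
Proof.
move=> m1 s0.
have ma : -1 < m + alpha by have := alpha_gt0; lra.
have -> : - kernel (m + alpha) s (phi - omega) x = \int[mu]_(xi in `]0, +oo[)
    (-1 * (envelope (m + alpha) s xi * cos (phase s (phi - omega) x xi))).
  rewrite RintegralZl// ?mulN1r//.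
  by apply: kernel_integrand_integrable => //; lra.
apply: (is_derive_Rintegral (mu := mu) (A := `]0, +oo[%classic)
  (f := fun s xi => envelope m s xi * cos (phase s phi x xi))
  (df := fun s xi => -1 * (envelope (m + alpha) s xi *
                      cos (phase s (phi - omega) x xi)))
  (G := envelope (m + alpha) (s / 2)) (u := s / 2) (v := s + 1)).
- exact: measurable_itv.
- lra.
- move=> y xi _; rewrite /= in_itv/= andbT => xi0.
  have dphase : is_derive y 1 (fun s => phase s phi x xi) (sin omega * xi `^ alpha).
    by apply: is_derive_eq; rewrite /GRing.scale/=; ring.
  have dcos := is_derive_cos_comp dphase.
  have darg : is_derive y 1 (fun s => - (s * cos omega * xi `^ alpha))
      (- (cos omega * xi `^ alpha)).
    by apply: is_derive_eq; rewrite /GRing.scale/=; ring.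
  have dexp := is_derive1_comp (@is_derive_expR R _) darg.
  apply: is_derive_eq; rewrite /GRing.scale/= -envelopeD// /envelope.
  have -> : phase y (phi - omega) x xi = phase y phi x xi - omega.
    by rewrite /phase addrA.
  by rewrite cosB cosDpihalf; ring.
- by move=> y /andP[sy _]; apply: kernel_integrand_integrable => //; lra.
- move=> y xi /andP[sy _] _; rewrite mulN1r normrN.
  by apply: le_trans (norm_envelope_cos _ _ _ _) _; apply: envelope_anti; exact: ltW.
- by apply: envelope_integrable; lra.
Qed.

Definition osc m s phi x xi := envelope m s xi * cos (phase s phi x xi).

Lemma is_derive_osc m s phi x xi : 0 < xi ->
  is_derive xi 1 (osc m s phi x)
    (m * osc (m - 1) s phi x xi + x * osc m s (phi + pi / 2) x xi
     - s * alpha * osc (m + alpha - 1) s (phi - omega) x xi).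
Proof.
move=> xi0; have dm := is_derive_powR_pos m xi0.
have da := is_derive_powR_pos alpha xi0.
have darg : is_derive xi 1 (fun xi => - (s * cos omega * xi `^ alpha))
    (- (s * cos omega * (alpha * xi `^ (alpha - 1)))).
  by apply: is_derive_eq; rewrite /GRing.scale/=; ring.
have dexp := is_derive1_comp (@is_derive_expR R _) darg.
have dphase : is_derive xi 1 (phase s phi x)
    (x + s * sin omega * (alpha * xi `^ (alpha - 1))).
  by apply: is_derive_eq; rewrite /GRing.scale/=; ring.
have dcos := is_derive_cos_comp dphase.
apply: is_derive_eq; rewrite /GRing.scale/= /osc /envelope.
have -> : xi `^ (m + alpha - 1) = xi `^ m * xi `^ (alpha - 1).
  by rewrite -addrA (powRDpos m).
have -> : phase s (phi - omega) x xi = phase s phi x xi - omega.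
  by rewrite /phase addrA.
have -> : phase s (phi + pi / 2) x xi = phase s phi x xi + pi / 2.
  by rewrite /phase addrA.
by rewrite cosB cosDpihalf; ring.
Qed.

Lemma envelope_cvgy m s : 0 < s -> envelope m s xi @[xi --> +oo] --> 0.
Proof.
move=> s0; have k0 : 0 < s * cos omega by rewrite mulr_gt0.
have [C C0 hC] := powR_expR_bound (m + 1) alpha_gt0 k0.
apply/cvgrPdist_le => e e0; near=> xi.
have xi1 : 1 < xi by near: xi; apply: nbhs_pinfty_gt; exact: num_real.
have xiC : C / e <= xi by near: xi; apply: nbhs_pinfty_ge; exact: num_real.
have xi0 : 0 < xi by lra.
rewrite sub0r normrN ger0_norm ?envelope_ge0//.
have := hC _ xi0; rewrite (lt_geF xi1) mul0r addr0 powRDpos//.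
rewrite powRr1 ?(ltW xi0)// => h.
rewrite /envelope expRN ler_pdivrMr ?expR_gt0//.
rewrite -(ler_pM2r xi0); apply: le_trans h _.
rewrite [leRHS]mulrAC ler_wpM2r ?expR_ge0//.
by rewrite mulrC -ler_pdivrMr.
Unshelve. all: by end_near. Qed.

Lemma osc_cvgy m s phi x : 0 < s -> osc m s phi x xi @[xi --> +oo] --> 0.
Proof.
move=> s0; apply: (@squeeze_cvgr _ _ _ _ (fun xi => - envelope m s xi)
  (fun xi => envelope m s xi)).
- by near=> xi; rewrite -ler_norml norm_envelope_cos.
- by rewrite -oppr0; apply: cvgN; exact: envelope_cvgy.
- exact: envelope_cvgy.
Unshelve. all: by end_near. Qed.

Lemma osc_cvg0 m s phi x : 0 < s -> 0 <= m ->
  osc m s phi x xi @[xi --> 0^'+] --> (m == 0)%R%:R * cos phi.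
Proof.
move=> s0 m0.
have ca : xi `^ alpha @[xi --> 0^'+] --> (0 : R) by exact: powR_cvg0.
have cp : phase s phi x xi @[xi --> 0^'+] --> phi.
  have : phase s phi x xi @[xi --> 0^'+] --> x * 0 + s * sin omega * 0 + phi.
    apply: cvgD; last exact: cvg_cst.
    apply: cvgD; apply: cvgMr => //.
    by apply: cvg_at_right_filter; exact: cvg_id.
  by rewrite !mulr0 !add0r.
have ce : expR (- (s * cos omega * xi `^ alpha)) @[xi --> 0^'+] --> (1 : R).
  have cE : - (s * cos omega * xi `^ alpha) @[xi --> 0^'+] --> (0 : R).
    have : - (s * cos omega * xi `^ alpha) @[xi --> 0^'+] --> - (s * cos omega * 0).
      by apply: cvgN; exact: cvgMr.
    by rewrite mulr0 oppr0.
  by rewrite -[X in _ --> X]expR0; apply: (cvg_comp _ _ cE); exact: continuous_expR.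
have cm : xi `^ m @[xi --> 0^'+] --> ((m == 0)%R%:R : R).
  have [->|mn0] := eqVneq m 0.
    by under eq_fun do rewrite powRr0; exact: cvg_cst.
  by apply: powR_cvg0; rewrite lt_neqAle eq_sym mn0.
apply: cvgM; last by apply: (cvg_comp _ _ cp); exact: continuous_cos.
by rewrite -[X in _ --> X]mulr1; apply: cvgM.
Qed.

Lemma osc_integrable_sub b m s phi x : 0 <= b -> -1 < m -> 0 < s ->
  L1 `]b, +oo[ (osc m s phi x).
Proof.
move=> b0 m1 s0; apply: (@integrableS _ _ _ mu `]0, +oo[) => //.
- by move=> y; rewrite /= !in_itv/= !andbT; apply: le_lt_trans.
- exact: kernel_integrand_integrable.
Qed.

(** Integrating the derivative of the integrand over ]b, +oo[; l is its limit
    at b. *)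
Lemma osc_FTC b m s phi x l : 0 <= b -> -1 < m -> 0 < s ->
  L1 `]b, +oo[ (fun xi => m * osc (m - 1) s phi x xi) ->
  osc m s phi x xi @[xi --> b^'+] --> l ->
  x * \int[mu]_(xi in `]b, +oo[) osc m s (phi + pi / 2) x xi
  = s * alpha * \int[mu]_(xi in `]b, +oo[) osc (m + alpha - 1) s (phi - omega) x xi
    - \int[mu]_(xi in `]b, +oo[) (m * osc (m - 1) s phi x xi) - l.
Proof.
move=> b0 m1 s0 i1 cl.
have i2 := osc_integrable_sub (phi + pi / 2) x b0 m1 s0.
have ma : -1 < m + alpha - 1 by case/andP: alpha12; lra.
have i3 := osc_integrable_sub (phi - omega) x b0 ma s0.
have H xi : b < xi -> 0 < xi by apply: le_lt_trans.
have cosc n phi' xi : 0 < xi -> {for xi, continuous (osc n s phi' x)}.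
  exact: continuous_kernel_integrand.
have cf xi : b < xi -> {for xi, continuous (fun xi =>
    m * osc (m - 1) s phi x xi + x * osc m s (phi + pi / 2) x xi
     - s * alpha * osc (m + alpha - 1) s (phi - omega) x xi)}.
  move=> h; apply: cvgB; last by apply: cvgMr; apply: cosc; exact: H.
  by apply: cvgD; apply: cvgMr; apply: cosc; exact: H.
have i2' := @RintegrableZ _ _ _ mu _ _ x (measurable_itv _) i2.
have i3' := @RintegrableZ _ _ _ mu _ _ (s * alpha) (measurable_itv _) i3.
have i12 := @RintegrableD _ _ _ mu _ _ _ (measurable_itv _) i1 i2'.
have i123 := @RintegrableB _ _ _ mu _ _ _ (measurable_itv _) i12 i3'.
have := FTC_halfline (fun xi h => is_derive_osc m s phi x (H _ h)) cf cl
  (osc_cvgy m phi x s0) i123.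
rewrite RintegralB// RintegralD// [X in _ + X - _]RintegralZl// [X in _ - X]RintegralZl// => hE.
lra.
Qed.

(** Integration by parts in the frequency: a factor x differentiates the
    frequency side, which lowers the exponent of the power by 1 or, through
    the exponential, raises it by alpha - 1. *)
Lemma kernel_recurrence m s phi x : 0 < m -> 0 < s ->
  x * kernel m s (phi + pi / 2) x =
  s * alpha * kernel (m + alpha - 1) s (phi - omega) x
  - m * kernel (m - 1) s phi x.
Proof.
move=> m0 s0; have m1 : -1 < m by lra.
have mm : -1 < m - 1 by lra.
have c0 : osc m s phi x xi @[xi --> 0^'+] --> 0.
  by have := @osc_cvg0 _ _ phi x s0 (ltW m0); rewrite (gt_eqF m0) mul0r.
have i1 := osc_integrable_sub phi x (lexx 0) mm s0.
have i1' := @RintegrableZ _ _ _ mu _ _ m (measurable_itv _) i1.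
by rewrite (osc_FTC (lexx 0) m1 s0 i1' c0) RintegralZl// subr0.
Qed.

(** For m = 0 the boundary term at frequency 0 survives. *)
Lemma kernel_recurrence0 s phi x : 0 < s ->
  x * kernel 0 s (phi + pi / 2) x =
  s * alpha * kernel (alpha - 1) s (phi - omega) x - cos phi.
Proof.
move=> s0; have m1 : (-1 : R) < 0 by lra.
have c0 : osc 0 s phi x xi @[xi --> 0^'+] --> cos phi.
  by have := @osc_cvg0 _ _ phi x s0 (lexx 0); rewrite eqxx mul1r.
have i1 : L1 `]0, +oo[ (fun xi => 0 * osc (0 - 1) s phi x xi).
  by under [X in EFin \o X]eq_fun do rewrite mul0r; exact: integrable0.
rewrite (osc_FTC (lexx 0) m1 s0 i1 c0) add0r.
under [X in _ - X - _]eq_Rintegral do rewrite mul0r.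
by rewrite [X in _ - X - _]Rintegral_cst// mul0r subr0.
Qed.

(** On the far half-line ]b, +oo[ the boundary term and the singular term are
    each of size b^m, also for the exponents m <= 0 of kernels whose symbol is
    singular at frequency 0. *)
Lemma far_part_le b m s phi x : 0 < b -> -1 < m <= 0 -> 0 < s ->
  `|x| * `|\int[mu]_(xi in `]b, +oo[) osc m s (phi + pi / 2) x xi|
  <= s * alpha * envelope_mass (m + alpha - 1) s + 2 * b `^ m.
Proof.
move=> b0 /andP[m1 m0] s0; have ma : -1 < m + alpha - 1 by case/andP: alpha12; lra.
have sa0 : 0 <= s * alpha by rewrite mulr_ge0// ltW.
have osc_le n phi' xi : `|osc n s phi' x xi| <= xi `^ n.
  apply: le_trans (norm_envelope_cos _ _ _ _) _.
  rewrite /envelope ler_piMr ?powR_ge0// -expR0 ler_expR oppr_le0.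
  by rewrite mulr_ge0 ?powR_ge0// mulr_ge0 ?ltW.
have oscm n phi' : measurable_fun `]b, +oo[ (osc n s phi' x).
  apply: continuous_halfline_measurable => xi bxi.
  by apply: continuous_kernel_integrand; exact: lt_trans bxi.
have [i1 h1] : L1 `]b, +oo[ (fun xi => m * osc (m - 1) s phi x xi) /\
    `|\int[mu]_(xi in `]b, +oo[) (m * osc (m - 1) s phi x xi)| <= b `^ m.
  have [->|mn0] := eqVneq m 0.
    under [X in EFin \o X]eq_fun do rewrite mul0r.
    split; first exact: integrable0.
    under eq_Rintegral do rewrite mul0r.
    by rewrite Rintegral_cst// mul0r normr0 powR_ge0.
  have mlt : m < 0 by rewrite lt_neqAle mn0.
  have [it itE] := @tail_powR_integral _ b (m - 1) b0 ltac:(lra).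
  have itm := @RintegrableZ _ _ _ mu _ _ (- m) (measurable_itv _) it.
  have mf : measurable_fun `]b, +oo[ (fun xi => m * osc (m - 1) s phi x xi).
    by apply: measurable_funM => //; exact: oscm.
  have le xi : `]b, +oo[%classic xi ->
      `|m * osc (m - 1) s phi x xi| <= - m * xi `^ (m - 1).
    by move=> _; rewrite normrM (ler0_norm m0) ler_wpM2l// oppr_ge0.
  split; first exact: (@le_Rintegrable _ _ _ mu _ _ _ (measurable_itv _) mf le itm).
  apply: le_trans (@normr_Rintegral_le _ _ _ mu _ _ _ (measurable_itv _) mf le itm) _.
  rewrite RintegralZl// itE subrK le_eqVlt; apply/orP; left; apply/eqP.
  by field; lra.
have cl : osc m s phi x xi @[xi --> b^'+] --> osc m s phi x b.
  by apply: cvg_at_right_filter; exact: continuous_kernel_integrand.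
rewrite -normrM (osc_FTC (ltW b0) m1 s0 i1 cl).
apply: le_trans (ler_normB _ _) _; rewrite mulr2n mulrDl mul1r addrA.
apply: lerD; last exact: osc_le.
apply: le_trans (ler_normB _ _) _; apply: lerD => //.
rewrite normrM (ger0_norm sa0) ler_wpM2l//.
have ie := envelope_integrable ma s0.
have sub : `]b, +oo[ `<=` `]0, +oo[.
  by move=> y; rewrite /= !in_itv/= !andbT; exact: lt_trans.
apply: (@le_trans _ _ (\int[mu]_(xi in `]b, +oo[) envelope (m + alpha - 1) s xi)).
  apply: (@normr_Rintegral_le _ _ _ mu _ _ _ (measurable_itv _) (oscm _ _)).
  - by move=> xi _; exact: norm_envelope_cos.
  - by apply: integrableS ie => //; exact: measurable_itv.
by apply: subset_Rintegral_le => // xi; exact: envelope_ge0.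
Qed.

(** The growth in s is recorded because the kernels will be summed over
    s = k + 1 + a t with geometric weights. *)
Definition decays m (j : nat) (beta : R) := exists2 C, 0 <= C &
  forall s phi x, 1 <= s -> 1 <= `|x| ->
    `|kernel m s phi x| <= C * (1 + s) ^+ j * `|x| `^ (- beta).

Lemma decays_bounded m : -1 < m -> decays m 0 0.
Proof.
move=> m1; exists (envelope_mass m 1); first exact: envelope_mass_ge0.
by move=> s phi x s1 x1; rewrite oppr0 powRr0 expr0 !mulr1 kernel_le_mass.
Qed.

Lemma decays_weaken m j j' beta beta' : (j <= j')%N -> beta' <= beta ->
  decays m j beta -> decays m j' beta'.
Proof.
move=> jj bb [C C0 h]; exists C => // s phi x s1 x1.
apply: le_trans (h _ _ _ s1 x1) _; apply: ler_pM.
- by rewrite mulr_ge0// exprn_ge0//; lra.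
- exact: powR_ge0.
- by rewrite ler_wpM2l// ler_weXn2l//; lra.
- by apply: ler_powR => //; rewrite lerN2.
Qed.

(** One integration by parts gains a factor 1/x and leads to the exponents m +
    alpha - 1 and m - 1. *)
Lemma decays_step m j beta : 0 < m ->
  decays (m + alpha - 1) j beta -> decays (m - 1) j beta ->
  decays m j.+1 (beta + 1).
Proof.
move=> m0 [C1 C10 h1] [C2 C20 h2].
exists (alpha * C1 + m * C2).
  by rewrite addr_ge0// mulr_ge0// ltW.
move=> s phi x s1 x1; have x0 : 0 < `|x| by lra.
have s0 : 0 < s by lra.
rewrite opprD (powRDpos _ _ x0) powR_inv1// mulrA ler_pdivlMr// mulrC -normrM.
rewrite -{1}(subrK (pi / 2) phi) (kernel_recurrence _ _ m0 s0).
apply: le_trans (ler_normB _ _) _.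
have {}h1 := h1 s (phi - pi / 2 - omega) x s1 x1.
have {}h2 := h2 s (phi - pi / 2) x s1 x1.
rewrite !normrM (gtr0_norm s0) (gtr0_norm alpha_gt0) (gtr0_norm m0).
set p := `|x| `^ (- beta) in h1 h2 *.
have p0 : 0 <= p by exact: powR_ge0.
have e0 : 0 <= (1 + s) ^+ j by rewrite exprn_ge0//; lra.
rewrite exprS.
have q0 : 0 <= (1 + s) ^+ j * p by rewrite mulr_ge0.
apply: (@le_trans _ _ (s * alpha * (C1 * (1 + s) ^+ j * p)
  + m * (C2 * (1 + s) ^+ j * p))).
  by apply: lerD; rewrite ler_wpM2l// ?mulr_ge0// ltW.
rewrite -subr_ge0.
have -> : (alpha * C1 + m * C2) * ((1 + s) * (1 + s) ^+ j) * p -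
  (s * alpha * (C1 * (1 + s) ^+ j * p) + m * (C2 * (1 + s) ^+ j * p)) =
  (alpha * C1 + s * (m * C2)) * ((1 + s) ^+ j * p) by ring.
by rewrite mulr_ge0// addr_ge0// !mulr_ge0// ltW.
Qed.

(** For m < 0 integration by parts fails at frequency 0, so the integral is
    cut at 1/|x|: the near part is at most the integral of xi^m, and the far
    part is integrated by parts. *)
Lemma decays_singular m : -1 < m <= 0 -> decays m 1 (m + 1).
Proof.
move=> /andP[m1 m0]; have ma : -1 < m + alpha - 1 by case/andP: alpha12; lra.
pose M := envelope_mass (m + alpha - 1) 1.
have M0 : 0 <= M by exact: envelope_mass_ge0.
exists (4 / (m + 1) + alpha * M + 2).
  have m4 : 0 <= 4 / (m + 1) by rewrite divr_ge0//; lra.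
  by rewrite !addr_ge0// mulr_ge0// ltW.
move=> s phi x s1 x1; have x0 : 0 < `|x| by lra.
have s0 : 0 < s by lra.
pose b := `|x|^-1; have b0 : 0 < b by rewrite invr_gt0.
have b1 : b <= 1 by rewrite invf_le1.
have bE : `|x| `^ (- (m + 1)) = b `^ (m + 1).
  by rewrite /b -powR_inv1 ?normr_ge0// -powRrM mulN1r.
rewrite bE expr1.
have [ih hh] := head_powR_integral b0 m1.
have far := @far_part_le b m s (phi - pi / 2) x b0 _ s0.
rewrite m1 m0 subrK in far; have {}far := far isT.
have split : kernel m s phi x = \int[mu]_(xi in `]0, b]) osc m s phi x xi
    + \int[mu]_(xi in `]b, +oo[) osc m s phi x xi.
  rewrite /kernel -Rintegral_setU//.
  - congr (Rintegral _ _ _); apply/seteqP; split => y /=; rewrite !in_itv/= !andbT.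
    + by move=> y0; case: (leP y b); [left; rewrite y0|right].
    + by case=> [/andP[]//|]; exact: lt_trans.
  - apply: integrableS (kernel_integrand_integrable phi x m1 s0) => //.
      exact: measurableU.
    by move=> y [] /=; rewrite !in_itv/= ?andbT; [case/andP|exact: lt_trans].
  - by apply/disj_setPS => y [] /=; rewrite !in_itv/= andbT => /andP[_ yb]; rewrite ltNge yb.
have near : `|\int[mu]_(xi in `]0, b]) osc m s phi x xi| <= 4 * (b `^ (m + 1) / (m + 1)).
  apply: le_trans _ hh.
  have mf : measurable_fun `](0 : R), b] (osc m s phi x).
    apply: (@measurable_funS _ _ _ _ `](0 : R), +oo[) => //.
      by move=> y; rewrite /= !in_itv/= => /andP[->].
    exact: kernel_integrand_measurable.
  apply: (@normr_Rintegral_le _ _ _ mu _ _ _ (measurable_itv _) mf) => // y _.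
  apply: le_trans (norm_envelope_cos _ _ _ _) _.
  rewrite /envelope ler_piMr ?powR_ge0// -expR0 ler_expR oppr_le0.
  by rewrite mulr_ge0 ?powR_ge0// mulr_ge0 ?ltW.
have bm : b `^ m * b = b `^ (m + 1) by rewrite powRDpos// powRr1// ltW.
have bb : b <= b `^ (m + 1).
  by apply: ger1_powR; [rewrite b0|lra].
have Ms : envelope_mass (m + alpha - 1) s <= M by exact: envelope_mass_anti.
have {}far : `|\int[mu]_(xi in `]b, +oo[) osc m s phi x xi|
    <= (s * alpha * M + 2) * b `^ (m + 1).
  rewrite -(ler_pM2l x0); apply: le_trans far _.
  apply: (@le_trans _ _ (s * alpha * M + 2 * b `^ m)).
    by rewrite lerD2r ler_wpM2l// mulr_ge0// ltW.
  have xb : `|x| * b `^ (m + 1) = b `^ m.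
    by rewrite -bm mulrCA mulfV ?gt_eqF// mulr1.
  have bm1 : 1 <= b `^ m by rewrite -(ler_pM2r b0) mul1r bm.
  rewrite [leRHS]mulrCA xb [leRHS]mulrDl lerD2r.
  by rewrite ler_peMr// !mulr_ge0// ltW.
rewrite split; apply: le_trans (ler_normD _ _) _.
have q0 : 0 <= b `^ (m + 1) by exact: powR_ge0.
apply: (le_trans (lerD near far)).
have -> : 4 * (b `^ (m + 1) / (m + 1)) + (s * alpha * M + 2) * b `^ (m + 1) =
  (4 / (m + 1) + s * (alpha * M) + 2) * b `^ (m + 1) by ring.
rewrite ler_wpM2r//.
have m4 : 0 <= 4 / (m + 1) by rewrite divr_ge0//; lra.
have aM : 0 <= alpha * M by rewrite mulr_ge0// ltW.
rewrite -subr_ge0.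
have -> : (4 / (m + 1) + alpha * M + 2) * (1 + s) - (4 / (m + 1) + s * (alpha * M) + 2)
  = s * (4 / (m + 1)) + alpha * M + 2 * s by ring.
by rewrite !addr_ge0// mulr_ge0// ltW.
Qed.

(** The singular exponent alpha - 2 limits the decay to |x|^{-alpha}, the
    heavy tail of the stable laws. *)
Lemma decays_density_kernel : decays (alpha - 1) 2 alpha.
Proof.
case/andP: (alpha12) => a1 a2.
have h1 : decays (alpha - 1 + alpha - 1) 1 (alpha - 1).
  apply: (@decays_weaken _ 1 1 (0 + 1)) => //; first lra.
  by apply: decays_step; [lra|apply: decays_bounded; lra..].
have h2 : decays (alpha - 1 - 1) 1 (alpha - 1).
  have := @decays_singular (alpha - 1 - 1).
  by rewrite subrK; apply; apply/andP; split; lra.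
by rewrite -{2}(subrK 1 alpha); apply: decays_step; [lra|exact: h1|exact: h2].
Qed.

Lemma decays_generator_kernel : decays alpha 3 2.
Proof.
case/andP: (alpha12) => a1 a2.
rewrite (_ : 2 = 1 + 1)//; apply: decays_step => //; last first.
  by apply: decays_weaken decays_density_kernel => //; lra.
apply: (@decays_weaken _ 1 _ (0 + 1)) => //; first lra.
by apply: decays_step; [lra|apply: decays_bounded; lra..].
Qed.

(** Integrable because alpha > 1; all the kernels are compared with it. *)
Definition weight x : R := (1 + `|x|) `^ (- alpha).

Lemma weight_ge0 x : 0 <= weight x. Proof. exact: powR_ge0. Qed.

Lemma decays_weight (F : R -> R -> R) j M C : 0 <= C -> 0 <= M ->
  (forall s x, 1 <= s -> `|x| <= 1 -> `|F s x| <= M * (1 + s) ^+ j) ->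
  (forall s x, 1 <= s -> 1 <= `|x| ->
    `|F s x| <= C * (1 + s) ^+ j * `|x| `^ (- alpha)) ->
  forall s x, 1 <= s -> `|F s x| <= 4 * (M + C) * (1 + s) ^+ j * weight x.
Proof.
case/andP: (alpha12) => a1 a2 C0 M0 hM hC s x s1.
have e0 : 0 <= (1 + s) ^+ j by rewrite exprn_ge0//; lra.
have two y : 0 < y -> (2 * y) `^ alpha <= 4 * y `^ alpha.
  move=> y0; rewrite powRM ?(ltW y0)// ler_wpM2r ?powR_ge0//.
  rewrite (@le_trans _ _ (2 `^ 2))//; first by apply: ler_powR => //; lra.
  by rewrite (powR_mulrn 2)//; lra.
have w1 y : 0 < y -> 1 + `|x| <= 2 * y -> y `^ (- alpha) <= 4 * weight x.
  move=> y0 hy; rewrite /weight !powRN ler_pdivlMr ?powR_gt0 ?ltr_pwDl//.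
  rewrite mulrC ler_pdivrMr ?powR_gt0//; apply: le_trans (two _ y0).
  by apply: ge0_ler_powR; rewrite ?nnegrE; have := normr_ge0 x; lra.
have [x1|x1] := leP `|x| 1.
  apply: le_trans (hM _ _ s1 x1) _.
  have := w1 1 ltr01; rewrite powR1 => /(_ ltac:(lra)) hw.
  have -> : 4 * (M + C) * (1 + s) ^+ j * weight x
    = (M + C) * (1 + s) ^+ j * (4 * weight x) by ring.
  rewrite -[leLHS]mulr1; apply: ler_pM => //; first exact: mulr_ge0.
  by rewrite ler_wpM2r// lerDl.
apply: le_trans (hC _ _ s1 (ltW x1)) _.
have hw := w1 `|x| ltac:(lra) ltac:(lra).
have -> : 4 * (M + C) * (1 + s) ^+ j * weight x
    = (M + C) * (1 + s) ^+ j * (4 * weight x) by ring.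
apply: ler_pM => //; rewrite ?powR_ge0 ?mulr_ge0//.
by rewrite ler_wpM2r// lerDr.
Qed.

(** The phase - pi / 2 removes the boundary term, so x times the density kernel
    is again a kernel. *)
Lemma density_kernel_recurrence s x : 0 < s ->
  x * kernel 0 s 0 x = s * alpha * kernel (alpha - 1) s (- omega - pi / 2) x.
Proof.
move=> s0; have := kernel_recurrence0 (- (pi / 2)) x s0.
rewrite addNr cosN cos_pihalf subr0 => ->.
by rewrite [- (pi / 2) - omega]addrC.
Qed.

Let kernel_bound_near m (phi : R -> R) j : -1 < m -> forall s x, 1 <= s -> `|x| <= 1 ->
  `|kernel m s (phi s) x| <= envelope_mass m 1 * (1 + s) ^+ j.
Proof.
move=> m1 s x s1 _; apply: le_trans (kernel_le_mass _ _ m1 ltr01 s1) _ => //.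
by rewrite ler_peMr ?envelope_mass_ge0// exprn_ege1//; lra.
Qed.

Lemma xdensity_kernel_bound : exists2 C, 0 <= C & forall s x, 1 <= s ->
  `|x * kernel 0 s 0 x| <= C * (1 + s) ^+ 3 * weight x.
Proof.
have [C C0 hC] := decays_density_kernel.
have am : -1 < alpha - 1 by case/andP: alpha12; lra.
have M0 := envelope_mass_ge0 (alpha - 1) 1.
have e3 s : 1 <= s -> 0 <= (1 + s) ^+ 2 by move=> s1; rewrite exprn_ge0//; lra.
exists (4 * (alpha * envelope_mass (alpha - 1) 1 + alpha * C)).
  by rewrite mulr_ge0// addr_ge0// mulr_ge0// ltW.
apply: decays_weight; rewrite ?mulr_ge0// ?(ltW alpha_gt0)//.
- move=> s x s1 x1; rewrite density_kernel_recurrence; last lra.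
  rewrite !normrM (gtr0_norm alpha_gt0) (@gtr0_norm _ s); last lra.
  have h := kernel_bound_near (fun=> - omega - pi / 2) 2 am s1 x1.
  have -> : alpha * envelope_mass (alpha - 1) 1 * (1 + s) ^+ 3 =
    (1 + s) * alpha * (envelope_mass (alpha - 1) 1 * (1 + s) ^+ 2) by ring.
  apply: ler_pM => //; first by rewrite mulr_ge0 ?(ltW alpha_gt0)//; lra.
  by rewrite ler_wpM2r ?(ltW alpha_gt0)//; lra.
- move=> s x s1 x1; rewrite density_kernel_recurrence; last lra.
  rewrite !normrM (gtr0_norm alpha_gt0) (@gtr0_norm _ s); last lra.
  have h := hC s (- omega - pi / 2) x s1 x1.
  have -> : alpha * C * (1 + s) ^+ 3 * `|x| `^ (- alpha) =
    (1 + s) * alpha * (C * (1 + s) ^+ 2 * `|x| `^ (- alpha)) by ring.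
  apply: ler_pM => //; first by rewrite mulr_ge0 ?(ltW alpha_gt0)//; lra.
  by rewrite ler_wpM2r ?(ltW alpha_gt0)//; lra.
Qed.

Lemma density_kernel_bound : exists2 C, 0 <= C & forall s x, 1 <= s ->
  `|kernel 0 s 0 x| <= C * (1 + s) ^+ 3 * weight x.
Proof.
have [C C0 hC] := xdensity_kernel_bound.
have M0 := envelope_mass_ge0 0 1.
exists (4 * (envelope_mass 0 1 + C)); first by rewrite mulr_ge0// addr_ge0.
apply: decays_weight => //.
- by apply: (kernel_bound_near (fun=> 0)); lra.
- move=> s x s1 x1.
  apply: (@le_trans _ _ `|x * kernel 0 s 0 x|).
    by rewrite normrM ler_peMl.
  apply: le_trans (hC _ _ s1) _; rewrite ler_wpM2l//.
    by rewrite mulr_ge0// exprn_ge0//; lra.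
  rewrite /weight !powRN lef_pV2 ?posrE ?powR_gt0 ?ltr_pwDl//; last lra.
  by apply: ge0_ler_powR; rewrite ?nnegrE ?(ltW alpha_gt0)//; lra.
Qed.

Lemma generator_kernel_bound : exists2 C, 0 <= C & forall s x, 1 <= s ->
  `|kernel alpha s (- omega) x| <= C * (1 + s) ^+ 3 * weight x.
Proof.
have [C C0 hC] := decays_weaken (leqnn _) (proj2 (andP alpha12)) decays_generator_kernel.
have M0 := envelope_mass_ge0 alpha 1.
exists (4 * (envelope_mass alpha 1 + C)); first by rewrite mulr_ge0// addr_ge0.
apply: decays_weight => //.
- by apply: (kernel_bound_near (fun=> - omega)); have := alpha_gt0; lra.
- by move=> s x s1 x1; apply: hC.
Qed.

End stable_kernels.

(** * The Gaussian kernel *)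

Section gaussian.
Context {R : realType}.
Local Notation mu := (@lebesgue_measure R).
Local Notation L1 A f := (mu.-integrable A (EFin \o f)).
Implicit Types s x y z sigma : R.

Let two12 : 1 < (2 : R) <= 2. Proof. by lra. Qed.
Let cos0_gt0 : 0 < cos (0 : R). Proof. by rewrite cos0. Qed.

Local Notation gauss := (kernel (2 : R) 0 0).

Lemma kernelDpi alpha omega m s phi x :
  -1 < m -> 0 < s -> 1 < alpha <= 2 -> 0 < cos omega ->
  kernel alpha omega m s (phi + pi) x = - kernel alpha omega m s phi x.
Proof.
move=> m1 s0 a12 c0; rewrite -mulN1r -RintegralZl//; last first.
  exact: kernel_integrand_integrable.
apply: eq_Rintegral => xi _; rewrite mulN1r -mulrN; congr (_ * _).
by rewrite /phase addrA cosDpi.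
Qed.

(** At x = 0 the kernel is half of the mass of an unnormalized normal density.
    *)
Lemma gauss_kernel0 s : 0 < s -> gauss s 0 0 = 2^-1 * Num.sqrt (pi / s).
Proof.
move=> s0; pose sg := Num.sqrt (2 * s)^-1.
have sg2 : sg ^+ 2 = (2 * s)^-1 by rewrite sqr_sqrtr// invr_ge0; lra.
have sg0 : sg != 0.
  by apply: contraTneq s0 => sgE; move: sg2; rewrite sgE expr0n/= => /esym/eqP;
     rewrite invr_eq0 mulf_eq0 pnatr_eq0/= => /eqP ->; rewrite ltxx.
have := integral_normal_pdf (0 : R) sg.
have pdfE x : normal_pdf 0 sg x = normal_peak sg * expR (- (s * x ^+ 2)).
  rewrite normal_pdfE// /normal_fun subr0 sg2; congr (_ * expR _).
  by rewrite -mulr_natr; field; lra.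
have ip := integrable_normal_pdf (0 : R) sg.
move=> hint; have h1 : \int[mu]_x normal_pdf 0 sg x = 1 by rewrite /Rintegral hint.
move: h1; rewrite reflect_Rintegral//.
under eq_Rintegral => x _ do rewrite !pdfE sqrrN -mulr2n -mulr_natl mulrA.
have i0 : L1 `]0, +oo[ (fun x => expR (- (s * x ^+ 2))).
  have := @powR_expR_integrable R 2 s 0 ltac:(lra) s0 ltac:(lra).
  apply: eq_integrable => // x; rewrite inE/= in_itv/= andbT => x0.
  by rewrite /= powRr0 mul1r (powR_mulrn 2)// ltW.
rewrite RintegralZl//.
have -> : \int[mu]_(x in `]0, +oo[) expR (- (s * x ^+ 2)) = gauss s 0 0.
  apply: eq_Rintegral => x; rewrite inE/= in_itv/= andbT => x0.
  rewrite /envelope /phase powRr0 mul1r (powR_mulrn 2) ?(ltW x0)//.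
  by rewrite cos0 sin0 mulr1 !(mulr0, mul0r) !addr0 cos0 mulr1.
have -> : normal_peak sg = (Num.sqrt (pi / s))^-1.
  rewrite /normal_peak sg2; congr (Num.sqrt _)^-1.
  by rewrite -mulr_natr; field; lra.
have q0 : 0 < Num.sqrt (pi / s) by rewrite sqrtr_gt0 divr_gt0// pi_gt0.
have qn0 : Num.sqrt (pi / s) != 0 by rewrite gt_eqF.
move=> h; apply: (@mulfI _ (2 / Num.sqrt (pi / s))).
  by rewrite mulf_neq0 ?invr_eq0 ?pnatr_eq0.
by rewrite h; field; rewrite qn0.
Qed.

(** The Gaussian kernel solves y' = - x y / (2 s). *)
Lemma gauss_kernelE s x : 0 < s ->
  gauss s 0 x = 2^-1 * Num.sqrt (pi / s) * expR (- (x ^+ 2 / (4 * s))).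
Proof.
move=> s0; have m1 : (-1 : R) < 0 by lra.
have dg y : is_derive y 1 (gauss s 0) (- (y / (2 * s)) * gauss s 0 y).
  have := is_derive_kernel_x two12 cos0_gt0 0 y m1 s0.
  have := kernel_recurrence0 two12 cos0_gt0 (pi / 2) y s0.
  rewrite cos_pihalf subr0 -splitr subr0 -{1}(add0r pi) kernelDpi//.
  rewrite (_ : 2 - 1 = 0 + 1); last by lra.
  rewrite !add0r => h dg; apply: is_derive_eq.
  by apply: (@mulfI _ (s * 2)); [rewrite mulf_neq0//; lra|rewrite -h; field; lra].
pose F y := gauss s 0 y * expR (y ^+ 2 / (4 * s)).
have dF y : is_derive y 1 F 0.
  have darg : is_derive y 1 (fun y => y ^+ 2 / (4 * s)) (y / (2 * s)).
    apply: is_derive_eq; rewrite /GRing.scale/=. field; lra.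
  have dexp := is_derive1_comp (@is_derive_expR R _) darg.
  have dgy := dg y.
  apply: is_derive_eq; rewrite /GRing.scale/=. ring.
have FE : F x = F 0 by exact: is_derive_0_is_cst.
have : F 0 = 2^-1 * Num.sqrt (pi / s).
  by rewrite /F expr0n/= mul0r expR0 mulr1 gauss_kernel0.
by rewrite -FE => <-; rewrite /F -mulrA -expRD addrN expR0 mulr1.
Qed.

Lemma gauss_kernel_normal sigma x y : 0 < sigma ->
  2 * gauss (sigma ^+ 2 / 2) 0 (x - y) = 2 * pi * normal_pdf y sigma x.
Proof.
move=> s0; have ss0 : 0 < sigma ^+ 2 / 2 by rewrite divr_gt0// exprn_gt0.
rewrite gauss_kernelE// normal_pdfE ?gt_eqF// /normal_peak /normal_fun.
have -> : - ((x - y) ^+ 2 / (4 * (sigma ^+ 2 / 2))) = - (x - y) ^+ 2 / (sigma ^+ 2 *+ 2).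
  by rewrite -mulr_natr; field; lra.
rewrite !mulrA; congr (_ * _); rewrite mulfV// mul1r.
set a := sigma ^+ 2 * pi *+ 2.
have a0 : 0 < a by rewrite /a -mulr_natr !mulr_gt0 ?exprn_gt0 ?pi_gt0.
have -> : pi / (sigma ^+ 2 / 2) = (2 * pi) ^+ 2 / a.
  have pi0 : pi != 0 :> R by rewrite gt_eqF// pi_gt0.
  have sn0 : sigma != 0 by rewrite gt_eqF.
  rewrite /a -mulr_natr; clear a0 a; move: (pi) pi0 => q q0.
  by field; rewrite q0 sn0.
have p0 : 0 <= 2 * pi :> R by rewrite mulr_ge0// pi_ge0.
by rewrite sqrtrM ?sqr_ge0// sqrtr_sqr ger0_norm// sqrtrV// ltW.
Qed.

End gaussian.

(** * Inversion of the Hartley transform *)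

Section hartley.
Context {R : realType}.
Local Notation mu := (@lebesgue_measure R).
Local Notation L1 A f := (mu.-integrable A (EFin \o f)).
Implicit Types (f g h : R -> R) (x y xi sigma : R).

Lemma Rfubini_dominated (F : R -> R -> R) (a b : R -> R) :
  measurable_fun setT (fun z : measurableTypeR R * measurableTypeR R => F z.1 z.2) ->
  (forall x y, `|F x y| <= a x * b y) -> L1 setT a -> L1 setT b ->
  (forall x, 0 <= a x) -> (forall y, 0 <= b y) ->
  \int[mu]_x \int[mu]_y F x y = \int[mu]_y \int[mu]_x F x y.
Proof.
move=> mF Fab ia ib a0 b0.
pose G (z : measurableTypeR R * measurableTypeR R) := (F z.1 z.2)%:E.
have mG : measurable_fun setT G by exact/measurable_EFinP.
have mF1 x : measurable_fun [set: measurableTypeR R] (F x).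
  exact: (@measurableT_comp _ _ _ _ _ _ _ _ (pair x) mF).
have mF2 y : measurable_fun [set: measurableTypeR R] (fun x => F x y).
  exact: (@measurableT_comp _ _ _ _ _ _ _ _ (pair^~ y) mF).
have iF1 x : L1 setT (F x).
  apply: (@le_Rintegrable _ _ _ mu _ _ (fun y => a x * b y)) => //.
  exact: (@RintegrableZ _ _ _ mu _ _ (a x) measurableT ib).
have iF2 y : L1 setT (fun x => F x y).
  apply: (@le_Rintegrable _ _ _ mu _ _ (fun x => b y * a x)) => //.
    by move=> x _; rewrite mulrC.
  exact: (@RintegrableZ _ _ _ mu _ _ (b y) measurableT ia).
have iG : (product_measure1 mu mu).-integrable setT G.
  have Ib : (\int[mu]_y (b y)%:E = (\int[mu]_y b y)%:E)%E.
    rewrite /Rintegral fineK//.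
    exact: (@integrable_fin_num _ _ _ mu _ measurableT _ ib).
  apply/(@integrable12ltyP _ _ _ _ _ mu mu) => //.
  apply: (@le_lt_trans _ _ (\int[mu]_x (a x * \int[mu]_y b y)%:E)%E).
    apply: ge0_le_integral => //.
    - by move=> x _; apply: integral_ge0.
    - apply: (@measurable_fun_fubini_tonelli_F _ _ _ _ _ mu (fun z => `|G z|%E)) => //.
      exact: measurableT_comp.
    - by apply/measurable_EFinP/measurable_funM => //; exact: integrable_measurable ia.
    - move=> x _; rewrite EFinM -Ib -integralZl//; apply: ge0_le_integral => //.
      + rewrite [X in measurable_fun _ X](_ : _ = EFin \o (fun y => `|F x y|))//.
        by apply/measurable_EFinP; exact: measurableT_comp.
      + apply/measurable_EFinP/measurable_funM => //.
        exact: integrable_measurable ib.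
      + by move=> y _; rewrite lee_fin.
  have := @RintegrableZ _ _ _ mu _ _ (\int[mu]_y b y) measurableT ia.
  move=> /(integrable_lty measurableT).
  by under eq_integral do rewrite /= mulrC.
have h := Fubini iG.
rewrite /Rintegral; congr fine.
transitivity (\int[mu]_x \int[mu]_y G (x, y))%E.
  apply: eq_integral => x _; rewrite fineK//.
  exact: (@integrable_fin_num _ _ _ mu _ measurableT _ (iF1 x)).
rewrite h; apply: eq_integral => y _; rewrite fineK//.
exact: (@integrable_fin_num _ _ _ mu _ measurableT _ (iF2 y)).
Qed.

Definition cas (t : R) := cos t + sin t.

Lemma norm_cas (t : R) : `|cas t| <= 2.
Proof.
by apply: le_trans (ler_normD _ _) _; have := cos_max t; have := sin_max t; lra.
Qed.

Lemma continuous_cas : continuous cas.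
Proof. by move=> t; apply: cvgD; [exact: continuous_cos|exact: continuous_sin]. Qed.

Lemma measurable_cas : measurable_fun setT cas.
Proof. exact: continuous_measurable_fun continuous_cas. Qed.

(** The real form of the Fourier transform: for real f it is the sum of the
    real and imaginary parts, and it is its own inverse up to 2 pi. *)
Definition hartley f xi : R := \int[mu]_x (cas (x * xi) * f x).

Lemma cas_mul_integrable f xi : L1 setT f -> L1 setT (fun x => cas (x * xi) * f x).
Proof.
move=> if_; apply: (@RintegrableM _ _ _ mu _ _ _ 2) => //; last first.
  by move=> x _; exact: norm_cas.
apply: (measurableT_comp measurable_cas).
by apply: measurable_funM.
Qed.

Lemma continuous_hartley f : L1 setT f -> continuous (hartley f).
Proof.
move=> if_ xi.
apply: (@continuity_under_integral R _ _ mu (fun xi x => cas (x * xi) * f x) setT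
   measurableT (xi - 1) (xi + 1) _ _ (fun x => 2 * `|f x|)).
- by move=> y _; exact: cas_mul_integrable.
- apply: aeW => x _ y _; apply: cvgMl.
  apply: continuous_comp; last exact: continuous_cas.
  by apply: cvgMr; exact: cvg_id.
- by apply: RintegrableZ => //; exact: integrable_norm.
- move=> y _; apply: aeW => x _; rewrite normrM ler_wpM2r//; exact: norm_cas.
- by rewrite inE/= in_itv/=; apply/andP; split; lra.
Qed.

Lemma hartley_measurable f : L1 setT f -> measurable_fun setT (hartley f).
Proof. by move=> if_; apply: continuous_measurable_fun; exact: continuous_hartley. Qed.

Definition gauss_factor sigma xi : R := expR (- (sigma ^+ 2 / 2 * xi ^+ 2)).

Lemma gauss_factor_ge0 sigma xi : 0 <= gauss_factor sigma xi.
Proof. exact: expR_ge0. Qed.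

Lemma gauss_factor_measurable sigma : measurable_fun setT (gauss_factor sigma).
Proof.
apply: continuous_measurable_fun => x; apply: continuous_comp; last exact: continuous_expR.
by apply: cvgN; apply: cvgMr; exact: exprn_continuous.
Qed.

Lemma even_integrable (k : R -> R) : measurable_fun setT k ->
  (forall x, k (- x) = k x) -> L1 `]0, +oo[ k -> L1 setT k.
Proof.
move=> mk ek ik; apply: reflect_integrable => //.
by under [X in EFin \o X]eq_fun do rewrite ek.
Qed.

Lemma gauss_factor_integrable sigma : 0 < sigma -> L1 setT (gauss_factor sigma).
Proof.
move=> s0; apply: even_integrable.
- exact: gauss_factor_measurable.
- by move=> x; rewrite /gauss_factor sqrrN.
have ss0 : 0 < sigma ^+ 2 / 2 by rewrite divr_gt0// exprn_gt0.
have := @powR_expR_integrable R 2 _ 0 ltac:(lra) ss0 ltac:(lra).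
apply: eq_integrable => // x; rewrite inE/= in_itv/= andbT => x0.
by rewrite /= powRr0 mul1r (powR_mulrn 2)// ltW.
Qed.

Lemma cas_cas_gauss_integrable sigma x y : 0 < sigma ->
  L1 setT (fun xi => cas (y * xi) * gauss_factor sigma xi * cas (x * xi)).
Proof.
move=> s0.
apply: (@eq_integrable _ _ _ mu _ measurableT (EFin \o (fun xi =>
    (cas (y * xi) * cas (x * xi)) * gauss_factor sigma xi))) => //.
  by move=> xi _ /=; rewrite mulrAC.
apply: (@RintegrableM _ _ _ mu _ _ _ 4) => //; last exact: gauss_factor_integrable.
  by apply: measurable_funM; apply: (measurableT_comp measurable_cas);
    apply: measurable_funM.
move=> xi _; rewrite normrM (_ : 4 = 2 * 2)//; last by lra.
by apply: ler_pM => //; exact: norm_cas.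
Qed.

(** Folding the line at 0 cancels the odd part of the product of the two cas,
    and cos ((x - y) xi) remains. *)
Lemma cas_cas_gauss sigma x y : 0 < sigma ->
  \int[mu]_xi (cas (y * xi) * gauss_factor sigma xi * cas (x * xi))
    = 2 * pi * normal_pdf y sigma x.
Proof.
move=> s0; have ss0 : 0 < sigma ^+ 2 / 2 by rewrite divr_gt0// exprn_gt0.
have ig := cas_cas_gauss_integrable x y s0.
rewrite reflect_Rintegral// -gauss_kernel_normal//.
rewrite -RintegralZl//; last by apply: kernel_integrand_integrable; rewrite ?cos0//; lra.
apply: eq_Rintegral => xi; rewrite inE/= in_itv/= andbT => xi0.
rewrite /envelope /phase powRr0 mul1r (powR_mulrn 2) ?(ltW xi0)//.
rewrite cos0 sin0 mulr1 mulr0 mul0r !addr0 /gauss_factor sqrrN.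
rewrite mulrBl cosB /cas !mulrN !cosN !sinN; ring.
Qed.

Lemma mul_pdf_integrable f y sigma : L1 setT f -> 0 < sigma ->
  L1 setT (fun x => f x * normal_pdf y sigma x).
Proof.
move=> if_ s0; apply: (@eq_integrable _ _ _ mu _ measurableT
  (EFin \o (fun x => normal_pdf y sigma x * f x))) => //.
  by move=> x _ /=; rewrite mulrC.
apply: (@RintegrableM _ _ _ mu _ _ _ (normal_peak sigma)) => //.
  exact: measurable_normal_pdf.
move=> x _; rewrite ger0_norm ?normal_pdf_ge0//.
by rewrite normal_pdf_ub// gt_eqF.
Qed.

(** Gaussian summation of the inverse transform is convolution with a normal
    density. *)
Lemma hartley_smoothing f sigma y : L1 setT f -> 0 < sigma ->
  \int[mu]_xi (cas (y * xi) * gauss_factor sigma xi * hartley f xi)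
    = 2 * pi * \int[mu]_x (f x * normal_pdf y sigma x).
Proof.
move=> if_ s0; have mf := integrable_measurable if_.
have ig := gauss_factor_integrable s0.
have icas xi := cas_mul_integrable xi if_.
have -> : \int[mu]_xi (cas (y * xi) * gauss_factor sigma xi * hartley f xi) =
    \int[mu]_xi \int[mu]_x (cas (y * xi) * gauss_factor sigma xi * (cas (x * xi) * f x)).
  by apply: eq_Rintegral => xi _; rewrite RintegralZl.
rewrite (@Rfubini_dominated _ (fun xi => 4 * gauss_factor sigma xi) (fun x => `|f x|)).
- rewrite -RintegralZl//; last exact: mul_pdf_integrable.
  apply: eq_Rintegral => x _.
  rewrite [RHS]mulrCA -cas_cas_gauss// -RintegralZl//; last first.
    exact: cas_cas_gauss_integrable.
  by apply: eq_Rintegral => xi _; rewrite mulrA mulrC.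
- apply: measurable_funM; apply: measurable_funM.
  + apply: (measurableT_comp measurable_cas).
    by apply: measurable_funM => //; exact: measurable_fst.
  + exact: (measurableT_comp (gauss_factor_measurable sigma) measurable_fst).
  + apply: (measurableT_comp measurable_cas).
    by apply: measurable_funM; [exact: measurable_snd|exact: measurable_fst].
  + exact: (measurableT_comp mf measurable_snd).
- move=> xi x; rewrite !normrM (ger0_norm (gauss_factor_ge0 _ _)) mulrA.
  rewrite ler_wpM2r// mulrAC ler_wpM2r ?gauss_factor_ge0//.
  by rewrite (_ : 4 = 2 * 2); [apply: ler_pM => //; exact: norm_cas|lra].
- exact: (@RintegrableZ _ _ _ mu _ _ 4 measurableT ig).
- exact: integrable_norm.
- by move=> xi; rewrite mulr_ge0 ?gauss_factor_ge0.
- by move=> x.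
Qed.

End hartley.

Section inversion.
Context {R : realType}.
Local Notation mu := (@lebesgue_measure R).
Local Notation L1 A f := (mu.-integrable A (EFin \o f)).
Implicit Types (f g h : R -> R) (x y xi sigma delta : R).

Lemma Rintegral_normal_pdf y sigma : \int[mu]_x normal_pdf y sigma x = 1.
Proof. by rewrite /Rintegral integral_normal_pdf. Qed.

Lemma expRN_le_inv (u : R) : 0 < u -> expR (- u) <= u^-1.
Proof.
move=> u0; rewrite expRN lef_pV2 ?posrE ?expR_gt0//.
by apply: le_trans (expR_ge1Dx u); rewrite lerDr.
Qed.

Lemma normal_peak_le sigma : 0 < sigma -> normal_peak sigma <= sigma^-1.
Proof.
move=> s0; rewrite /normal_peak lef_pV2 ?posrE//; last first.
  by rewrite sqrtr_gt0 mulrn_wgt0// mulr_gt0 ?exprn_gt0 ?pi_gt0.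
rewrite -[X in X <= _](ger0_norm (ltW s0)) -sqrtr_sqr ler_sqrt//; last first.
  by rewrite mulrn_wge0// mulr_ge0 ?sqr_ge0// pi_ge0.
rewrite -mulrnAr ler_peMr ?sqr_ge0//.
by have := @pi_ge2 R; rewrite -mulr_natr; lra.
Qed.

(** Far from the mean a normal density is small relative to the one of twice
    the width; this controls the tail mass. *)
Lemma normal_pdf_far_ratio sigma delta x y :
  0 < sigma -> 0 < delta -> delta <= `|x - y| ->
  normal_pdf y sigma x <= 6 / delta ^+ 2 * sigma ^+ 2 * normal_pdf y (2 * sigma) x.
Proof.
move=> s0 d0 dxy; rewrite !normal_pdfE ?gt_eqF ?mulr_gt0//.
have z2 : delta ^+ 2 <= (x - y) ^+ 2.
  by rewrite -(real_normK (num_real (x - y))) lerXn2r ?nnegrE// ltW.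
have d2 : 0 < delta ^+ 2 by rewrite exprn_gt0.
have s2 : 0 < sigma ^+ 2 by rewrite exprn_gt0.
have peak2 : normal_peak sigma = 2 * normal_peak (2 * sigma).
  have E : (2 * sigma) ^+ 2 * pi *+ 2 = 2 ^+ 2 * (sigma ^+ 2 * pi *+ 2).
    by rewrite exprMn -mulrA mulrnAr.
  rewrite /normal_peak E [X in _ = 2 * X^-1]sqrtrM ?sqr_ge0// sqrtr_sqr.
  by rewrite ger0_norm// invfM mulrA mulfV// mul1r.
set w := 3 * (x - y) ^+ 2 / (8 * sigma ^+ 2).
have fun2 : normal_fun y sigma x = normal_fun y (2 * sigma) x * expR (- w).
  rewrite /normal_fun -expRD /w; congr expR; rewrite -(mulr_natl (sigma ^+ 2)).
  by rewrite -(mulr_natl ((2 * sigma) ^+ 2)); field; rewrite gt_eqF.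
have w0 : 3 * delta ^+ 2 / (8 * sigma ^+ 2) <= w.
  by rewrite /w ler_wpM2r ?invr_ge0//; lra.
have wl0 : 0 < 3 * delta ^+ 2 / (8 * sigma ^+ 2) by rewrite divr_gt0//; lra.
have ew : expR (- w) <= 3 / delta ^+ 2 * sigma ^+ 2.
  apply: le_trans (expRN_le_inv _) _; first exact: lt_le_trans w0.
  apply: (@le_trans _ _ ((3 * delta ^+ 2 / (8 * sigma ^+ 2))^-1)).
    by rewrite lef_pV2 ?posrE//; exact: lt_le_trans w0.
  have -> : (3 * delta ^+ 2 / (8 * sigma ^+ 2))^-1 = 8 / 3 * (sigma ^+ 2 / delta ^+ 2).
    by field; rewrite !gt_eqF.
  rewrite (_ : 3 / delta ^+ 2 * sigma ^+ 2 = 3 * (sigma ^+ 2 / delta ^+ 2)); last by ring.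
  by rewrite ler_wpM2r ?divr_ge0 ?(ltW s2) ?(ltW d2)//; lra.
rewrite peak2 fun2.
have pn : 0 <= normal_peak (2 * sigma) * normal_fun y (2 * sigma) x.
  by rewrite mulr_ge0 ?normal_peak_ge0 ?normal_fun_ge0.
rewrite (_ : _ * (_ * _) = 2 * expR (- w) *
   (normal_peak (2 * sigma) * normal_fun y (2 * sigma) x)); last by ring.
rewrite ler_wpM2r// (_ : 6 / delta ^+ 2 * sigma ^+ 2 = 2 * (3 / delta ^+ 2 * sigma ^+ 2)).
  by rewrite ler_wpM2l.
by ring.
Qed.

Lemma normal_pdf_far sigma delta x y : 0 < sigma -> 0 < delta -> delta <= `|x - y| ->
  normal_pdf y sigma x <= 3 / delta ^+ 2 * sigma.
Proof.
move=> s0 d0 dxy; apply: le_trans (normal_pdf_far_ratio s0 d0 dxy) _.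
have s2 : 0 < 2 * sigma by rewrite mulr_gt0.
have peak : normal_pdf y (2 * sigma) x <= (2 * sigma)^-1.
  by apply: le_trans (normal_pdf_ub _ _ _) (normal_peak_le s2); rewrite gt_eqF.
rewrite (_ : 3 / delta ^+ 2 * sigma = 6 / delta ^+ 2 * sigma ^+ 2 * (2 * sigma)^-1).
  by rewrite ler_wpM2l// mulr_ge0 ?divr_ge0 ?sqr_ge0.
by field; rewrite !gt_eqF.
Qed.

Definition sigma_ n : R := n.+1%:R^-1.

(** Away from y a narrow normal density is uniformly small, which handles f,
    and small relative to the density of twice its width, which handles the
    constant f y. *)
Lemma normal_approximation f y : L1 setT f -> {for y, continuous f} ->
  \int[mu]_x (f x * normal_pdf y (sigma_ n) x) @[n --> \oo] --> f y.
Proof.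
move=> if_ cf; apply/cvgrPdist_le => e e0.
have e2 : 0 < e / 2 by rewrite divr_gt0.
have /cvgrPdist_le/(_ _ e2)/nbhs_ballP[delta /= d0 hd] := cf.
set N := \int[mu]_x `|f x|.
pose K := 3 / delta ^+ 2 * N + `|f y| * (6 / delta ^+ 2).
have K0 : 0 <= K.
  rewrite addr_ge0// mulr_ge0// ?divr_ge0 ?sqr_ge0//.
  by apply: Rintegral_ge0 => x _.
near=> n.
have s0 : 0 < sigma_ n by rewrite invr_gt0.
have s1 : sigma_ n <= 1 by rewrite invf_le1// ler1n.
have sK : sigma_ n * K <= e / 2.
  rewrite /sigma_ mulrC ler_pdivrMr//.
  rewrite -ler_pdivrMl//; apply: (@le_trans _ _ n%:R); last by rewrite ler_nat.
  by near: n; exact: nbhs_infty_ger.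
set sg := sigma_ n in s0 s1 sK *.
have ip := @integrable_normal_pdf R y sg.
have ip2 := @integrable_normal_pdf R y (2 * sg).
have ifp := mul_pdf_integrable y if_ s0.
have ifyp := @RintegrableZ _ _ _ mu _ _ (f y) measurableT ip.
have inf := integrable_norm if_.
rewrite -[X in X - _]mulr1 -(Rintegral_normal_pdf y sg) -RintegralZl//.
rewrite -RintegralB//.
pose G x := e / 2 * normal_pdf y sg x + 3 / delta ^+ 2 * sg * `|f x|
   + `|f y| * (6 / delta ^+ 2 * sg ^+ 2) * normal_pdf y (2 * sg) x.
have i1 := @RintegrableZ _ _ _ mu _ _ (e / 2) measurableT ip.
have i2 := @RintegrableZ _ _ _ mu _ _ (3 / delta ^+ 2 * sg) measurableT inf.
have i3 := @RintegrableZ _ _ _ mu _ _ (`|f y| * (6 / delta ^+ 2 * sg ^+ 2)) measurableT ip2.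
have i12 := @RintegrableD _ _ _ mu _ _ _ measurableT i1 i2.
have iG : L1 setT G := @RintegrableD _ _ _ mu _ _ _ measurableT i12 i3.
have iB := @RintegrableB _ _ _ mu _ _ _ measurableT ifyp ifp.
apply: (@le_trans _ _ (\int[mu]_x G x)).
  apply: (@normr_Rintegral_le _ _ _ mu _ _ _ measurableT _ _ iG).
    exact: integrable_measurable iB.
  move=> x _; rewrite -mulrBl normrM (ger0_norm (normal_pdf_ge0 _ _ _)) /G.
  have pge0 := normal_pdf_ge0 y sg x; have pge2 := normal_pdf_ge0 y (2 * sg) x.
  have c1 : 0 <= 3 / delta ^+ 2 * sg.
    by rewrite mulr_ge0 ?divr_ge0 ?sqr_ge0 ?(ltW s0).
  have c2 : 0 <= 6 / delta ^+ 2 * sg ^+ 2.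
    exact: mulr_ge0 (divr_ge0 (ler0n _ 6) (sqr_ge0 _)) (sqr_ge0 _).
  have [xy|xy] := ltP `|x - y| delta.
    have := hd x; rewrite /ball/= distrC => /(_ xy) h.
    rewrite -addrA ler_wpDr//; last by rewrite ler_wpM2r.
    exact: addr_ge0 (mulr_ge0 c1 (normr_ge0 _)) (mulr_ge0 (mulr_ge0 (normr_ge0 _) c2) pge2).
  have p1 := normal_pdf_far s0 d0 xy; have p2 := normal_pdf_far_ratio s0 d0 xy.
  apply: (@le_trans _ _ ((`|f y| + `|f x|) * normal_pdf y sg x)).
    by rewrite ler_wpM2r// ler_normB.
  rewrite mulrDl addrC; apply: lerD.
    by rewrite ler_wpDl ?(mulr_ge0 (ltW e2) pge0)// mulrC ler_wpM2r.
  by rewrite -mulrA ler_wpM2l.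
rewrite /G !RintegralD// !RintegralZl// !Rintegral_normal_pdf !mulr1 -/N.
rewrite -addrA [leRHS]splitr lerD2l; apply: le_trans sK.
rewrite /K mulrDr; apply: lerD; first by rewrite mulrCA !mulrA.
rewrite [leRHS]mulrCA ler_wpM2l// [leRHS]mulrC ler_wpM2l ?divr_ge0 ?sqr_ge0//.
by rewrite expr2 ler_piMr// ltW.
Unshelve. all: by end_near. Qed.

Lemma gauss_factor_sigma_cvg xi : gauss_factor (sigma_ n) xi @[n --> \oo] --> (1 : R).
Proof.
have c0 : (sigma_ n : R) @[n --> \oo] --> (0 : R) by exact: cvg_harmonic.
have c : - (sigma_ n ^+ 2 / 2 * xi ^+ 2) @[n --> \oo] --> - (0 ^+ 2 / 2 * xi ^+ 2).
  apply: cvgN; apply: cvgMl; apply: cvgMl.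
  by apply: (cvg_comp _ (fun y : R => y ^+ 2) c0); exact: exprn_continuous.
rewrite -[X in _ --> X](@expR0 R).
have E0 : - (0 ^+ 2 / 2 * xi ^+ 2) = 0 by rewrite expr0n/= !mul0r oppr0.
by rewrite E0 in c; apply: (cvg_comp _ _ c); exact: continuous_expR.
Qed.

Lemma gauss_factor_le1 sigma xi : gauss_factor sigma xi <= 1.
Proof.
by rewrite expR_le1 oppr_le0 mulr_ge0 ?divr_ge0 ?sqr_ge0.
Qed.

(** In the smoothing formula the Gaussian factor tends to 1 and the normal
    density concentrates at y. *)
Theorem hartley_inversion f y : L1 setT f -> L1 setT (hartley f) ->
  {for y, continuous f} -> hartley (hartley f) y = 2 * pi * f y.
Proof.
move=> if_ ih cf.
have h1 : \int[mu]_xi (cas (y * xi) * gauss_factor (sigma_ n) xi * hartley f xi)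
   @[n --> \oo] --> 2 * pi * f y.
  under eq_fun => n do rewrite hartley_smoothing// ?invr_gt0//.
  by apply: cvgMr; exact: normal_approximation.
have [||||_ h2] := @Rdominated_cvg _ _ _ mu setT
  (fun n xi => cas (y * xi) * gauss_factor (sigma_ n) xi * hartley f xi)
  (fun xi => cas (xi * y) * hartley f xi) (fun xi => 2 * `|hartley f xi|) measurableT.
- move=> n; apply: measurable_funM; last exact: integrable_measurable ih.
  apply: measurable_funM; last exact: gauss_factor_measurable.
  by apply: (measurableT_comp measurable_cas); apply: measurable_funM.
- move=> xi _; apply: cvgMl; rewrite [X in _ --> X](_ : _ = cas (y * xi) * 1).
    by apply: cvgMr; exact: gauss_factor_sigma_cvg.
  by rewrite mulr1 mulrC.
- move=> n xi _; rewrite !normrM ler_wpM2r// (ger0_norm (gauss_factor_ge0 _ _)).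
  rewrite -[leRHS]mulr1; apply: ler_pM => //; rewrite ?gauss_factor_ge0 ?norm_cas//.
  exact: gauss_factor_le1.
- apply: (@RintegrableZ _ _ _ mu _ _ 2 measurableT); exact: integrable_norm.
by apply/esym; rewrite -(cvg_lim _ h1)//; apply: (cvg_lim _ h2).
Qed.

(** By continuity the transform also vanishes at 0, and inversion applies. *)
Lemma hartley_eq0 f : L1 setT f -> continuous f ->
  (forall xi, xi != 0 -> hartley f xi = 0) -> forall y, f y = 0.
Proof.
move=> if_ cf h0.
have H0 xi : hartley f xi = 0.
  have [->|/h0//] := eqVneq xi 0.
  have c := continuous_hartley if_ (x := 0).
  have c1 : hartley f z @[z --> 0^'] --> hartley f 0.
    by apply: cvg_trans c; apply: cvg_app; exact: nbhs_dnbhs.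
  have c2 : hartley f z @[z --> 0^'] --> (0 : R).
    apply: cvg_near_cst; near=> z; apply: h0; near: z; exact: nbhs_dnbhs_neq.
  by rewrite -(cvg_lim _ c1)// (cvg_lim _ c2).
have HE : hartley f = fun=> 0 by exact/funext.
move=> y; have := @hartley_inversion f y if_.
rewrite HE /hartley; under eq_Rintegral do rewrite mulr0.
rewrite Rintegral_cst// mul0r => h.
have {}h : 0 = 2 * pi * f y by apply: h; [exact: integrable0|exact: cf].
by apply/eqP; move/esym/eqP: h; rewrite !mulf_eq0 pnatr_eq0/= gt_eqF// pi_gt0.
Unshelve. all: by end_near. Qed.

End inversion.

(** * Fourier transforms of the kernels *)

Section complex_exponential.
Context {R : realType}.
Implicit Types (a b c d x y alpha theta s xi : R) (z w : R[i]).

Lemma ComplexM a b c d :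
  Complex a b * Complex c d = Complex (a * c - b * d) (a * d + b * c).
Proof. by []. Qed.

Lemma ComplexN a b : - Complex a b = Complex (- a) (- b).
Proof. by []. Qed.

Lemma ComplexD a b c d : Complex a b + Complex c d = Complex (a + c) (b + d).
Proof. by []. Qed.

Lemma realM a c d : real_complex R a * Complex c d = Complex (a * c) (a * d).
Proof. by rewrite ComplexM !mul0r subr0 addr0. Qed.

Lemma real_realM a b : real_complex R a * real_complex R b = real_complex R (a * b).
Proof. by rewrite realM mulr0. Qed.

Lemma expiD x y : expi (x + y) = expi x * expi y.
Proof. by rewrite /expi ComplexM cosD sinD; congr Complex; rewrite addrC. Qed.

Lemma cexpD z w : cexp (z + w) = cexp z * cexp w.
Proof.
case: z => a b; case: w => c d; rewrite ComplexD /cexp /= expRD expiD.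
by rewrite -real_realM; ring.
Qed.

Lemma expi_pi : expi (pi : R) = - 1.
Proof. by rewrite /expi cospi sinpi; congr Complex; rewrite oppr0. Qed.

Lemma expi_Npi : expi (- pi : R) = - 1.
Proof. by rewrite /expi cosN sinN cospi sinpi oppr0; congr Complex; rewrite oppr0. Qed.

Lemma psiE alpha theta xi : xi != 0 ->
  psi alpha theta xi = Complex (`|xi| `^ alpha * cos (theta * pi / 2))
    (Num.sg xi * (`|xi| `^ alpha * sin (theta * pi / 2))).
Proof.
move=> xi0; rewrite /psi /expi realM -!mulrA sin_sg cos_sg//.
by congr Complex; rewrite mulrCA.
Qed.

Lemma cexp_psi alpha theta s xi : xi != 0 ->
  cexp (- (real_complex R s * psi alpha theta xi)) =
  Complex (expR (- (s * cos (theta * pi / 2) * `|xi| `^ alpha))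
      * cos (s * sin (theta * pi / 2) * `|xi| `^ alpha))
    (- (Num.sg xi * (expR (- (s * cos (theta * pi / 2) * `|xi| `^ alpha))
      * sin (s * sin (theta * pi / 2) * `|xi| `^ alpha)))).
Proof.
move=> xi0; rewrite psiE// realM ComplexN /cexp /= /expi realM cosN sinN.
have -> : s * (Num.sg xi * (`|xi| `^ alpha * sin (theta * pi / 2))) =
  Num.sg xi * (s * sin (theta * pi / 2) * `|xi| `^ alpha) by ring.
have -> : s * (`|xi| `^ alpha * cos (theta * pi / 2)) =
  s * cos (theta * pi / 2) * `|xi| `^ alpha by ring.
by rewrite sin_sg cos_sg// mulrN; congr (Complex _ (- _)); rewrite mulrCA.
Qed.

End complex_exponential.

Section fourier_transform.
Context {R : realType}.
Local Notation mu := (@lebesgue_measure R).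
Local Notation L1 A f := (mu.-integrable A (EFin \o f)).
Implicit Types (f g : R -> R) (m s phi x xi c : R).

Lemma cos_mul_measurable xi : measurable_fun [set: measurableTypeR R] (fun x => cos (x * xi)).
Proof.
apply: (measurableT_comp (@continuous_measurable_fun _ _ (@continuous_cos R))).
by apply: measurable_funM.
Qed.

Lemma cos_mul_integrable f xi : L1 setT f -> L1 setT (fun x => cos (x * xi) * f x).
Proof.
move=> if_; apply: (@RintegrableM _ _ _ mu _ _ _ 1) => //.
  exact: cos_mul_measurable.
by move=> x _; exact: cos_max.
Qed.

Lemma sin_mul_measurable xi : measurable_fun [set: measurableTypeR R] (fun x => sin (x * xi)).
Proof.
apply: (measurableT_comp (@continuous_measurable_fun _ _ (@continuous_sin R))).
by apply: measurable_funM.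
Qed.

Lemma sin_mul_integrable f xi : L1 setT f -> L1 setT (fun x => sin (x * xi) * f x).
Proof.
move=> if_; apply: (@RintegrableM _ _ _ mu _ _ _ 1) => //.
  exact: sin_mul_measurable.
by move=> x _; exact: sin_max.
Qed.

Lemma hartleyE f xi : L1 setT f ->
  hartley f xi = complex.Re (fourier f xi) + complex.Im (fourier f xi).
Proof.
move=> if_; rewrite /= -RintegralD//; [|exact: cos_mul_integrable|exact: sin_mul_integrable].
by apply: eq_Rintegral => x _; rewrite mulrDl.
Qed.

Lemma fourier_hartley f xi : L1 setT f -> fourier f xi =
  Complex ((hartley f xi + hartley f (- xi)) / 2) ((hartley f xi - hartley f (- xi)) / 2).
Proof.
move=> if_; have iN : L1 setT (fun x => sin (x * xi) * f x).
  exact: sin_mul_integrable.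
have hN : hartley f (- xi) = complex.Re (fourier f xi) - complex.Im (fourier f xi).
  rewrite /= -RintegralB//; last exact: cos_mul_integrable.
  by apply: eq_Rintegral => x _; rewrite /cas mulrN cosN sinN mulrBl.
rewrite hN hartleyE//; case: (fourier f xi) => a b /=.
by congr Complex; field.
Qed.

Lemma fourierZ c f xi : L1 setT f ->
  fourier (fun x => c * f x) xi = real_complex R c * fourier f xi.
Proof.
move=> if_; rewrite /fourier realM -!RintegralZl//;
  [|exact: sin_mul_integrable|exact: cos_mul_integrable].
by congr Complex; apply: eq_Rintegral => x _; rewrite mulrCA.
Qed.

Lemma fourierB f g xi : L1 setT f -> L1 setT g ->
  fourier (fun x => f x - g x) xi = fourier f xi - fourier g xi.
Proof.
move=> if_ ig; rewrite /fourier ComplexN ComplexD -!RintegralB//;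
  [|exact: sin_mul_integrable|exact: sin_mul_integrable|exact: cos_mul_integrable
   |exact: cos_mul_integrable].
by congr Complex; apply: eq_Rintegral => x _; rewrite mulrBr.
Qed.

Variables alpha theta : R.
Local Notation omega := (theta * pi / 2).
Hypothesis alpha12 : 1 < alpha <= 2.
Hypothesis cos_gt0 : 0 < cos omega.

(** The kernel is half the Hartley transform of this function, by folding the
    line at 0; inversion then transforms the kernel itself. *)
Definition profile m s phi xi : R :=
  if 0 < xi then envelope alpha omega m s xi * cas (- phase alpha omega s phi 0 xi)
  else envelope alpha omega m s (- xi) * cas (phase alpha omega s phi 0 (- xi)).

Lemma envelope_measurable m s : measurable_fun setT (envelope alpha omega m s).
Proof.
apply: measurable_funM; first exact: measurable_powR.
apply: (measurableT_comp (@measurable_expR R)); apply: measurableT_comp => //.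
by apply: measurable_funM.
Qed.

Lemma phase_measurable s phi x : measurable_fun setT (phase alpha omega s phi x).
Proof.
by apply: measurable_funD => //; apply: measurable_funD; apply: measurable_funM.
Qed.

Lemma profile_measurable m s phi : measurable_fun setT (profile m s phi).
Proof.
have mN : measurable_fun setT (-%R : R -> R) by exact: oppr_measurable.
apply: measurable_fun_ifT; first exact: measurable_fun_ltr.
- apply: measurable_funM; first exact: envelope_measurable.
  apply: (measurableT_comp measurable_cas); apply: (measurableT_comp mN).
  exact: phase_measurable.
- apply: measurable_funM; first exact: (measurableT_comp (envelope_measurable _ _) mN).
  apply: (measurableT_comp measurable_cas).
  exact: (measurableT_comp (phase_measurable _ _ _) mN).
Qed.

Lemma norm_profile m s phi xi :
  `|profile m s phi xi| <= 2 * envelope alpha omega m s `|xi|.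
Proof.
rewrite /profile; case: ifPn => [xi0|].
  rewrite (gtr0_norm xi0) normrM (ger0_norm (envelope_ge0 _ _ _ _ _)) mulrC.
  by rewrite ler_wpM2r ?envelope_ge0// norm_cas.
rewrite -leNgt => xi0.
rewrite (ler0_norm xi0) normrM (ger0_norm (envelope_ge0 _ _ _ _ _)) mulrC.
by rewrite ler_wpM2r ?envelope_ge0// norm_cas.
Qed.

Lemma envelope_norm_integrable m s : -1 < m -> 0 < s ->
  L1 setT (fun xi => envelope alpha omega m s `|xi|).
Proof.
move=> m1 s0; apply: even_integrable.
- exact: (measurableT_comp (envelope_measurable _ _)).
- by move=> x; rewrite normrN.
have := envelope_integrable alpha12 cos_gt0 m1 s0.
apply: eq_integrable; first exact: measurable_itv.
move=> x; rewrite inE/= in_itv/= andbT => x0.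
by rewrite /= gtr0_norm.
Qed.

Lemma profile_integrable m s phi : -1 < m -> 0 < s -> L1 setT (profile m s phi).
Proof.
move=> m1 s0; have ie := envelope_norm_integrable m1 s0.
apply: (@le_Rintegrable _ _ _ mu _ _ _ measurableT (profile_measurable _ _ _)
  (fun x _ => norm_profile m s phi x)).
exact: (@RintegrableZ _ _ _ mu _ _ 2 measurableT ie).
Qed.

Lemma hartley_profile m s phi x : -1 < m -> 0 < s ->
  hartley (profile m s phi) x = 2 * kernel alpha omega m s phi x.
Proof.
move=> m1 s0; rewrite /hartley.
have i1 : L1 setT (fun xi => cas (xi * x) * profile m s phi xi).
  by apply: cas_mul_integrable; exact: profile_integrable.
rewrite reflect_Rintegral// -RintegralZl//; last exact: kernel_integrand_integrable.
apply: eq_Rintegral => xi; rewrite inE/= in_itv/= andbT => xi0.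
rewrite /profile xi0 oppr_gt0 ltNge (ltW xi0)/= opprK.
have -> : phase alpha omega s phi x xi = x * xi + phase alpha omega s phi 0 xi.
  by rewrite /phase mul0r add0r addrA.
rewrite cosD /cas mulNr !cosN !sinN [xi * x]mulrC; ring.
Qed.

Lemma continuous_profile m s phi xi : xi != 0 -> {for xi, continuous (profile m s phi)}.
Proof.
move=> xi0; have [xp|] := ltP 0 xi.
  have E : profile m s phi xi = envelope alpha omega m s xi
     * cas (- phase alpha omega s phi 0 xi) by rewrite /profile xp.
  suff : profile m s phi y @[y --> xi] --> profile m s phi xi by []; rewrite E.
  have c : {for xi, continuous (fun y => envelope alpha omega m s y
      * cas (- phase alpha omega s phi 0 y))}.
    apply: cvgM; first exact: continuous_envelope.
    apply: (@continuous_comp _ _ _ (fun y => - phase alpha omega s phi 0 y) cas).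
      by apply: cvgN; exact: continuous_phase.
    exact: continuous_cas.
  apply: cvg_trans c; apply: near_eq_cvg; near=> y; rewrite /profile ifT//.
  by near: y; exact: lt_nbhsr.
rewrite le_eqVlt (negbTE xi0)/= => xn; have xn' : 0 < - xi by rewrite oppr_gt0.
have E : profile m s phi xi = envelope alpha omega m s (- xi)
     * cas (phase alpha omega s phi 0 (- xi)) by rewrite /profile ltNge (ltW xn).
suff : profile m s phi y @[y --> xi] --> profile m s phi xi by []; rewrite E.
have c : {for xi, continuous (fun y => envelope alpha omega m s (- y)
      * cas (phase alpha omega s phi 0 (- y)))}.
  have cN : {for xi, continuous (fun y : R => - y)} by apply: cvgN; exact: cvg_id.
  apply: cvgM.
    exact: (@continuous_comp _ _ _ (fun y : R => - y)
      (envelope alpha omega m s) xi cN (@continuous_envelope R alpha omega m s _ xn')).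
  apply: (@continuous_comp _ _ _ (fun y => phase alpha omega s phi 0 (- y)) cas).
    exact: (@continuous_comp _ _ _ (fun y : R => - y)
      (phase alpha omega s phi 0) xi cN (@continuous_phase R alpha omega s phi 0 _ xn')).
  exact: continuous_cas.
apply: cvg_trans c; apply: near_eq_cvg; near=> y; rewrite /profile ifF//.
by apply/negbTE; rewrite -leNgt ltW//; near: y; exact: lt_nbhsl.
Unshelve. all: by end_near. Qed.

Lemma hartley_kernel m s phi xi : -1 < m -> 0 < s -> xi != 0 ->
  L1 setT (kernel alpha omega m s phi) ->
  hartley (kernel alpha omega m s phi) xi = pi * profile m s phi xi.
Proof.
move=> m1 s0 xi0 ik.
have HE : hartley (profile m s phi) = fun x => 2 * kernel alpha omega m s phi x.
  by apply/funext => x; exact: hartley_profile.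
have := @hartley_inversion R (profile m s phi) xi.
rewrite HE => /(_ (profile_integrable phi m1 s0)).
have -> : hartley (fun x => 2 * kernel alpha omega m s phi x) xi =
    2 * hartley (kernel alpha omega m s phi) xi.
  rewrite /hartley -RintegralZl//; last exact: cas_mul_integrable.
  by apply: eq_Rintegral => x _; rewrite mulrCA.
move=> /(_ (@RintegrableZ _ _ _ mu _ _ 2 measurableT ik) (@continuous_profile m s phi _ xi0)).
by move=> h; apply: (@mulfI _ 2); [rewrite pnatr_eq0|rewrite h mulrA].
Qed.

(** Even and odd parts of the Hartley transform are the cosine and the sine
    transform, so the profile at xi and - xi determines both. *)
Theorem fourier_kernel m s phi xi : -1 < m -> 0 < s -> xi != 0 ->
  L1 setT (kernel alpha omega m s phi) ->
  fourier (fun x => pi^-1 * kernel alpha omega m s phi x) xi =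
  real_complex R (`|xi| `^ m) * expi (- (Num.sg xi * phi))
    * cexp (- (real_complex R s * psi alpha theta xi)).
Proof.
move=> m1 s0 xi0 ik; rewrite fourierZ// fourier_hartley// !hartley_kernel ?oppr_eq0//.
rewrite cexp_psi// /expi !realM ComplexM.
rewrite cosN sinN sin_sg cos_sg//.
have pi0 : pi != 0 :> R by rewrite gt_eqF// pi_gt0.
have phE y : phase alpha omega s phi 0 y = s * sin omega * y `^ alpha + phi.
  by rewrite /phase mul0r add0r.
have [xp|xn] := ltP 0 xi.
  rewrite /profile xp oppr_gt0 ltNge (ltW xp)/= opprK gtr0_sg// gtr0_norm//.
  rewrite !phE /cas cosN sinN cosD sinD /envelope !mul1r.
  by congr Complex; move: (@pi R) pi0 => q q0; field; rewrite q0.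
have xl : xi < 0 by rewrite lt_neqAle xi0.
rewrite /profile oppr_gt0 xl ltNge xn/= ltr0_sg// ltr0_norm//.
rewrite !phE /cas cosN sinN cosD sinD /envelope !mulN1r.
by congr Complex; move: (@pi R) pi0 => q q0; field; rewrite q0.
Qed.

End fourier_transform.

(** * The exponential series of a rotated argument *)

Section exponential_series.
Context {R : realType}.
Implicit Types (y w phi : R) (N : nat).

(** Real part of the partial sums of e^{i phi} exp(y e^{i w}); the shift of
    phi by - pi / 2 gives the imaginary part. *)
Definition cos_series y w phi N : R :=
  \sum_(n < N) y ^+ n / n`!%:R * cos (n%:R * w + phi).

Let remainder N w phi y : R := expR (y * cos w) * cos (y * sin w + phi)
  - cos_series y w phi N.

Lemma is_derive_exprn n y :
  is_derive y 1 (fun y : R => y ^+ n) (n%:R * y ^+ n.-1).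
Proof.
rewrite (_ : (fun y : R => y ^+ n) = (id : R -> R) ^+ n); last first.
  by apply/funext => z; rewrite exprfctE.
by apply: is_derive_eq; rewrite /GRing.scale/= mulr1.
Qed.

Let is_derive_remainder N w phi y :
  is_derive y 1 (remainder N.+1 w phi) (remainder N w (phi + w) y).
Proof.
have d1 : is_derive y 1 (fun y => expR (y * cos w) * cos (y * sin w + phi))
    (expR (y * cos w) * cos (y * sin w + (phi + w))).
  have darg : is_derive y 1 (fun y => y * cos w) (cos w).
    by apply: is_derive_eq; rewrite /GRing.scale/=; ring.
  have dexp := is_derive1_comp (@is_derive_expR R _) darg.
  have darg2 : is_derive y 1 (fun y => y * sin w + phi) (sin w).
    by apply: is_derive_eq; rewrite /GRing.scale/=; ring.
  have dcos := is_derive_cos_comp darg2.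
  apply: is_derive_eq; rewrite /GRing.scale/= addrA [in RHS]cosD cosDpihalf.
  by ring.
have d2 : is_derive y 1 (fun y => cos_series y w phi N.+1) (cos_series y w (phi + w) N).
  have E : (fun y => cos_series y w phi N.+1) = \sum_(n < N.+1)
      (fun y => cos (n%:R * w + phi) / n`!%:R * y ^+ n).
    apply/funext => z; rewrite fct_sumE; apply: eq_bigr => n _; ring.
  rewrite E; have -> : cos_series y w (phi + w) N = \sum_(n < N.+1)
      (cos (n%:R * w + phi) / n`!%:R * (n%:R * y ^+ n.-1)).
    rewrite big_ord_recl /= !mul0r mulr0 add0r; apply: eq_bigr => n _.
    rewrite /bump/= add1n /= factS natrM -natr1 mulrDl mul1r -addrA [w + phi]addrC.
    by field; rewrite pnatr_eq0 -lt0n fact_gt0 natr1 pnatr_eq0.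
  have dn (n : 'I_N.+1) : is_derive y 1
      (fun y => cos (n%:R * w + phi) / n`!%:R * y ^+ n)
      (cos (n%:R * w + phi) / n`!%:R * (n%:R * y ^+ n.-1)).
    by have dX := is_derive_exprn n y; apply: is_derive_eq.
  exact: (is_derive_sum dn).
exact: is_deriveB.
Qed.

(** Taylor estimate by induction: differentiating in y lowers N and turns phi
    by w. *)
Lemma cos_series_remainder N w phi y : 0 <= y ->
  `|expR (y * cos w) * cos (y * sin w + phi) - cos_series y w phi N|
  <= expR y * y ^+ N / N`!%:R.
Proof.
rewrite -/(remainder N w phi y); elim: N phi y => [|N ih] phi y y0.
  rewrite /remainder /cos_series big_ord0 subr0 expr0 fact0 divr1 mulr1.
  rewrite normrM ger0_norm ?expR_ge0// -[leRHS]mulr1; apply: ler_pM; rewrite ?expR_ge0 ?cos_max//.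
  by rewrite ler_expR ler_piMr// cos_le1.
have dr z := is_derive_remainder N w phi z.
have r0 : remainder N.+1 w phi 0 = 0.
  rewrite /remainder /cos_series big_ord_recl /= expr0 fact0 divr1 mul1r !mul0r expR0.
  by rewrite mul1r !add0r big1 ?addr0 ?subrr// => i _; rewrite /bump/= exprS !mul0r.
pose G (z : R) : R := expR y * z ^+ N.+1 / N.+1`!%:R.
have dG (z : R) : is_derive z 1 G (expR y * z ^+ N / N`!%:R).
  have dX := is_derive_exprn N.+1 z.
  apply: is_derive_eq; rewrite /GRing.scale/= factS natrM.
  by field; rewrite nat1r !pnatr_eq0 -lt0n fact_gt0.
have bound (c : R) : c \in `]0, y[ -> `|remainder N w (phi + w) c| <= expR y * c ^+ N / N`!%:R.
  rewrite in_itv/= => /andP[c0 cy]; apply: le_trans (ih _ _ (ltW c0)) _.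
  rewrite ler_wpM2r ?invr_ge0// ler_wpM2r ?exprn_ge0 ?(ltW c0)//.
  by rewrite ler_expR ltW.
(* G + remainder and G - remainder are nondecreasing and vanish at 0 *)
have side (sg : R) : sg = 1 \/ sg = -1 -> 0 <= G y + sg * remainder N.+1 w phi y.
  move=> hsg; move: y0; rewrite le_eqVlt => /predU1P[<-|y0].
    by rewrite r0 /G exprS mul0r mulr0 mul0r mulr0 addr0.
  pose F z := G z + sg * remainder N.+1 w phi z.
  have dF (z : R) : is_derive z 1 F (expR y * z ^+ N / N`!%:R + sg * remainder N w (phi + w) z).
    have := dr z; have := dG z => ? ?; apply: is_derive_eq.
    by rewrite /GRing.scale/=.
  have [|c cy E] := @MVT _ F _ 0 y y0 (fun t _ => dF t).
    by apply: derivable_within_continuous => t _; have [] := dF t.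
  have F0 : F 0 = 0 by rewrite /F r0 /G exprS mul0r mulr0 mul0r mulr0 addr0.
  rewrite F0 !subr0 in E; rewrite -/(F y) E mulr_ge0 ?(ltW y0)//.
  by have := bound c cy; case: hsg => ->; rewrite ler_norml => /andP[]; lra.
rewrite -/(G y) ler_norml; apply/andP; split.
  by have := side 1 (or_introl erefl); lra.
by have := side (-1) (or_intror erefl); lra.
Qed.

Lemma cos_series_cvg w phi y : 0 <= y ->
  cos_series y w phi N @[N --> \oo] --> expR (y * cos w) * cos (y * sin w + phi).
Proof.
move=> y0; apply/cvgrPdist_le => e e0.
have : (expR y * exp_coeff y N) @[N --> \oo] --> expR y * 0.
  by apply: cvgMr; apply: cvg_series_cvg_0; exact: is_cvg_series_exp_coeff.
rewrite mulr0 => /cvgrPdist_le/(_ _ e0); apply: filterS => N.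
rewrite sub0r normrN ger0_norm => [h|]; last first.
  by rewrite mulr_ge0 ?expR_ge0 ?divr_ge0 ?exprn_ge0.
by apply: le_trans (cos_series_remainder _ _ _ y0) _; rewrite -mulrA.
Qed.

Lemma norm_cos_series N w phi y : 0 <= y -> `|cos_series y w phi N| <= expR y.
Proof.
move=> y0; apply: (@le_trans _ _ (series (exp_coeff y) N)).
  rewrite /series/= big_mkord; apply: le_trans (ler_norm_sum _ _ _) _.
  apply: ler_sum => n _; rewrite normrM ger0_norm ?divr_ge0 ?exprn_ge0//.
  by rewrite /exp_coeff ler_piMr ?divr_ge0 ?exprn_ge0// cos_max.
apply: nondecreasing_cvgn_le; last exact: is_cvg_series_exp_coeff.
by apply: nondecreasing_series => n _ _; rewrite divr_ge0 ?exprn_ge0.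
Qed.

End exponential_series.

(** * Symbols and their operators *)

Section symbol_operators.
Context {R : realType}.
Local Notation mu := (@lebesgue_measure R).
Local Notation L1 A f := (mu.-integrable A (EFin \o f)).
Implicit Types (f g h : R -> R) (m : R -> R[i]) (alpha theta xi y w : R).

Lemma symbol_image_unique m f g g' :
  symbol_image m f g -> symbol_image m f g' -> g = g'.
Proof.
move=> [if_ ig cg Hg] [_ ig' cg' Hg']; apply/funext => x.
apply/eqP; rewrite -subr_eq0; apply/eqP.
have iB : L1 setT (fun x => g x - g' x).
  exact: (@RintegrableB _ _ _ mu _ _ _ measurableT ig ig').
apply: (@hartley_eq0 _ (fun x => g x - g' x) iB).
  by move=> z; apply: cvgB; [exact: cg|exact: cg'].
by move=> xi xi0; rewrite hartleyE// fourierB// Hg// Hg'// subrr /= addr0.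
Qed.

Lemma symbol_opE m f g : symbol_image m f g -> symbol_op m f = g.
Proof.
move=> Hg; apply: (@symbol_image_unique m f) => //.
by apply: (@xgetPex _ (fun=> 0) [set g | symbol_image m f g]); exists g.
Qed.

Lemma neg_psiE alpha theta xi : - psi alpha theta xi =
  real_complex R (`|xi| `^ alpha) * expi (Num.sg xi * theta * pi / 2 + pi).
Proof. by rewrite expiD expi_pi /psi mulrN1 mulrN. Qed.

Lemma expi_expn w n : expi w ^+ n = expi (n%:R * w).
Proof.
elim: n => [|n ih].
  by rewrite expr0 mul0r /expi cos0 sin0.
by rewrite exprS ih -expiD -nat1r mulrDl mul1r.
Qed.

Lemma real_expn y n : real_complex R y ^+ n = real_complex R (y ^+ n).
Proof. by elim: n => [//|n ih]; rewrite !exprS ih real_realM. Qed.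

Lemma cexp_realM y w : cexp (real_complex R y * expi w) =
  real_complex R (expR (y * cos w)) * expi (y * sin w).
Proof. by rewrite {1}/expi realM. Qed.

(** Multiplication by r e^{i t} in the coordinates Re + Im and Re - Im, which
    for a transform are the Hartley transform at xi and at - xi. *)
Lemma Re_Im_rotate (r t : R) (z : R[i]) :
  complex.Re (real_complex R r * expi t * z) + complex.Im (real_complex R r * expi t * z)
  = r * (cos t * (complex.Re z + complex.Im z)
         + cos (t - pi / 2) * (complex.Re z - complex.Im z)).
Proof.
case: z => a b; rewrite /expi realM ComplexM /= cosB cos_pihalf sin_pihalf; ring.
Qed.

Lemma hartley_Re_Im f xi : L1 setT f ->
  hartley f (- xi) = complex.Re (fourier f xi) - complex.Im (fourier f xi).
Proof.
by move=> if_; rewrite fourier_hartley//=; field.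
Qed.

Lemma norm_hartley_le f xi : L1 setT f -> `|hartley f xi| <= 2 * \int[mu]_x `|f x|.
Proof.
move=> if_; have i2 := @RintegrableZ _ _ _ mu _ _ 2 measurableT (integrable_norm if_).
rewrite -RintegralZl//; last exact: integrable_norm.
apply: (@normr_Rintegral_le _ _ _ mu _ _ _ measurableT _ _ i2).
  exact: integrable_measurable (cas_mul_integrable xi if_).
by move=> x _; rewrite normrM ler_wpM2r// norm_cas.
Qed.

Lemma smoothing_integrable f (sigma y : R) : L1 setT f -> 0 < sigma ->
  L1 setT (fun xi => cas (y * xi) * gauss_factor sigma xi * hartley f xi).
Proof.
move=> if_ s0; pose C := 2 * (2 * \int[mu]_x `|f x|).
apply: (@eq_integrable _ _ _ mu _ measurableT (EFin \o (fun xi =>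
    (cas (y * xi) * hartley f xi) * gauss_factor sigma xi))) => //.
  by move=> xi _ /=; rewrite mulrAC.
apply: (@RintegrableM _ _ _ mu _ _ _ C) => //; last exact: gauss_factor_integrable.
  apply: measurable_funM; last exact: hartley_measurable.
  by apply: (measurableT_comp measurable_cas); apply: measurable_funM.
move=> xi _; rewrite normrM; apply: ler_pM => //; first exact: norm_cas.
exact: norm_hartley_le.
Qed.

(** A symbol of size e^{|xi|^alpha} applied to a transform decaying like
    e^{- c |xi|^alpha} must be integrable against every Gaussian. For alpha = 2
    this forces c = 1. *)
Lemma subgaussian_power alpha (c eps : R) : 0 < alpha <= 2 -> 0 < eps ->
  0 < c -> c <= 1 -> (alpha < 2 \/ c = 1) ->
  exists2 C, 0 <= C & forall x, 0 < x -> (1 - c) * x `^ alpha <= eps * x ^+ 2 + C.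
Proof.
move=> /andP[a0 a2] e0 c0 c1 [al2|->]; last first.
  exists 0 => // x x0; rewrite subrr mul0r addr0 mulr_ge0 ?sqr_ge0//; exact: ltW.
pose X := ((1 - c) / eps) `^ (2 - alpha)^-1.
have X0 : 0 <= X by exact: powR_ge0.
have al : 0 < 2 - alpha by lra.
have q0 : 0 <= (1 - c) / eps by rewrite divr_ge0 ?(ltW e0)//; lra.
exists ((1 - c) * X `^ alpha); first by rewrite mulr_ge0 ?powR_ge0//; lra.
move=> x x0; have [xX|Xx] := leP x X.
  apply: (@le_trans _ _ ((1 - c) * X `^ alpha)).
    apply: ler_wpM2l; first by lra.
    by apply: ge0_ler_powR; rewrite ?nnegrE ?(ltW a0) ?(ltW x0).
  by rewrite lerDr mulr_ge0 ?sqr_ge0// ltW.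
rewrite ler_wpDr//; first by rewrite mulr_ge0 ?powR_ge0//; lra.
have h : (1 - c) / eps <= x `^ (2 - alpha).
  have -> : (1 - c) / eps = X `^ (2 - alpha).
    by rewrite /X -powRrM mulVf ?gt_eqF// powRr1.
  by apply: ge0_ler_powR; rewrite ?nnegrE ?(ltW al) ?(ltW x0) ?(ltW Xx).
rewrite -(powR_mulrn 2) ?(ltW x0)// (_ : 2%:R = (2 - alpha) + alpha); last by lra.
by rewrite powRDpos// mulrA ler_wpM2r ?powR_ge0// mulrC -ler_pdivrMr.
Qed.

Lemma gauss_power_integrable alpha (c sigma : R) : 0 < alpha <= 2 -> 0 < sigma ->
  0 < c -> c <= 1 -> (alpha < 2 \/ c = 1) ->
  L1 setT (fun xi => gauss_factor sigma xi * expR ((1 - c) * `|xi| `^ alpha)).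
Proof.
move=> a02 s0 c0 c1 ac.
have e0 : 0 < sigma ^+ 2 / 4 by rewrite divr_gt0// exprn_gt0.
have [C C0 hC] := subgaussian_power a02 e0 c0 c1 ac.
pose sg := sigma / Num.sqrt 2.
have sg0 : 0 < sg by rewrite divr_gt0// sqrtr_gt0.
have sg2 : sg ^+ 2 = sigma ^+ 2 / 2 by rewrite exprMn exprVn sqr_sqrtr.
apply: (@le_Rintegrable _ _ _ mu _ _ (fun xi => expR C * gauss_factor sg xi)) => //.
- apply: measurable_funM; first exact: gauss_factor_measurable.
  apply: (measurableT_comp (@measurable_expR R)); apply: measurable_funM => //.
  exact: (measurableT_comp (@measurable_powR R alpha)).
- move=> xi _; rewrite ger0_norm ?mulr_ge0 ?expR_ge0// /gauss_factor -!expRD ler_expR.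
  have h : (1 - c) * `|xi| `^ alpha <= sigma ^+ 2 / 4 * xi ^+ 2 + C.
    have [->|xi0] := eqVneq xi 0.
      rewrite normr0 powR0 ?gt_eqF//; last by case/andP: a02.
      by rewrite mulr0 expr0n/= mulr0 add0r.
    by rewrite -(real_normK (num_real xi)); apply: hC; rewrite normr_gt0.
  rewrite sg2; move: h; set p := `|xi| `^ alpha; set q := xi ^+ 2; set r := sigma ^+ 2.
  by lra.
- exact: (@RintegrableZ _ _ _ mu _ _ (expR C) measurableT (gauss_factor_integrable sg0)).
Qed.

End symbol_operators.

(** * The fractional shift operator *)

Section fractional_shift.
Context {R : realType}.
Local Notation mu := (@lebesgue_measure R).
Local Notation L1 A f := (mu.-integrable A (EFin \o f)).
Variables (alpha theta K : R) (f h : R -> R).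
Local Notation omega := (theta * pi / 2).
Local Notation D := (riesz_feller alpha theta).
Local Notation S := (shift_series alpha theta 1 f).
Local Notation Dsym := (riesz_feller_symbol alpha theta).
Implicit Types (xi y : R).

Hypothesis alpha02 : 0 < alpha <= 2.
Hypothesis cos_gt0 : 0 < cos omega.
Hypothesis alpha2cos : alpha < 2 \/ cos omega = 1.
Hypothesis image_h : symbol_image (frac_shift_symbol alpha theta 1) f h.
Hypothesis continuous_f : continuous f.
Hypothesis decay_f : forall xi, xi != 0 ->
  `|hartley f xi| <= K * expR (- (cos omega * `|xi| `^ alpha)).

(* - psi(xi) = |xi|^alpha e^{i angle(xi)} *)
Let angle xi : R := Num.sg xi * theta * pi / 2 + pi.

Section iterates.
Hypothesis iterates : forall n, symbol_image Dsym (iter n D f) (iter n.+1 D f).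

Let iter_integrable n : L1 setT (iter n D f).
Proof. by have [] := iterates n. Qed.

Let iter_continuous n : continuous (iter n D f).
Proof. by case: n => [//|n]; have [] := iterates n. Qed.

Let hartley_iter n xi : xi != 0 -> hartley (iter n D f) xi =
  (`|xi| `^ alpha) ^+ n * (cos (n%:R * angle xi + 0) * hartley f xi
    + cos (n%:R * angle xi + (- (pi / 2))) * hartley f (- xi)).
Proof.
move=> xi0; have if_ := iter_integrable 0.
have F : fourier (iter n D f) xi = Dsym xi ^+ n * fourier f xi.
  elim: n => [|n ih]; first by rewrite expr0 mul1r.
  have [_ _ _ ->//] := iterates n.
  by rewrite ih exprS mulrA.
rewrite (hartleyE _ (iter_integrable n)) F /riesz_feller_symbol neg_psiE.
rewrite exprMn expi_expn real_expn Re_Im_rotate -hartley_Re_Im//.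
by rewrite -hartleyE// addr0.
Qed.

Lemma partial_shift_spec N : [/\ L1 setT (S N), continuous (S N) &
  forall xi, xi != 0 -> hartley (S N) xi =
    cos_series (`|xi| `^ alpha) (angle xi) 0 N * hartley f xi
    + cos_series (`|xi| `^ alpha) (angle xi) (- (pi / 2)) N * hartley f (- xi)].
Proof.
elim: N => [|N [iS cS hS]].
  have -> : S 0%N = fun=> 0 by apply/funext => x; rewrite /shift_series big_ord0.
  split; [exact: integrable0|by move=> x; exact: cvg_cst|].
  move=> xi xi0; rewrite /cos_series !big_ord0 !mul0r addr0 /hartley.
  by under eq_Rintegral do rewrite mulr0; rewrite Rintegral_cst// mul0r.
have E : S N.+1 = fun x => S N x + N`!%:R^-1 * iter N D f x.
  by apply/funext => x; rewrite /shift_series big_ord_recr/= expr1n mul1r.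
have iZ := @RintegrableZ _ _ _ mu _ _ (N`!%:R^-1) measurableT (iter_integrable N).
rewrite E; split.
- exact: (@RintegrableD _ _ _ mu _ _ _ measurableT iS iZ).
- move=> x; apply: cvgD; first exact: cS.
  by apply: cvgMr; exact: iter_continuous.
move=> xi xi0; rewrite (_ : hartley _ xi =
    hartley (S N) xi + N`!%:R^-1 * hartley (iter N D f) xi); last first.
  rewrite /hartley -RintegralZl//; last exact: cas_mul_integrable.
  rewrite -RintegralD//; [|exact: cas_mul_integrable|].
    by apply: eq_Rintegral => x _; rewrite mulrDr [X in _ + X]mulrCA.
  exact: (@RintegrableZ _ _ _ mu _ _ _ measurableT (cas_mul_integrable _ (iter_integrable N))).
rewrite hS// hartley_iter// /cos_series !big_ord_recr/=; ring.
Qed.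

Let hartley_h xi : xi != 0 -> hartley h xi =
  expR (`|xi| `^ alpha * cos (angle xi)) *
    (cos (`|xi| `^ alpha * sin (angle xi) + 0) * hartley f xi
     + cos (`|xi| `^ alpha * sin (angle xi) + (- (pi / 2))) * hartley f (- xi)).
Proof.
move=> xi0; have [if_ ih _ F] := image_h.
rewrite (hartleyE _ ih) F// /frac_shift_symbol.
have -> : - (real_complex R 1 * psi alpha theta xi) =
    real_complex R (`|xi| `^ alpha) * expi (angle xi).
  by rewrite -neg_psiE; congr (- _); rewrite -[RHS]mul1r.
by rewrite cexp_realM Re_Im_rotate -hartley_Re_Im// -hartleyE// addr0.
Qed.

(** After multiplication by a Gaussian the partial exponential series of the
    symbol is dominated, so Gaussian averages of the partial sums converge to
    those of h, although the series itself is unbounded in frequency. *)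
Lemma smoothed_partial_shift_cvg sigma y : 0 < sigma ->
  \int[mu]_x (S N x * normal_pdf y sigma x) @[N --> \oo] -->
  \int[mu]_x (h x * normal_pdf y sigma x).
Proof.
move=> s0; have [if_ ih _ _] := image_h.
have c1 := cos_le1 omega.
have iG := gauss_power_integrable alpha02 s0 cos_gt0 c1 alpha2cos.
pose A := [set: R] `\` [set (0 : R)].
have mA : measurable (A : set (measurableTypeR R)) by exact: measurableD.
have A0 xi : A xi -> xi != 0 by move=> [_ /eqP].
have HE g : L1 setT g -> \int[mu]_x (g x * normal_pdf y sigma x) = (2 * pi)^-1 *
    \int[mu]_(xi in A) (cas (y * xi) * gauss_factor sigma xi * hartley g xi).
  move=> ig; have p0 : 2 * pi != 0 :> R by rewrite mulf_neq0 ?pnatr_eq0// gt_eqF// pi_gt0.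
  rewrite (_ : \int[mu]_(xi in A) _ =
      \int[mu]_xi (cas (y * xi) * gauss_factor sigma xi * hartley g xi)).
    by rewrite hartley_smoothing// mulKf.
  apply/esym; congr fine; apply: negligible_integral => //; last exact: lebesgue_measure_set1.
  exact: smoothing_integrable.
have mF g : L1 setT g -> measurable_fun A
    (fun xi => cas (y * xi) * gauss_factor sigma xi * hartley g xi).
  by move=> ig; apply: measurable_funTS; apply: integrable_measurable (smoothing_integrable y ig s0).
have iS N : L1 setT (S N) by have [] := partial_shift_spec N.
have [||||_ lim] := @Rdominated_cvg _ _ _ mu A
  (fun N xi => cas (y * xi) * gauss_factor sigma xi * hartley (S N) xi)
  (fun xi => cas (y * xi) * gauss_factor sigma xi * hartley h xi)
  (fun xi => (4 * K) * (gauss_factor sigma xi * expR ((1 - cos omega) * `|xi| `^ alpha)))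
  mA.
- by move=> N; exact: mF.
- move=> xi /A0 xi0; apply: cvgMr.
  under eq_fun => N do rewrite (let: And3 _ _ e := partial_shift_spec N in e) ?xi0//.
  rewrite hartley_h// mulrDr !mulrA.
  by apply: cvgD; apply: cvgMl; apply: cos_series_cvg; exact: powR_ge0.
- move=> N xi /A0 xi0; have [_ _ ->//] := partial_shift_spec N.
  have p0 : 0 <= `|xi| `^ alpha by exact: powR_ge0.
  rewrite normrM normrM (ger0_norm (gauss_factor_ge0 _ _)).
  have -> : 4 * K * (gauss_factor sigma xi * expR ((1 - cos omega) * `|xi| `^ alpha)) =
      2 * gauss_factor sigma xi * (2 * (expR (`|xi| `^ alpha)
        * (K * expR (- (cos omega * `|xi| `^ alpha))))).
    by rewrite mulrBl mul1r expRD; ring.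
  apply: ler_pM; rewrite ?mulr_ge0 ?gauss_factor_ge0//.
    by rewrite ler_wpM2r ?gauss_factor_ge0// norm_cas.
  apply: le_trans (ler_normD _ _) _; rewrite [leRHS]mulr_natl [leRHS]mulr2n.
  apply: lerD; rewrite normrM; apply: ler_pM; rewrite ?norm_cos_series//.
    exact: decay_f.
  by rewrite -[`|xi|]normrN; apply: decay_f; rewrite oppr_eq0.
- apply: (integrableS measurableT mA) => //.
  exact: (@RintegrableZ _ _ _ mu _ _ (4 * K) measurableT iG).
rewrite HE//; under eq_fun => N do rewrite (HE _ (iS N)).
exact: cvgMr.
Qed.

End iterates.

(** A uniform limit is also the limit of Gaussian averages, which is known;
    letting the width tend to 0 recovers the values. *)
Theorem shift_series_limit g : shift_series_cvg alpha theta 1 f g -> g = h.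
Proof.
move=> [iterates uni]; apply/funext => y.
have [_ ih ch _] := image_h.
apply/eqP; rewrite -subr_eq0 -normr_le0; apply/ler_addgt0Pr => eta eta0.
rewrite add0r; have e3 : 0 < eta / 3 by rewrite divr_gt0.
have [N0 hN0] : exists N0, forall N, (N0 <= N)%N -> forall x, `|g x - S N x| <= eta / 3.
  have /uni [N0 _ h0] : nbhs (g : {uniform R -> R}) [set k | forall x, `|g x - k x| <= eta / 3].
    apply/uniform_nbhs; exists [set z : R * R | ball z.1 (eta / 3) z.2]; split.
      exact: (entourage_ball _ (PosNum e3)).
    by move=> k hk x; apply: ltW; exact: hk.
  by exists N0 => N /h0.
have iS N : L1 setT (S N) by have [] := partial_shift_spec iterates N.
have close sigma : 0 < sigma ->
   `|\int[mu]_x (S N0 x * normal_pdf y sigma x) - \int[mu]_x (h x * normal_pdf y sigma x)|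
     <= eta / 3 * 2.
  move=> s0; have c := @smoothed_partial_shift_cvg iterates _ y s0.
  have c' : `|\int[mu]_x (S N0 x * normal_pdf y sigma x)
      - \int[mu]_x (S N x * normal_pdf y sigma x)| @[N --> \oo] -->
    `|\int[mu]_x (S N0 x * normal_pdf y sigma x) - \int[mu]_x (h x * normal_pdf y sigma x)|.
    by apply: cvg_norm; apply: cvgB => //; exact: cvg_cst.
  rewrite -(cvg_lim _ c')//; apply: limr_le; first by apply/cvg_ex; eexists; exact: c'.
  near=> N; have NN : (N0 <= N)%N by near: N; exact: nbhs_infty_ge.
  rewrite /= -RintegralB//; [|exact: mul_pdf_integrable..].
  have ip := @RintegrableZ _ _ _ mu _ _ (eta / 3 * 2) measurableT (integrable_normal_pdf y sigma).
  apply: (@le_trans _ _ (\int[mu]_x (eta / 3 * 2 * normal_pdf y sigma x))); last first.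
    rewrite RintegralZl ?Rintegral_normal_pdf ?mulr1//.
    exact: integrable_normal_pdf.
  apply: (@normr_Rintegral_le _ _ _ mu _ _ _ measurableT _ _ ip).
    by apply: measurable_funB; apply: integrable_measurable (mul_pdf_integrable _ (iS _) s0).
  move=> x _; rewrite -mulrBl normrM (ger0_norm (normal_pdf_ge0 _ _ _)).
  rewrite ler_wpM2r ?normal_pdf_ge0//.
  have -> : S N0 x - S N x = (g x - S N x) - (g x - S N0 x) by ring.
  apply: le_trans (ler_normB _ _) _.
  by have := hN0 _ (leqnn N0) x; have := hN0 _ NN x; lra.
have : `|S N0 y - h y| <= eta / 3 * 2.
  have cS : {for y, continuous (S N0)} by have [_ cS _] := partial_shift_spec iterates N0; exact: cS.
  have c' : `|\int[mu]_x (S N0 x * normal_pdf y (sigma_ n) x)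
      - \int[mu]_x (h x * normal_pdf y (sigma_ n) x)| @[n --> \oo] --> `|S N0 y - h y|.
    by apply: cvg_norm; apply: cvgB; apply: normal_approximation => //; exact: ch.
  rewrite -(cvg_lim _ c')//; apply: limr_le; first by apply/cvg_ex; eexists; exact: c'.
  by near=> n; apply: close; rewrite invr_gt0.
have := hN0 _ (leqnn N0) y => h1 h2.
have -> : g y - h y = (g y - S N0 y) + (S N0 y - h y) by ring.
apply: le_trans (ler_normD _ _) _; lra.
Unshelve. all: by end_near. Qed.

(** Whether or not the exponential series converges uniformly, the value is
    the image of f under the symbol. *)
Theorem frac_shiftE : frac_shift alpha theta 1 f = h.
Proof.
rewrite /frac_shift; case: xgetP => [g _ /shift_series_limit//|_].
exact: symbol_opE.
Qed.

End fractional_shift.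

(** * Stable densities *)

Section stable_density.
Context {R : realType}.
Local Notation mu := (@lebesgue_measure R).
Local Notation L1 A f := (mu.-integrable A (EFin \o f)).
Variables alpha theta : R.
Local Notation omega := (theta * pi / 2).
Hypothesis alpha12 : 1 < alpha <= 2.
Hypothesis cos_gt0 : 0 < cos omega.
Implicit Types (s x xi : R).

(** The functions with Fourier transforms e^{- s psi} and - psi e^{- s psi};
    the second is also the derivative of the first in s. *)
Definition stable_density s x : R := pi^-1 * kernel alpha omega 0 s 0 x.

Definition stable_generator s x : R := - (pi^-1 * kernel alpha omega alpha s (- omega) x).

Local Notation p := stable_density.
Local Notation Dp := stable_generator.

(** What makes the mixtures of a family of kernels over geometric weights
    continuous and integrable. *)
Definition tame (K : R -> R -> R) :=
  (forall s, 1 <= s -> continuous (K s)) /\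
  exists2 C, 0 <= C & forall s x, 1 <= s ->
    `|K s x| <= C * (1 + s) ^+ 4 * weight alpha x.

Lemma tame_bound K : (forall s, 1 <= s -> continuous (K s)) ->
  (exists2 C, 0 <= C & forall s x, 1 <= s ->
    `|K s x| <= C * (1 + s) ^+ 3 * weight alpha x) -> tame K.
Proof.
move=> cK [C C0 hC]; split => //; exists C => // s x s1.
apply: le_trans (hC _ _ s1) _; rewrite ler_wpM2r ?weight_ge0// ler_wpM2l//.
by rewrite ler_weXn2l//; lra.
Qed.

Lemma tame_integrable K s : tame K -> 1 <= s -> L1 setT (K s).
Proof.
move=> [cK [C _ hC]] s1.
have iw : L1 setT (weight alpha) by apply: weight_integrable; case/andP: alpha12.
apply: (@le_Rintegrable _ _ _ mu _ _ (fun x => C * (1 + s) ^+ 4 * weight alpha x)) => //.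
- by apply: continuous_measurable_fun; exact: cK.
- by move=> x _; exact: hC.
- exact: (@RintegrableZ _ _ _ mu _ _ (C * (1 + s) ^+ 4) measurableT iw).
Qed.

Let pi_inv0 : 0 <= pi^-1 :> R. Proof. by rewrite invr_ge0 pi_ge0. Qed.
Let m0 : (-1 : R) < 0. Proof. by lra. Qed.
Let ma : -1 < alpha. Proof. by case/andP: alpha12; lra. Qed.

Lemma normalized_kernel_bound m s0 phi : -1 < m -> 0 < s0 ->
  exists2 M, 0 <= M & forall s x, s0 <= s -> `|pi^-1 * kernel alpha omega m s phi x| <= M.
Proof.
move=> m1 s00; exists (pi^-1 * envelope_mass alpha omega m s0).
  by rewrite mulr_ge0// envelope_mass_ge0.
move=> s x ss; rewrite normrM (ger0_norm pi_inv0); apply: ler_wpM2l => //.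
exact: kernel_le_mass.
Qed.

Lemma continuous_stable_density s : 1 <= s -> continuous (p s).
Proof.
move=> s1 x; apply: cvgMr; apply: continuous_kernel => //; lra.
Qed.

Lemma tame_density : tame p.
Proof.
apply: tame_bound; first exact: continuous_stable_density.
have [C C0 hC] := density_kernel_bound alpha12 cos_gt0.
exists (pi^-1 * C); first exact: mulr_ge0.
move=> s x s1; rewrite normrM (ger0_norm pi_inv0).
rewrite -(mulrA pi^-1 C) -(mulrA pi^-1 (C * _)).
by apply: ler_wpM2l => //; exact: hC.
Qed.

Lemma tame_xdensity : tame (fun s x => x * p s x).
Proof.
apply: tame_bound.
  by move=> s s1 x; apply: cvgM; [exact: cvg_id|exact: continuous_stable_density].
have [C C0 hC] := xdensity_kernel_bound alpha12 cos_gt0.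
exists (pi^-1 * C); first exact: mulr_ge0.
move=> s x s1; rewrite mulrCA normrM (ger0_norm pi_inv0).
rewrite -(mulrA pi^-1 C) -(mulrA pi^-1 (C * _)).
by apply: ler_wpM2l => //; exact: hC.
Qed.

Lemma tame_generator : tame Dp.
Proof.
apply: tame_bound.
  move=> s s1 x; apply: cvgN; apply: cvgMr; apply: continuous_kernel => //; lra.
have [C C0 hC] := generator_kernel_bound alpha12 cos_gt0.
exists (pi^-1 * C); first exact: mulr_ge0.
move=> s x s1; rewrite normrN normrM (ger0_norm pi_inv0).
rewrite -(mulrA pi^-1 C) -(mulrA pi^-1 (C * _)).
by apply: ler_wpM2l => //; exact: hC.
Qed.

Lemma tame_shift K : tame K -> tame (fun s => K (s + 1)).
Proof.
move=> [cK [C C0 hC]]; split; first by move=> s s1; apply: cK; lra.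
exists (16 * C); first by rewrite mulr_ge0.
move=> s x s1; have s1' : 1 <= s + 1 by lra.
apply: le_trans (hC _ x s1') _; rewrite ler_wpM2r ?weight_ge0//.
rewrite mulrAC -[leRHS]mulrC ler_wpM2l//.
rewrite (_ : 16 = 2 ^+ 4); last by ring.
by rewrite -exprMn lerXn2r ?nnegrE; lra.
Qed.

Lemma tame_density_scaled : tame (fun s x => - (alpha * s) * p s x).
Proof.
have [C C0 hC] := density_kernel_bound alpha12 cos_gt0.
have a0 : 0 <= alpha by case/andP: alpha12; lra.
split.
  by move=> s s1 x; apply: cvgMr; exact: continuous_stable_density.
exists (alpha * (pi^-1 * C)); first by rewrite !mulr_ge0.
move=> s x s1; rewrite mulNr normrN !normrM (ger0_norm a0) (ger0_norm pi_inv0).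
rewrite (@ger0_norm _ s); last lra.
have -> : alpha * (pi^-1 * C) * (1 + s) ^+ 4 * weight alpha x =
  alpha * (1 + s) * (pi^-1 * (C * (1 + s) ^+ 3 * weight alpha x)) by ring.
apply: ler_pM; rewrite ?mulr_ge0//; first lra.
  by rewrite ler_wpM2l//; lra.
by rewrite ler_wpM2l// hC.
Qed.

Lemma fourier_stable_density s xi : 1 <= s -> xi != 0 ->
  fourier (p s) xi = cexp (- (real_complex R s * psi alpha theta xi)).
Proof.
move=> s1 xi0; have s0 : 0 < s by lra.
have ip := tame_integrable tame_density s1.
have ik : L1 setT (kernel alpha omega 0 s 0).
  have := @RintegrableZ _ _ _ mu _ _ pi measurableT ip.
  by apply: eq_integrable => // x _; rewrite /= ?mulrNN mulVKf// gt_eqF// pi_gt0.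
apply: etrans (fourier_kernel alpha12 cos_gt0 _ s0 xi0 ik) _ => //.
by rewrite powRr0 mulr0 oppr0 /expi cos0 sin0 realM mulr1 mulr0 mul1r.
Qed.

Lemma generator_symbol_image s : 1 <= s ->
  symbol_image (riesz_feller_symbol alpha theta) (p s) (Dp s).
Proof.
move=> s1; have s0 : 0 < s by lra.
have iD := tame_integrable tame_generator s1.
split => //; [exact: tame_integrable tame_density s1|exact: tame_generator.1|].
move=> xi xi0; rewrite fourier_stable_density//.
have ik : L1 setT (kernel alpha omega alpha s (- omega)).
  have := @RintegrableZ _ _ _ mu _ _ (- pi) measurableT iD.
  by apply: eq_integrable => // x _; rewrite /= mulrNN mulVKf// gt_eqF// pi_gt0.
have -> : Dp s = fun x => (-1) * (pi^-1 * kernel alpha omega alpha s (- omega) x).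
  by apply/funext => x; rewrite mulN1r.
rewrite fourierZ; last exact: (@RintegrableZ _ _ _ mu _ _ pi^-1 measurableT ik).
rewrite fourier_kernel// /riesz_feller_symbol /psi mulrN opprK.
rewrite mulrA; congr (_ * _).
rewrite [_ * theta * pi / 2]mulrAC.
have -> : real_complex R (-1) = -1 by congr Complex; rewrite oppr0.
by rewrite mulN1r; congr (- (_ * expi _)); ring.
Qed.

Lemma shift_symbol_image s : 1 <= s ->
  symbol_image (frac_shift_symbol alpha theta 1) (p s) (p (s + 1)).
Proof.
move=> s1; have s1' : 1 <= s + 1 by lra.
split; [exact: tame_integrable tame_density s1|exact: tame_integrable tame_density s1'
       |exact: tame_density.1|].
move=> xi xi0; rewrite !fourier_stable_density// /frac_shift_symbol -cexpD.
by congr cexp; rewrite -opprD -mulrDl -rmorphD addrC.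
Qed.

Lemma symbol_imageZ m f g (c : R) :
  symbol_image m f g -> symbol_image m (fun x => c * f x) (fun x => c * g x).
Proof.
move=> [if_ ig cg H]; split.
- exact: (@RintegrableZ _ _ _ mu _ _ c measurableT if_).
- exact: (@RintegrableZ _ _ _ mu _ _ c measurableT ig).
- by move=> x; apply: cvgMr; exact: cg.
- by move=> xi xi0; rewrite !fourierZ// H// mulrCA.
Qed.

(** On the frequency side multiplication by x is - i d/dxi, and
    - i psi'(xi) is alpha divided by the Feller symbol exactly when
    theta = 2 - alpha. *)
Lemma feller_symbol_image s : theta = 2 - alpha -> 1 <= s ->
  symbol_image (feller_symbol (1 - alpha) (alpha - 1))
    (fun x => x * p s x) (fun x => - (alpha * s) * p s x).
Proof.
move=> thE s1; have s0 : 0 < s by lra.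
have a0 : 0 < alpha by case/andP: alpha12; lra.
have ix := tame_integrable tame_xdensity s1.
have ip := tame_integrable tame_density s1.
split => //; [exact: tame_integrable tame_density_scaled s1
             |exact: tame_density_scaled.1|].
move=> xi xi0; rewrite fourierZ// fourier_stable_density//.
have sa0 : s * alpha != 0 by rewrite mulf_neq0// gt_eqF.
have pn0 : pi != 0 :> R by rewrite gt_eqF// pi_gt0.
have xE x : x * p s x = s * alpha * (pi^-1 * kernel alpha omega (alpha - 1) s (- omega - pi / 2) x).
  by rewrite mulrCA density_kernel_recurrence// mulrCA.
have ik : L1 setT (kernel alpha omega (alpha - 1) s (- omega - pi / 2)).
  have := @RintegrableZ _ _ _ mu _ _ (pi / (s * alpha)) measurableT ix.
  apply: eq_integrable => // x _; rewrite /= xE; congr EFin.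
  by move: (@pi R) pn0 => q q0; field; rewrite q0 !gt_eqF.
under [X in fourier X xi]eq_fun do rewrite xE.
rewrite fourierZ; last exact: (@RintegrableZ _ _ _ mu _ _ pi^-1 measurableT ik).
rewrite fourier_kernel//; last by case/andP: alpha12; lra.
rewrite /feller_symbol.
set e := cexp _; set A := `|xi| `^ (alpha - 1).
have A0 : 0 < A by rewrite powR_gt0// normr_gt0.
have -> : `|xi| `^ (- (alpha - 1)) = A^-1 by rewrite powRN.
have -> : real_complex R A^-1 * expi (- (pi * (1 - alpha) * Num.sg xi / 2)) *
  (real_complex R (s * alpha) * (real_complex R A * expi (- (Num.sg xi * (- omega - pi / 2))) * e))
  = (real_complex R A^-1 * real_complex R (s * alpha) * real_complex R A) *
    (expi (- (pi * (1 - alpha) * Num.sg xi / 2)) *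
     expi (- (Num.sg xi * (- omega - pi / 2)))) * e by ring.
rewrite !real_realM -expiD.
have -> : A^-1 * (s * alpha) * A = s * alpha by rewrite mulrAC mulVf ?gt_eqF// mul1r.
have -> : - (pi * (1 - alpha) * Num.sg xi / 2) + - (Num.sg xi * (- omega - pi / 2))
   = Num.sg xi * pi by rewrite thE; field.
have -> : expi (Num.sg xi * pi) = -1.
  move: xi0; rewrite neq_lt => /orP[xn|xp].
  - by rewrite ltr0_sg// mulN1r expi_Npi.
  - by rewrite gtr0_sg// mul1r expi_pi.
rewrite mulrN1; congr (_ * _).
by rewrite mulrC; congr Complex; rewrite oppr0.
Qed.

End stable_density.

(** * Mixtures of kernels *)

Section mixtures.
Context {R : realType}.
Local Notation mu := (@lebesgue_measure R).
Local Notation L1 A f := (mu.-integrable A (EFin \o f)).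

Lemma limn_seriesZ (k : R) (a : nat -> R) : cvgn (series a) ->
  limn (series (fun n => k * a n)) = k * limn (series a).
Proof. exact: lim_seriesZ. Qed.

Lemma cvgn_seriesZ (k : R) (a : nat -> R) : cvgn (series a) ->
  cvgn (series (fun n => k * a n)).
Proof. exact: is_cvg_seriesZ. Qed.

(** Weierstrass: domination makes the series integrals over the counting
    measure, to which continuity under the integral applies. *)
Lemma continuous_series (f : nat -> R -> R) M : (forall k, continuous (f k)) ->
  (forall k y, `|f k y| <= M k) -> cvgn (series M) ->
  continuous (fun y => limn (series (f ^~ y))).
Proof.
move=> cf fM cM x.
have E y : limn (series (f ^~ y)) = \int[@counting nat R]_k f k y.
  by rewrite series_Rintegral//; apply: (@le_cvg_series _ _ M).
have -> : (fun y => limn (series (f ^~ y))) = (fun y => \int[@counting nat R]_k f k y).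
  by apply/funext => y; exact: E.
have M0 k : 0 <= M k by rewrite (le_trans _ (fM k 0)).
apply: (@continuity_under_integral R _ _ (@counting nat R) (fun y k => f k y) setT
   measurableT (x - 1) (x + 1) _ _ M).
- by move=> y _; apply: series_integrable; exact: (@le_cvg_series _ _ M).
- by apply: aeW => k _ y _; exact: cf.
- by apply: series_integrable; under eq_fun do rewrite ger0_norm//.
- by move=> y _; apply: aeW => k _; exact: fM.
- by rewrite inE/= in_itv/=; apply/andP; split; lra.
Qed.

Variables alpha : R.
Hypothesis alpha12 : 1 < alpha <= 2.
Let alpha_gt1 : 1 < alpha. Proof. by case/andP: alpha12. Qed.
Local Notation w := (weight alpha).
Local Notation tame := (tame alpha).

Lemma weight_le1 x : w x <= 1.
Proof.
by rewrite /weight -[leRHS](powRr0 (1 + `|x|)) ler_powR ?lerDl// oppr_le0 ltW// (lt_trans _ alpha_gt1).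
Qed.

Variables c s : nat -> R.
Hypothesis s_ge1 : forall k, 1 <= s k.
Hypothesis c_cvg : cvgn (series (fun k => `|c k| * (1 + s k) ^+ 4)).

Definition mixture (K : R -> R -> R) x := limn (series (fun k => c k * K (s k) x)).

Let cs k := `|c k| * (1 + s k) ^+ 4.

Let cs_ge0 k : 0 <= cs k.
Proof. by rewrite mulr_ge0// exprn_ge0//; have := s_ge1 k; lra. Qed.

Let csZ C : cvgn (series (fun k => C * cs k)).
Proof. exact: cvgn_seriesZ. Qed.

Lemma tame_term K : tame K -> exists2 C, 0 <= C &
  forall k x, `|c k * K (s k) x| <= C * cs k * w x.
Proof.
move=> [_ [C C0 hC]]; exists C => // k x; rewrite normrM.
have -> : C * cs k * w x = `|c k| * (C * (1 + s k) ^+ 4 * w x) by rewrite /cs; ring.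
by rewrite ler_wpM2l// hC.
Qed.

Lemma tame_series_cvg K x : tame K -> cvgn (series (fun k => `|c k * K (s k) x|)).
Proof.
move=> /tame_term[C C0 hC]; apply: (@le_cvg_series _ _ (fun k => C * cs k)) => // k.
by rewrite (le_trans (hC _ _))// ler_piMr ?weight_le1// mulr_ge0.
Qed.

Lemma continuous_mixture K : tame K -> continuous (mixture K).
Proof.
move=> tK; have [C C0 hC] := tame_term tK.
apply: (@continuous_series _ (fun k => C * cs k)) => //.
- by move=> k x; apply: cvgMr; exact: tK.1.
- by move=> k x; rewrite (le_trans (hC _ _))// ler_piMr ?weight_le1// mulr_ge0.
Qed.

Lemma mixture_integral K (g : R -> R) b : tame K -> measurable_fun setT g ->
  (forall x, `|g x| <= b) ->
  L1 setT (fun x => g x * mixture K x) /\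
  series (fun k => c k * \int[mu]_x (g x * K (s k) x)) @ \oo -->
    \int[mu]_x (g x * mixture K x).
Proof.
move=> tK mg gb; have [C C0 hC] := tame_term tK.
have b0 : 0 <= b by rewrite (le_trans _ (gb 0)).
have iw : L1 setT w by exact: weight_integrable.
have mK k : measurable_fun setT (K (s k)).
  by apply: continuous_measurable_fun; exact: tK.1.
have iK k : L1 setT (fun x => g x * K (s k) x).
  have i := tame_integrable alpha12 tK (s_ge1 k).
  apply: (@le_Rintegrable _ _ _ mu _ _ (fun x => b * `|K (s k) x|)) => //.
  - by apply: measurable_funM; [exact: mg|exact: mK].
  - by move=> x _; rewrite normrM ler_wpM2r.
  - apply: (@RintegrableZ _ _ _ mu _ _ b measurableT) => //.
    exact: (@integrable_norm _ _ _ mu).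
have E x : g x * mixture K x = limn (series (fun k => g x * (c k * K (s k) x))).
  rewrite /mixture limn_seriesZ//; apply: normed_cvg; exact: tame_series_cvg.
have [|||||i cv] := @Rintegral_series _ _ _ mu setT
   (fun k x => g x * (c k * K (s k) x)) (fun k => b * C * cs k) w measurableT.
- move=> k; apply: measurable_funM; first exact: mg.
  by apply: measurable_funM; [exact: measurable_cst|exact: mK].
- move=> k x _; rewrite normrM.
  have -> : b * C * cs k * w x = b * (C * cs k * w x) by ring.
  exact: ler_pM.
- exact: csZ.
- by move=> k; apply: mulr_ge0; [exact: mulr_ge0|exact: cs_ge0].
- exact: iw.
have F : (fun x => g x * mixture K x) =
    (fun x => limn (series (fun k => g x * (c k * K (s k) x)))) by apply/funext.
rewrite F; split => //.
rewrite (_ : (fun k => _) = (fun k => \int[mu]_x (g x * (c k * K (s k) x))))//.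
apply/funext => k; rewrite -RintegralZl//.
by apply: eq_Rintegral => x _; rewrite mulrCA.
Qed.

Lemma mixture_integrable K : tame K -> L1 setT (mixture K).
Proof.
move=> tK; have [] := @mixture_integral K (fun=> 1) 1 tK => //.
  by move=> x; rewrite normr1.
by under eq_fun do rewrite mul1r.
Qed.

(** The transform of a mixture is the mixture of the transforms, by dominated
    convergence, and a multiplier commutes with it. *)
Lemma symbol_image_mixture m K1 K2 : tame K1 -> tame K2 ->
  (forall r, 1 <= r -> symbol_image m (K1 r) (K2 r)) ->
  symbol_image m (mixture K1) (mixture K2).
Proof.
move=> t1 t2 im; split; [exact: mixture_integrable..|exact: continuous_mixture|].
move=> xi xi0; case E : (m xi) => [mr mi].
have mcos : measurable_fun [set: R] (fun x => cos (x * xi)) by exact: cos_mul_measurable.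
have msin : measurable_fun [set: R] (fun x => sin (x * xi)) by exact: sin_mul_measurable.
have bcos x : `|cos (x * xi)| <= 1 by exact: cos_max.
have bsin x : `|sin (x * xi)| <= 1 by exact: sin_max.
have [_ c1] := mixture_integral t1 mcos bcos.
have [_ s1] := mixture_integral t1 msin bsin.
have [_ c2] := mixture_integral t2 mcos bcos.
have [_ s2] := mixture_integral t2 msin bsin.
have H k : fourier (K2 (s k)) xi = Complex mr mi * fourier (K1 (s k)) xi.
  by have [_ _ _ ->//] := im _ (s_ge1 k); rewrite E.
have seriesD (a b : nat -> R) r t n :
    series (fun k => r * a k + t * b k) n = r * series a n + t * series b n.
  by rewrite /series/= big_split/= !mulr_sumr.
rewrite /fourier; congr Complex.
- rewrite -(cvg_lim _ c2)//; apply: cvg_lim => //.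
  rewrite (_ : series _ = (fun n => mr * series (fun k => c k * \int[mu]_x (cos (x * xi) * K1 (s k) x)) n
      + (- mi) * series (fun k => c k * \int[mu]_x (sin (x * xi) * K1 (s k) x)) n)).
    rewrite -(mulNr mi); apply: cvgD; apply: cvgMr; [exact: c1|exact: s1].
  apply/funext => n; rewrite -seriesD; congr (series _ n).
  by apply/funext => k; have [-> _] := H k; rewrite mulNr (mulrCA mr) (mulrCA mi) -mulrBr.
- rewrite -(cvg_lim _ s2)//; apply: cvg_lim => //.
  rewrite (_ : series _ = (fun n => mr * series (fun k => c k * \int[mu]_x (sin (x * xi) * K1 (s k) x)) n
      + mi * series (fun k => c k * \int[mu]_x (cos (x * xi) * K1 (s k) x)) n)).
    apply: cvgD; apply: cvgMr; [exact: s1|exact: c1].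
  apply/funext => n; rewrite -seriesD; congr (series _ n).
  by apply/funext => k; have [_ ->] := H k; rewrite (mulrCA mr) (mulrCA mi) -mulrDr.
Qed.

Lemma hartley_mixture_le K B (E : R -> R) xi : tame K -> 0 <= E xi ->
  (forall r, 1 <= r -> `|hartley (K r) xi| <= B * (1 + r) ^+ 4 * E xi) ->
  `|hartley (mixture K) xi| <= B * limn (series cs) * E xi.
Proof.
move=> tK E0 hB.
have mcas : measurable_fun [set: R] (fun x => cas (x * xi)).
  apply: continuous_measurable_fun => x.
  apply: (@continuous_comp _ _ _ (fun x : R => x * xi) cas); last exact: continuous_cas.
  by apply: cvgMl; exact: cvg_id.
have [_ cv] := mixture_integral tK mcas (fun x => norm_cas (x * xi)).
rewrite /hartley -(cvg_lim _ cv)//.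
rewrite (_ : B * _ * _ = (B * E xi) * limn (series cs)); last by ring.
rewrite -limn_seriesZ; last exact: c_cvg.
apply: normr_lim_series_le; last exact: csZ.
move=> k; rewrite normrM.
have -> : (B * E xi) * cs k = `|c k| * (B * (1 + s k) ^+ 4 * E xi) by rewrite /cs; ring.
by rewrite ler_wpM2l//; exact: hB.
Qed.

End mixtures.

(** * Weights of the birth process *)

Section yule_weights.
Context {R : realType}.
Variables a lambda : R.
Hypothesis a_ge0 : 0 <= a.
Hypothesis lambda_gt0 : 0 < lambda.
Implicit Types (t y : R) (k : nat).

(** The probability that B(t) = k + 1, and the corresponding operational time. *)
Definition progeny t k : R := expR (- (lambda * t)) * (1 - expR (- (lambda * t))) ^+ k.
Definition epoch t k : R := k.+1%:R + a * t.

Lemma epoch_ge1 t k : 0 <= t -> 1 <= epoch t k.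
Proof. by move=> t0; rewrite /epoch -natr1 -addrA addrCA lerDl addr_ge0// mulr_ge0. Qed.

Let q_bound t : 0 <= t -> 0 <= 1 - expR (- (lambda * t)) < 1.
Proof.
move=> t0; have := expR_gt0 (- (lambda * t)).
have : expR (- (lambda * t)) <= 1 by rewrite -expR0 ler_expR oppr_le0 mulr_ge0// ltW.
by move=> h1 h0; apply/andP; split; lra.
Qed.

Lemma progeny_ge0 t k : 0 <= t -> 0 <= progeny t k.
Proof.
by move=> /q_bound/andP[q0 _]; rewrite mulr_ge0 ?expR_ge0// exprn_ge0.
Qed.

Lemma progeny_cvg t : 0 <= t ->
  cvgn (series (fun k => `|progeny t k| * (1 + epoch t k) ^+ 4)).
Proof.
move=> t0; have qb := q_bound t0.
have C0 : 0 <= 2 + a * t by rewrite addr_ge0// mulr_ge0.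
rewrite (_ : (fun k => _) = (fun k => expR (- (lambda * t)) *
    ((k%:R + (2 + a * t)) ^+ 4 * (1 - expR (- (lambda * t))) ^+ k))).
  by apply: cvgn_seriesZ; exact: poly_geometric_cvg.
apply/funext => k; rewrite ger0_norm ?progeny_ge0// /progeny /epoch -natr1.
have -> : 1 + (k%:R + 1 + a * t) = k%:R + (2 + a * t) by ring.
ring.
Qed.

(** The Kolmogorov forward equation of the birth process, which leaves the
    state j at rate lambda j. *)
Lemma is_derive_progeny t k : is_derive t 1 (progeny ^~ k)
  (lambda * (k%:R * progeny t k.-1 - k.+1%:R * progeny t k)).
Proof.
have dexp : is_derive t 1 (fun t => expR (- (lambda * t))) (- lambda * expR (- (lambda * t))).
  have darg : is_derive t 1 (fun t => - (lambda * t)) (- lambda).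
    by apply: is_derive_eq; rewrite /GRing.scale/=; ring.
  by have := is_derive1_comp (@is_derive_expR R _) darg; rewrite mulrC.
have dq : is_derive t 1 (fun t => 1 - expR (- (lambda * t))) (lambda * expR (- (lambda * t))).
  by apply: is_derive_eq; rewrite mulNr; ring.
have dpow := is_derive1_comp (is_derive_exprn k _) dq.
apply: is_derive_eq; rewrite /GRing.scale/= /progeny.
by case: k {dpow} => [|k]/=; rewrite ?expr0 ?exprS -?natr1; ring.
Qed.

(** Near t >= 0 the weights are dominated by a geometric sequence; to the left
    of t = 0 they are no longer probabilities, but still summable. *)
Lemma progeny_near t : 0 <= t -> exists2 e : R, 0 < e & exists2 r : R, 2^-1 <= r < 1 &
  forall y, t - e < y < t + e -> (forall k, `|progeny y k| <= 2 * r ^+ k) /\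
    forall k, 2^-1 <= epoch y k.
Proof.
move=> t0; have /andP[q0 q1] := q_bound t0.
pose q y := 1 - expR (- (lambda * y)).
(* halfway between q(t), which is at least 0, and 1 *)
pose r := (1 + q t) / 2.
have rb : 2^-1 <= r < 1 by rewrite /r; apply/andP; split; rewrite /q; lra.
have cq : {for t, continuous q}.
  apply: cvgB; first exact: cvg_cst.
  apply: (@continuous_comp _ _ _ (fun y : R => - (lambda * y)) (@expR R)); last exact: continuous_expR.
  by apply: cvgN; apply: cvgMr; exact: cvg_id.
have : \forall y \near t, `|q t - q y| < (1 - q t) / 2.
  by move/cvgrPdist_lt: cq; apply; rewrite /q; lra.
move=> /nbhs_ballP[e1/= e10 he1].
pose e2 := (2 * (a + 1))^-1.
have e20 : 0 < e2 by rewrite invr_gt0; have := a_ge0; lra.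
exists (Num.min e1 e2); first by rewrite lt_min e10.
exists r => // y /andP[hy1 hy2].
have hm1 : Num.min e1 e2 <= e1 by rewrite ge_min lexx.
have hm2 : Num.min e1 e2 <= e2 by rewrite ge_min lexx orbT.
have : `|q t - q y| < (1 - q t) / 2.
  by apply: he1; rewrite /ball/= ltr_norml; apply/andP; split; lra.
rewrite ltr_norml => /andP[h1 h2].
have qr : `|q y| <= r by rewrite ler_norml /r; apply/andP; split; rewrite /q in q0 q1 h1 h2 *; lra.
split=> k.
  rewrite normrM normrX; apply: ler_pM => //.
    rewrite ger0_norm ?expR_ge0//; move: qr; rewrite ler_norml /q; case/andP: rb; lra.
  by rewrite lerXn2r// ?nnegrE//; case/andP: rb; lra.
have ay : - 2^-1 <= a * y.
  have : a * (- e2) <= a * y by rewrite ler_wpM2l//; lra.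
  suff : a * e2 <= 2^-1 by rewrite mulrN; lra.
  by rewrite /e2 ler_pdivrMr; have := a_ge0; lra.
by rewrite /epoch -[k.+1%:R]natr1; have := ler0n R k; lra.
Qed.

Section term_by_term.
Variables (p dp : R -> R) (M : R).
Hypothesis p_derive : forall s : R, 0 < s -> is_derive s 1 p (dp s).
Hypothesis p_le : forall s : R, 2^-1 <= s -> `|p s| <= M.
Hypothesis dp_le : forall s : R, 2^-1 <= s -> `|dp s| <= M.

Lemma is_derive_yule_series t : 0 <= t -> is_derive t 1
  (fun y => limn (series (fun k => progeny y k * p (epoch y k))))
  (limn (series (fun k =>
    lambda * (k%:R * progeny t k.-1 - k.+1%:R * progeny t k) * p (epoch t k)
    + a * (progeny t k * dp (epoch t k))))).
Proof.
move=> t0; have [e e0 [r /andP[r2 r1] near_t]] := progeny_near t0.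
have r0 : 0 <= r by lra.
have M0 : 0 <= M by rewrite (le_trans _ (p_le (lexx _))).
have geo : cvgn (series (fun k => (k%:R + 1) ^+ 1 * r ^+ k)).
  by apply: poly_geometric_cvg => //; rewrite r0.
have geoZ C : cvgn (series (fun k => C * ((k%:R + 1) ^+ 1 * r ^+ k))).
  exact: cvgn_seriesZ.
apply: (@is_derive_series R (fun k y => progeny y k * p (epoch y k))
  (fun k y => lambda * (k%:R * progeny y k.-1 - k.+1%:R * progeny y k) * p (epoch y k)
    + a * (progeny y k * dp (epoch y k)))
  (fun k => (6 * lambda + 2 * a) * M * ((k%:R + 1) ^+ 1 * r ^+ k)) (t - e) (t + e)).
- by apply/andP; split; lra.
- move=> k y /near_t[_ ep]; have ek0 : 0 < epoch y k by have := ep k; lra.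
  have dw := is_derive_progeny y k.
  have de : is_derive y 1 (epoch ^~ k) a.
    rewrite /epoch; apply: is_derive_eq; rewrite /GRing.scale/=; ring.
  have dp' := is_derive1_comp (f := p) (g := epoch ^~ k) (p_derive ek0) de.
  by apply: is_derive_eq; rewrite /GRing.scale/=; ring.
- move=> y /near_t[wy ep].
  apply: (@le_cvg_series _ _ (fun k => 2 * M * ((k%:R + 1) ^+ 1 * r ^+ k))) => // k.
  rewrite normrM.
  apply: (@le_trans _ _ (2 * r ^+ k * M)); first by apply: ler_pM => //; exact: p_le.
  rewrite mulrAC ler_wpM2l ?mulr_ge0// expr1 ler_peMl ?exprn_ge0// lerDr//.
- move=> k y /near_t[wy ep].
  have rk : 0 <= r ^+ k by rewrite exprn_ge0.
  have h1 : `|k%:R * progeny y k.-1| <= 4 * k%:R * r ^+ k.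
    case: k {rk} => [|k]/=; first by rewrite !mul0r normr0 mulr0 mul0r.
    rewrite normrM (ger0_norm (ler0n _ _)) mulrAC mulrC ler_wpM2r//.
    apply: le_trans (wy k) _; rewrite exprS.
    have : 0 <= r ^+ k by rewrite exprn_ge0.
    move: (r ^+ k) => z z0; have : 2^-1 * z <= r * z by rewrite ler_wpM2r.
    lra.
  have h2 : `|k.+1%:R * progeny y k| <= k.+1%:R * (2 * r ^+ k).
    by rewrite normrM ger0_norm// ler_wpM2l.
  have h3 : `|k%:R * progeny y k.-1 - k.+1%:R * progeny y k|
      <= 6 * ((k%:R + 1) * r ^+ k).
    apply: le_trans (ler_normB _ _) _.
    apply: le_trans (lerD h1 h2) _; rewrite -[k.+1%:R]natr1; lra.
  apply: le_trans (ler_normD _ _) _.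
  rewrite expr1 [leRHS](_ : _ = lambda * (6 * ((k%:R + 1) * r ^+ k)) * M
    + a * (2 * ((k%:R + 1) * r ^+ k) * M)); last by ring.
  apply: lerD.
    rewrite normrM normrM (gtr0_norm lambda_gt0).
    apply: ler_pM; rewrite ?mulr_ge0 ?(ltW lambda_gt0)//; last exact: p_le.
    by rewrite ler_wpM2l// ltW.
  rewrite normrM (ger0_norm a_ge0) ler_wpM2l// normrM.
  apply: ler_pM => //; last exact: dp_le.
  apply: le_trans (wy k) _; rewrite ler_wpM2l// ler_peMl// lerDr//.
- exact: geoZ.
Qed.

End term_by_term.
End yule_weights.

(** * The evolution of the mixtures *)

Section yule_mixtures.
Context {R : realType}.
Local Notation mu := (@lebesgue_measure R).
Local Notation L1 A f := (mu.-integrable A (EFin \o f)).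
Variables alpha theta : R.
Local Notation omega := (theta * pi / 2).
Hypothesis alpha12 : 1 < alpha <= 2.
Hypothesis cos_gt0 : 0 < cos omega.
Local Notation p := (stable_density alpha theta).
Local Notation Dp := (stable_generator alpha theta).
Local Notation tame := (tame alpha).
Implicit Types s x xi t : R.

Let alpha_gt0 : 0 < alpha. Proof. by case/andP: alpha12; lra. Qed.

(** What the Feller integral of order alpha - 1, or for alpha = 2 integration
    from - oo, makes of x p_s(x). *)
Definition moment_kernel s x := - (alpha * s) * p s x.

Definition shifted_moment_kernel s x := - (alpha * s) * p (s + 1) x.

Local Notation jp := moment_kernel.
Local Notation ojp := shifted_moment_kernel.

(** Writing s as (s + 1) - 1 gives access to the bounds at time s + 1. *)
Lemma tame_shifted_moment : tame ojp.
Proof.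
have [cj [C1 C10 h1]] := tame_shift (tame_density_scaled alpha12 cos_gt0).
have [cd [C2 C20 h2]] := tame_shift (tame_density alpha12 cos_gt0).
have E s x : ojp s x = - (alpha * (s + 1)) * p (s + 1) x + alpha * p (s + 1) x.
  by rewrite /ojp; ring.
split.
  move=> s s1 x; rewrite (_ : ojp s =
      fun x => - (alpha * (s + 1)) * p (s + 1) x + alpha * p (s + 1) x).
    by apply: cvgD; [exact: cj|apply: cvgMr; exact: cd].
  by apply/funext => z; exact: E.
exists (C1 + alpha * C2); first by rewrite addr_ge0// mulr_ge0// ltW.
move=> s x s1; rewrite E; apply: le_trans (ler_normD _ _) _.
have -> : (C1 + alpha * C2) * (1 + s) ^+ 4 * weight alpha x =
  C1 * (1 + s) ^+ 4 * weight alpha x + alpha * (C2 * (1 + s) ^+ 4 * weight alpha x) by ring.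
apply: lerD; first exact: h1.
by rewrite normrM (gtr0_norm alpha_gt0) ler_wpM2l ?(ltW alpha_gt0)// h2.
Qed.

Lemma is_derive_stable_density s x : 0 < s ->
  is_derive s 1 (fun s => p s x) (Dp s x).
Proof.
move=> s0; have dk := is_derive_kernel_s alpha12 cos_gt0 (m := 0) 0 x _ s0.
have {}dk := dk (ltrN10 _); rewrite add0r sub0r in dk.
by apply: is_derive_eq; rewrite /GRing.scale/= /stable_generator mulrN.
Qed.

Lemma stable_density_bound x : exists M, (forall s, 2^-1 <= s -> `|p s x| <= M) /\
  forall s, 2^-1 <= s -> `|Dp s x| <= M.
Proof.
have h0 : 0 < 2^-1 :> R by rewrite invr_gt0.
have a1 : -1 < alpha by have := alpha_gt0; lra.
have [M0 M00 hp] := normalized_kernel_bound alpha12 cos_gt0 0 (ltrN10 R) h0.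
have [M1 M10 hD] := normalized_kernel_bound alpha12 cos_gt0 (- omega) a1 h0.
exists (M0 + M1); split => s hs.
  by apply: le_trans (hp s x hs) _; rewrite lerDl.
by rewrite normrN; apply: le_trans (hD s x hs) _; rewrite lerDr.
Qed.

Lemma hartley_stable_density_le s xi : 1 <= s -> xi != 0 ->
  `|hartley (p s) xi| <= 2 * expR (- (cos omega * `|xi| `^ alpha)).
Proof.
move=> s1 xi0; rewrite hartleyE; last exact: (tame_integrable alpha12 (tame_density alpha12 cos_gt0)).
rewrite fourier_stable_density// cexp_psi//=.
apply: le_trans (ler_normD _ _) _.
set e := expR (- (s * _ * _)).
have he : e <= expR (- (cos omega * `|xi| `^ alpha)).
  rewrite ler_expR lerN2 -[leRHS]mulrA ler_peMl// mulr_ge0 ?powR_ge0//.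
  by rewrite ltW.
have e0 : `|e| = e by rewrite ger0_norm// expR_ge0.
rewrite normrN !normrM e0 normr_sg xi0 mul1r [leRHS]mulr_natl [leRHS]mulr2n.
by apply: lerD; apply: le_trans he; rewrite ler_piMr ?expR_ge0// ?cos_max ?sin_max.
Qed.

Variables a lambda : R.
Hypothesis a_ge0 : 0 <= a.
Hypothesis lambda_gt0 : 0 < lambda.

Definition yule_mixture t (K : R -> R -> R) : R -> R :=
  mixture (progeny lambda t) (epoch a t) K.
Local Notation mix := yule_mixture.

Lemma frac_shift_yule_mixture K1 K2 B t : 0 <= t -> tame K1 -> tame K2 ->
  (alpha < 2 \/ cos omega = 1) ->
  (forall s, 1 <= s -> symbol_image (frac_shift_symbol alpha theta 1) (K1 s) (K2 s)) ->
  (forall s xi, 1 <= s -> xi != 0 ->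
    `|hartley (K1 s) xi| <= B * (1 + s) ^+ 4 * expR (- (cos omega * `|xi| `^ alpha))) ->
  symbol_image (frac_shift_symbol alpha theta 1) (mix t K1) (mix t K2) /\
  frac_shift alpha theta 1 (mix t K1) = mix t K2.
Proof.
move=> t0 t1 t2 al2 im hB.
have s1 k : 1 <= epoch a t k by exact: epoch_ge1.
have cw := progeny_cvg a_ge0 lambda_gt0 t0.
have I := symbol_image_mixture alpha12 s1 cw t1 t2 im.
split => //.
apply: (frac_shiftE
  (K := B * limn (series (fun k => `|progeny lambda t k| * (1 + epoch a t k) ^+ 4)))) => //.
- by case/andP: alpha12 => h1 h2; apply/andP; split; lra.
- exact: (continuous_mixture alpha12 s1 cw).
- move=> xi xi0; apply: (hartley_mixture_le alpha12 s1 cw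
    (E := fun xi => expR (- (cos omega * `|xi| `^ alpha)))) => //.
  by move=> r r1; exact: hB.
Qed.

(** The forward equation of the time change: after differentiation in t the
    increments of the weights telescope against the shift s_k + 1 = s_(k+1). *)
Lemma is_derive_yule_mixture t x : 0 <= t ->
  is_derive t 1 (fun y => mix y p x)
    (a * (mix t Dp x + lambda * t * (mix t p x - mix t (fun s => p (s + 1)) x))
     + lambda / alpha * (mix t jp x - mix t ojp x)).
Proof.
move=> t0; have [M [M0 M1]] := stable_density_bound x.
have := is_derive_yule_series a_ge0 lambda_gt0
  (fun s hs => @is_derive_stable_density s x hs) M0 M1 t0.
move=> [hd hv]; apply: DeriveDef; [exact: hd|rewrite [LHS]hv {hd hv}].
have s1 k : 1 <= epoch a t k by exact: epoch_ge1.
have cw := progeny_cvg a_ge0 lambda_gt0 t0.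
have cv K : tame K -> series (fun k => progeny lambda t k * K (epoch a t k) x) @ \oo --> mix t K x.
  by move=> tK; apply: normed_cvg; exact: (tame_series_cvg alpha12 s1 cw).
have cp := cv _ (tame_density alpha12 cos_gt0).
have cop := cv _ (tame_shift (tame_density alpha12 cos_gt0)).
have cD := cv _ (tame_generator alpha12 cos_gt0).
have cj := cv _ (tame_density_scaled alpha12 cos_gt0).
have coj := cv _ tame_shifted_moment.
(* the mass gained by the k-th term; g k.+1 is the mass lost by the k-th one,
   moved to time s_k + 1 *)
pose g k := k%:R * progeny lambda t k.-1 * p (epoch a t k) x.
have g0 : g @ \oo --> 0.
  rewrite -cvg_shiftS.
  have z1 := cvg_series_cvg_0 (cvgP _ coj).
  have z2 := cvg_series_cvg_0 (cvgP _ cop).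
  rewrite (_ : [sequence g n.+1]_n = (fun n => - alpha^-1 * (progeny lambda t n * ojp (epoch a t n) x)
     + (- (a * t)) * (progeny lambda t n * p (epoch a t n + 1) x))); last first.
    apply/funext => n; rewrite /g /= /ojp /epoch -[n.+2%:R]natr1.
    have -> : n.+1%:R + 1 + a * t = n.+1%:R + a * t + 1 by ring.
    by field; rewrite gt_eqF.
  have z : (fun n => - alpha^-1 * (progeny lambda t n * ojp (epoch a t n) x)
     + (- (a * t)) * (progeny lambda t n * p (epoch a t n + 1) x)) @ \oo -->
     - alpha^-1 * 0 + - (a * t) * 0.
    by apply: cvgD; apply: cvgMr; [exact: z1|exact: z2].
  by move: z; rewrite !mulr0 addr0.
apply: cvg_lim => //.
rewrite (_ : series _ = fun n =>
   a * (series (fun k => progeny lambda t k * Dp (epoch a t k) x) n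
     + lambda * t * (series (fun k => progeny lambda t k * p (epoch a t k) x) n
        - series (fun k => progeny lambda t k * p (epoch a t k + 1) x) n))
   + lambda / alpha * (series (fun k => progeny lambda t k * jp (epoch a t k) x) n
        - series (fun k => progeny lambda t k * ojp (epoch a t k) x) n)
   - lambda * g n).
  rewrite -[X in _ --> X](subr0) -[X in _ - X](mulr0 lambda).
  apply: cvgB; last by apply: cvgMr; exact: g0.
  apply: cvgD; apply: cvgMr; last by apply: cvgB; [exact: cj|exact: coj].
  apply: cvgD; first exact: cD.
  by apply: cvgMr; apply: cvgB; [exact: cp|exact: cop].
apply/funext; elim=> [|n ih].
  by rewrite /series/= !big_geq// /g !mul0r; ring.
have E (b : nat -> R) : series b n.+1 = series b n + b n by rewrite /series/= big_nat_recr.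
rewrite !E ih /g/= /jp /ojp /epoch.
have -> : n.+2%:R + a * t = n.+1%:R + a * t + 1 by rewrite -[n.+2%:R]natr1; ring.
by field; rewrite gt_eqF.
Qed.

End yule_mixtures.

(** * Random variables with a density *)

Section densities.
Context d (T : measurableType d) (R : realType) (P : probability T R).
Local Notation mu := (@lebesgue_measure R).
Local Notation L1 A f := (mu.-integrable A (EFin \o f)).

Lemma density_integrable (X : T -> R) f : is_density P X f -> L1 setT f.
Proof.
move=> [_ mf f0 h]; apply/integrableP; split; first exact/measurable_EFinP.
under eq_integral do rewrite /= ger0_norm//.
by rewrite -h//= preimage_setT probability_setT ltry.
Qed.

(** The density is the Radon-Nikodym derivative of the law. *)
Lemma density_integral (X : {RV P >-> R}) f (g : R -> R) : is_density P X f ->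
  measurable_fun setT g -> (forall x, `|g x| <= 1) ->
  \int[P]_w g (X w) = \int[mu]_x (g x * f x).
Proof.
move=> dX mg g1; have if_ := density_integrable dX; case: dX => _ mf f0 h.
(* the law lives on the measurable space that carries the Lebesgue measure *)
have mX : measurable_fun [set: T] (X : T -> measurableTypeR R) by exact: (@measurable_funPT _ _ _ _ X).
pose Y : {mfun T >-> measurableTypeR R} := @mfun_Sub _ _ T (measurableTypeR R) X (mem_set mX).
have YE w : Y w = X w by [].
have dom : distribution P Y `<< mu.
  apply/null_content_dominatesP => A mA muA0.
  rewrite /distribution /pushforward h//.
  apply: null_set_integral => //.
  exact: measurable_funTS (measurable_int _ if_).
have iPg : P.-integrable setT (EFin \o (g \o X)).
  apply: (@le_integrable _ _ _ P _ measurableT _ (EFin \o cst 1)).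
  - by apply/measurable_EFinP; exact: measurableT_comp.
  - by move=> x _ /=; rewrite lee_fin normr1.
  - exact: finite_measure_integrable_cst.
have ig : (distribution P Y).-integrable setT (EFin \o g).
  apply: (@le_integrable _ _ _ (distribution P Y) _ measurableT _ (EFin \o cst 1)).
  - exact/measurable_EFinP.
  - by move=> x _ /=; rewrite lee_fin normr1.
  - exact: finite_measure_integrable_cst.
rewrite /Rintegral; congr fine.
have := @integral_distribution _ _ _ _ _ P Y (EFin \o g).
rewrite /= => <-; last 2 first.
- exact/measurable_EFinP.
- exact: iPg.
rewrite -(Radon_Nikodym_change_of_variables dom)//.
apply: ae_eq_integral => //.
- apply: emeasurable_funM; first exact/measurable_EFinP.
  by apply: (measurable_int mu); exact: Radon_Nikodym_integrable.
- by apply/measurable_EFinP; exact: measurable_funM.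
under [X in ae_eq _ _ _ X]eq_fun do rewrite EFinM.
apply: ae_eqe_mul2l.
rewrite Radon_NikodymE//=; case: cid => /= r [r1 r2 r3].
apply: integral_ae_eq => //.
- exact: (measurable_int _ if_).
- by move=> E _ mE; rewrite -r3//= /distribution /pushforward h.
Qed.

End densities.

(** * The law of the time-changed process *)

Section yule_law.
Context d (T : measurableType d) (R : realType) (P : probability T R).
Local Notation mu := (@lebesgue_measure R).
Local Notation L1 A f := (mu.-integrable A (EFin \o f)).
Variables alpha theta : R.
Local Notation omega := (theta * pi / 2).
Hypothesis alpha12 : 1 < alpha <= 2.
Hypothesis cos_gt0 : 0 < cos omega.
Variables (S : R -> {RV P >-> R}) (p : R -> R -> R).
Hypothesis levyS : is_stable_levy alpha theta S.
Hypothesis densityS : is_transition_density S p.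

(** Two continuous integrable functions with the same transform agree. *)
Lemma transition_densityE s x : 1 <= s -> p x s = stable_density alpha theta s x.
Proof.
move=> s1; have s0 : 0 < s by lra.
have [dS cS] := densityS s0.
have ip := density_integrable dS.
have [is_ _ cs _] := shift_symbol_image alpha12 cos_gt0 s1.
have im1 : symbol_image (fun=> 1) (stable_density alpha theta s) (stable_density alpha theta s).
  split => //; first exact: (tame_density alpha12 cos_gt0).1.
  by move=> xi _; rewrite mul1r.
suff im2 : symbol_image (fun=> 1) (stable_density alpha theta s) (p ^~ s).
  by have := symbol_image_unique im2 im1; move/(congr1 (fun f => f x)).
split => // xi xi0; rewrite mul1r fourier_stable_density//.
have [_ _ _ _ charS] := levyS; rewrite -charS; last exact: ltW.
have mcos : measurable_fun [set: R] (fun x => cos (x * xi)) by exact: cos_mul_measurable.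
have msin : measurable_fun [set: R] (fun x => sin (x * xi)) by exact: sin_mul_measurable.
rewrite /fourier -(density_integral dS mcos); last by move=> z; exact: cos_max.
rewrite -(density_integral dS msin); last by move=> z; exact: sin_max.
by congr Complex; apply: eq_Rintegral => w _; rewrite mulrC.
Qed.

Lemma stable_density_ge0 s x : 1 <= s -> 0 <= stable_density alpha theta s x.
Proof.
move=> s1; rewrite -transition_densityE//.
have s0 : 0 < s by lra.
by have [[_ _ + _] _] := densityS s0; apply.
Qed.

Variables (a lambda : R) (B : R -> {RV P >-> nat}).
Hypothesis a_ge0 : 0 <= a.
Hypothesis lambda_gt0 : 0 < lambda.
Hypothesis yuleB : is_yule lambda B.
Hypothesis indep : independent_processes S B.

Let s1 t k : 0 <= t -> 1 <= epoch a t k. Proof. exact: epoch_ge1. Qed.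

Lemma yule_density_mixture t x : 0 <= t ->
  yule_density a lambda p x t =
  yule_mixture a lambda t (stable_density alpha theta) x.
Proof.
move=> t0; have cw := progeny_cvg a_ge0 lambda_gt0 t0.
have tp := tame_density alpha12 cos_gt0.
have cv := normed_cvg (tame_series_cvg (x := x) alpha12 (fun k => s1 k t0) cw tp).
rewrite /yule_density; apply: cvg_lim => //.
rewrite -cvg_shiftS; apply: cvg_trans cv; apply: near_eq_cvg; near=> n.
rewrite /series/= big_add1/=; apply: eq_bigr => k _.
by rewrite transition_densityE ?s1.
Unshelve. all: by end_near. Qed.

Lemma yule_law t k : 0 <= t ->
  P (B t @^-1` [set k]) = (if k is j.+1 then progeny lambda t j else 0)%:E.
Proof.
move=> t0; have [_ /(_ 1%N (fun i => if i is 0%N then 0 else t)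
  (fun i => if i is 0%N then 1%N else k))] := yuleB.
rewrite big_ord_recl big_ord0 mulr1/= subr0 => h.
rewrite -[LHS](_ : P (\bigcap_(i < 1) [set w | B t w = k]) = _); last first.
  by congr (P _); rewrite bigcap_const//; exists 0%N.
rewrite h//; last by case.
congr EFin; rewrite /yule_transition; case: k {h} => [//|j] /=.
by rewrite bin0 mul1r expr1 subn1.
Qed.

(** Total probability over the values of B(t), where 0 has probability 0. *)
Lemma time_changed_density t : 0 <= t ->
  is_density P (time_changed a S B t) (yule_density a lambda p ^~ t).
Proof.
move=> t0.
have cw := progeny_cvg a_ge0 lambda_gt0 t0.
have tp := tame_density alpha12 cos_gt0.
have uE : yule_density a lambda p ^~ t = yule_mixture a lambda t (stable_density alpha theta).
  by apply/funext => x; exact: yule_density_mixture.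
have mp s : 1 <= s -> measurable_fun setT (stable_density alpha theta s).
  by move=> hs; apply: continuous_measurable_fun; exact: tp.1.
pose F A k := (S (a * t + k%:R) @^-1` A) `&` (B t @^-1` [set k]).
have XE A : time_changed a S B t @^-1` A = (\bigcup_j F A j.+1) `|` F A 0%N.
  apply/seteqP; split => w /=.
    rewrite /time_changed; case E : (B t w) => [|j] Aw; first by right.
    by left; exists j.
  by move=> [[j _]|] [/= Aw Bw]; rewrite /time_changed Bw.
have mF A k : measurable A -> measurable (F A k).
  by move=> mA; apply: measurableI; rewrite -[X in measurable X]setTI; apply: measurable_funPT.
split.
- move=> _ A mA; rewrite setTI XE; apply: measurableU; last exact: mF.
  by apply: bigcupT_measurable => j; exact: mF.
- rewrite uE; apply: continuous_measurable_fun.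
  exact: (continuous_mixture alpha12 (fun k => s1 k t0) cw tp).
- move=> x; rewrite yule_density_mixture//; apply: limr_ge.
    exact: normed_cvg (tame_series_cvg (x := x) alpha12 (fun k => s1 k t0) cw tp).
  apply: nearW => n; apply: sumr_ge0 => k _; rewrite mulr_ge0//.
    exact: progeny_ge0.
  by rewrite stable_density_ge0// s1.
move=> A mA.
have PF k : P (F A k) = (P (S (a * t + k%:R) @^-1` A) * P (B t @^-1` [set k]))%E.
  have b1 U : \bigcap_(i < 1) (U : set T) = U by rewrite bigcap_const//; exists 0%N.
  have := @indep 1%N 1%N (fun=> a * t + k%:R) (fun=> t) (fun=> A) (fun=> [set k]).
  by rewrite !b1; apply => // _; rewrite addr_ge0// mulr_ge0.
rewrite XE measureU0; [|by apply: bigcupT_measurable => j; exact: mF|exact: mF|]; last first.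
  by apply: etrans (PF 0%N) _; rewrite yule_law// mule0.
rewrite measure_semi_bigcup;
  [|by move=> j; exact: mF| |by apply: bigcupT_measurable => j; exact: mF]; last first.
  by move=> i j _ _ [w [[_ /= Bi] [_ /= Bj]]]; move: Bj; rewrite Bi => -[].
rewrite (eq_integral (fun x : measurableTypeR R =>
    \sum_(0 <= k <oo) (progeny lambda t k * stable_density alpha theta (epoch a t k) x)%:E)%E); last first.
  move=> x _; rewrite (@nneseries_lim R (fun k =>
      progeny lambda t k * stable_density alpha theta (epoch a t k) x)).
  - by rewrite yule_density_mixture.
  - by move=> k; rewrite mulr_ge0 ?progeny_ge0// stable_density_ge0// s1.
  - exact: normed_cvg (tame_series_cvg (x := x) alpha12 (fun k => s1 k t0) cw tp).
rewrite integral_nneseries//; last 2 first.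
- move=> k; apply/measurable_EFinP; apply: measurable_funTS.
  by apply: measurable_funM => //; apply: mp; exact: s1.
- by move=> k x _; rewrite lee_fin mulr_ge0 ?progeny_ge0// stable_density_ge0// s1.
apply: eq_eseriesr => k _; apply: etrans (PF k.+1) _; rewrite yule_law//.
have ek : 0 < epoch a t k by have := s1 k t0; lra.
have [[_ _ _ hd] _] := densityS ek.
have -> : a * t + k.+1%:R = epoch a t k by rewrite addrC.
rewrite hd// muleC -ge0_integralZl//.
- by apply: eq_integral => x _; rewrite transition_densityE ?s1.
- apply/measurable_EFinP; apply: measurable_funTS.
  by have [[]] := densityS ek.
- by move=> x _; rewrite lee_fin transition_densityE ?stable_density_ge0 ?s1.
- by rewrite lee_fin progeny_ge0.
Qed.

End yule_law.

(** * Primitives and derivatives of mixtures *)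

Section lower_primitive.
Context {R : realType}.
Local Notation mu := (@lebesgue_measure R).
Local Notation L1 A f := (mu.-integrable A (EFin \o f)).

(** A primitive vanishing at both ends of the line is the integral from - oo:
    folding the line at 0 shows that f has integral 0, so the integral over
    ]-oo, x] is minus the one over ]x, +oo[. *)
Lemma primitive_Ny (F f : R -> R) (x : R) : (forall z : R, is_derive z 1 F (f z)) ->
  continuous f -> L1 setT f -> L1 setT (fun z => f (- z)) ->
  F z @[z --> +oo] --> 0 -> F (- z) @[z --> +oo] --> 0 ->
  \int[mu]_(z in `]-oo, x]) f z = F x.
Proof.
move=> dF cf if_ ifN F0 FN0.
have cF z : F y @[y --> z] --> F z.
  have [h _] := dF z; apply: differentiable_continuous; exact/derivable1_diffP.
have cN (z : R) : (- y : R) @[y --> z] --> - z by apply: (@cvgN R R); exact: cvg_id.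
have right : \int[mu]_(z in `]x, +oo[) f z = 0 - F x.
  apply: (@FTC_halfline _ _ F f) => //.
  - by move=> z _; exact: cf.
  - by apply: cvg_at_right_filter; exact: cF.
  - exact: integrableS if_.
have full : \int[mu]_z f z = (0 - 0) - (F 0 - F (- 0)).
  rewrite reflect_Rintegral//.
  apply: (@FTC_halfline _ _ (fun z => F z - F (- z)) (fun z => f z + f (- z))).
  - move=> z _; have dN : is_derive z 1 (fun y => - y : R) (-1) by exact: is_deriveN.
    have dFN := is_derive1_comp (f := F) (g := fun y => - y) (dF (- z)) dN.
    by apply: is_derive_eq; rewrite /GRing.scale/=; ring.
  - move=> z _; apply: cvgD; first exact: cf.
    by apply: (@continuous_comp _ _ _ (fun y : R => - y) f); [exact: cN|exact: cf].
  - apply: cvg_at_right_filter; apply: cvgB; first exact: cF.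
    by apply: (@continuous_comp _ _ _ (fun y : R => - y) F); [exact: cN|exact: cF].
  - by apply: cvgB.
  - apply: (integrableS measurableT) => //.
    exact: (@RintegrableD _ _ _ mu _ _ _ measurableT if_ ifN).
have split_line : [set: R] = (`]-oo, x] `|` `]x, +oo[)%classic.
  apply/seteqP; split => // z _ /=; rewrite !in_itv/= andbT.
  by case: (leP z x); [left|right].
have := full; rewrite [in LHS]split_line Rintegral_setU//; first last.
- apply/disj_setPS => z [] /=; rewrite !in_itv/= andbT => zx.
  by rewrite ltNge zx.
- by rewrite -split_line.
by rewrite right oppr0; lra.
Qed.

End lower_primitive.

Section differentiated_mixtures.
Context {R : realType}.
Local Notation mu := (@lebesgue_measure R).
Variables alpha : R.
Hypothesis alpha12 : 1 < alpha <= 2.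
Local Notation w := (weight alpha).
Local Notation tame := (tame alpha).
Variables c s : nat -> R.
Hypothesis s_ge1 : forall k, 1 <= s k.
Hypothesis c_cvg : cvgn (series (fun k => `|c k| * (1 + s k) ^+ 4)).
Local Notation mix := (mixture c s).

Lemma mixture_le K : tame K -> exists2 C, 0 <= C & forall x, `|mix K x| <= C * w x.
Proof.
move=> tK; have [C C0 hC] := tame_term c s_ge1 tK.
exists (C * limn (series (fun k => `|c k| * (1 + s k) ^+ 4))).
  rewrite mulr_ge0//; apply: limr_ge => //; apply: nearW => n; apply: sumr_ge0 => k _.
  by rewrite mulr_ge0// exprn_ge0//; have := s_ge1 k; lra.
move=> x; rewrite mulrAC -limn_seriesZ//.
apply: normr_lim_series_le; last exact: cvgn_seriesZ.
by move=> k; rewrite mulrAC.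
Qed.

(** The bound by the weight survives the mixture. *)
Lemma mixture_cvg0 K : tame K ->
  mix K x @[x --> +oo] --> 0 /\ mix K (- x) @[x --> +oo] --> 0.
Proof.
move=> /mixture_le[C C0 hC].
have a0 : 0 < alpha by case/andP: alpha12; lra.
have bound : C * x `^ (- alpha) @[x --> +oo] --> C * 0.
  by apply: cvgMr; exact: powR_cvgy0.
have wle x : 0 < x -> w x <= x `^ (- alpha).
  move=> x0; rewrite /weight !powRN lef_pV2 ?posrE ?powR_gt0 ?ltr_pwDl//.
  rewrite ge0_ler_powR ?nnegrE ?addr_ge0 ?(ltW a0) ?(ltW x0)// gtr0_norm//.
  by rewrite lerDr.
rewrite mulr0 in bound.
have sq (f : R -> R) : (forall x, 0 < x -> `|f x| <= C * x `^ (- alpha)) ->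
    f x @[x --> +oo] --> (0 : R).
  move=> hf; apply: (@squeeze_cvgr _ _ _ _ (fun x => - (C * x `^ (- alpha)))
      (fun x => C * x `^ (- alpha)) f) => //.
    near=> x; rewrite -ler_norml; apply: hf; near: x; exact: nbhs_pinfty_gt.
  by rewrite -[X in _ --> X]oppr0; apply: cvgN.
split; apply: sq => x x0; apply: le_trans (hC _) _; rewrite ler_wpM2l//.
  exact: wle.
by rewrite /weight normrN; exact: wle.
Unshelve. all: by end_near. Qed.

Lemma is_derive_mixture (K dK : R -> R -> R) (M x : R) :
  (forall r y : R, 1 <= r -> is_derive y 1 (K r) (dK r y)) ->
  (forall r y, 1 <= r -> `|K r y| <= M * (1 + r) ^+ 4) ->
  (forall r y, 1 <= r -> `|dK r y| <= M * (1 + r) ^+ 4) ->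
  is_derive x 1 (mix K) (mix dK x).
Proof.
move=> hd hK hdK.
have bnd (G : R -> R -> R) : (forall r y, 1 <= r -> `|G r y| <= M * (1 + r) ^+ 4) ->
    forall k y, `|c k * G (s k) y| <= M * (`|c k| * (1 + s k) ^+ 4).
  by move=> hG k y; rewrite normrM mulrCA ler_wpM2l// hG.
apply: (@is_derive_series R (fun k y => c k * K (s k) y) (fun k y => c k * dK (s k) y)
   (fun k => M * (`|c k| * (1 + s k) ^+ 4)) (x - 1) (x + 1)).
- by apply/andP; split; lra.
- move=> k y _; have d := hd _ y (s_ge1 k).
  by apply: is_derive_eq; rewrite /GRing.scale.
- move=> y _; apply: (@le_cvg_series _ _ (fun k => M * (`|c k| * (1 + s k) ^+ 4))).
    by move=> k; exact: bnd.
  exact: cvgn_seriesZ.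
- by move=> k y _; exact: bnd.
- exact: cvgn_seriesZ.
Qed.

End differentiated_mixtures.

(** * The shift operator on mixtures *)

Section shifted_mixtures.
Context {R : realType}.
Local Notation mu := (@lebesgue_measure R).
Local Notation L1 A f := (mu.-integrable A (EFin \o f)).
Variables alpha theta a lambda : R.
Local Notation omega := (theta * pi / 2).
Hypothesis alpha12 : 1 < alpha <= 2.
Hypothesis cos_gt0 : 0 < cos omega.
Hypothesis alpha2 : alpha < 2 \/ cos omega = 1.
Hypothesis a_ge0 : 0 <= a.
Hypothesis lambda_gt0 : 0 < lambda.
Local Notation p := (stable_density alpha theta).
Local Notation Dp := (stable_generator alpha theta).
Local Notation jp := (moment_kernel alpha theta).
Local Notation ojp := (shifted_moment_kernel alpha theta).
Local Notation mix := (yule_mixture a lambda).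
Local Notation Osym := (frac_shift_symbol alpha theta 1).
Local Notation O := (frac_shift alpha theta 1).
Implicit Types s t x xi : R.

Let ge1_pow s : 1 <= s -> 1 <= (1 + s) ^+ 4.
Proof. by move=> s1; rewrite exprn_ege1//; lra. Qed.

Lemma shift_density_mixture t : 0 <= t ->
  symbol_image Osym (mix t p) (O (mix t p)) /\
  O (mix t p) = mix t (fun s => p (s + 1)).
Proof.
move=> t0; have tp := tame_density alpha12 cos_gt0.
have [|s xi s1 xi0|im E] := @frac_shift_yule_mixture R alpha theta alpha12 cos_gt0
  a lambda a_ge0 lambda_gt0
  p (fun s => p (s + 1)) 2 t t0 tp (tame_shift tp) alpha2.
- by move=> s; exact: shift_symbol_image.
- apply: le_trans (hartley_stable_density_le alpha12 cos_gt0 s1 xi0) _.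
  by rewrite ler_wpM2r ?expR_ge0// ler_peMr// ge1_pow.
by rewrite E.
Qed.

Lemma shift_moment_mixture t : 0 <= t ->
  symbol_image Osym (mix t jp) (O (mix t jp)) /\ O (mix t jp) = mix t ojp.
Proof.
move=> t0; have tp := tame_density alpha12 cos_gt0.
have a0 : 0 < alpha by case/andP: alpha12; lra.
have [|s xi s1 xi0|im E] := @frac_shift_yule_mixture R alpha theta alpha12 cos_gt0
  a lambda a_ge0 lambda_gt0
  jp ojp (2 * alpha) t t0 (tame_density_scaled alpha12 cos_gt0)
  (tame_shifted_moment alpha12 cos_gt0) alpha2.
- by move=> s s1; apply: symbol_imageZ; exact: shift_symbol_image.
- have -> : hartley (jp s) xi = - (alpha * s) * hartley (p s) xi.
    rewrite /hartley -RintegralZl//; last first.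
      by apply: cas_mul_integrable; exact: (tame_integrable alpha12 tp).
    by apply: eq_Rintegral => x _; rewrite mulrCA.
  rewrite mulNr normrN normrM (ger0_norm (mulr_ge0 (ltW a0) (le_trans ler01 s1))).
  have h := hartley_stable_density_le alpha12 cos_gt0 s1 xi0.
  have s4 : s <= (1 + s) ^+ 4.
    apply: (@le_trans _ _ (1 + s)); first by rewrite lerDr.
    by apply: ler_eXnr => //; lra.
  have e0 := expR_ge0 (- (cos omega * `|xi| `^ alpha)).
  rewrite [leRHS](_ : _ = alpha * (1 + s) ^+ 4 *
    (2 * expR (- (cos omega * `|xi| `^ alpha)))); last by ring.
  apply: ler_pM => //; first by rewrite mulr_ge0 ?(ltW a0)//; lra.
  by rewrite ler_wpM2l// ltW.
by rewrite E.
Qed.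

Lemma generator_mixture t : 0 <= t ->
  symbol_image (riesz_feller_symbol alpha theta) (mix t p) (mix t Dp).
Proof.
move=> t0; apply: (symbol_image_mixture alpha12) => //.
- by move=> k; exact: epoch_ge1.
- exact: progeny_cvg.
- exact: (tame_density alpha12 cos_gt0).
- exact: (tame_generator alpha12 cos_gt0).
- by move=> s; exact: generator_symbol_image.
Qed.

Lemma moment_mixtureE t x : 0 <= t ->
  x * mix t p x = mix t (fun s x => x * p s x) x.
Proof.
move=> t0; rewrite /yule_mixture /mixture -limn_seriesZ; last first.
  apply: normed_cvg; apply: (tame_series_cvg (x := x) alpha12 (fun k => epoch_ge1 a_ge0 k t0)
    (progeny_cvg a_ge0 lambda_gt0 t0)); exact: (tame_density alpha12 cos_gt0).
by congr (limn (series _)); apply/funext => k; rewrite mulrCA.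
Qed.

Lemma moment_mixture_integrable t : 0 <= t -> L1 setT (fun x => x * mix t p x).
Proof.
move=> t0; under eq_fun do rewrite moment_mixtureE//.
apply: (mixture_integrable alpha12) => //.
- by move=> k; exact: epoch_ge1.
- exact: progeny_cvg.
- exact: (tame_xdensity alpha12 cos_gt0).
Qed.

Lemma feller_mixture t : theta = 2 - alpha -> 0 <= t ->
  symbol_image (feller_symbol (1 - alpha) (alpha - 1))
    (fun x => x * mix t p x) (mix t jp).
Proof.
move=> th t0; under eq_fun do rewrite moment_mixtureE//.
apply: (symbol_image_mixture alpha12) => //.
- by move=> k; exact: epoch_ge1.
- exact: progeny_cvg.
- exact: (tame_xdensity alpha12 cos_gt0).
- exact: (tame_density_scaled alpha12 cos_gt0).
- by move=> s; exact: feller_symbol_image.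
Qed.

Lemma is_derive_halfline (f g : R -> R) t l : 0 <= t ->
  (forall y, 0 <= y -> f y = g y) -> is_derive t 1 g l -> is_halfline_derive f t l.
Proof.
move=> t0 fg [dg <-].
have c : h^-1 * (g (t + h) - g t) @[h --> 0^'] --> 'D_1 g t.
  have := dg; rewrite /derivable => /cvg_ex[l' hl'].
  rewrite /derive (cvg_lim _ hl')//; apply: cvg_trans hl'; apply: near_eq_cvg.
  by near=> h; rewrite /GRing.scale/= mulr1 [h + t]addrC.
have c' : h^-1 * (g (t + h) - g t) @[h --> within [set h | 0 <= t + h] (0 : R)^'] --> 'D_1 g t.
  exact: cvg_within_filter.
rewrite /is_halfline_derive; apply: cvg_trans c'; apply: near_eq_cvg.
by near=> h; rewrite !fg//; near: h; exact: withinT.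
Unshelve. all: by end_near. Qed.

End shifted_mixtures.

(** * The Gaussian case *)

Section gaussian_case.
Context {R : realType}.
Local Notation mu := (@lebesgue_measure R).
Local Notation L1 A f := (mu.-integrable A (EFin \o f)).
Local Notation p := (stable_density 2 (0 : R)).
Local Notation Dp := (stable_generator 2 (0 : R)).
Local Notation jp := (moment_kernel 2 (0 : R)).
Implicit Types s t x : R.

Let two12 : 1 < (2 : R) <= 2. Proof. by apply/andP; split; lra. Qed.

Let omega0 : 0 * pi / 2 = 0 :> R. Proof. by rewrite !mul0r. Qed.

Lemma cos_angle0 : cos (0 * pi / 2) = 1 :> R. Proof. by rewrite omega0 cos0. Qed.

Let cos_gt0 : 0 < cos (0 * pi / 2) :> R. Proof. by rewrite cos_angle0. Qed.

Definition gauss_slope s x : R := pi^-1 * kernel 2 (0 * pi / 2) 1 s (pi / 2) x.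

Lemma is_derive_gauss s x : 0 < s -> is_derive x 1 (p s) (gauss_slope s x).
Proof.
move=> s0; have d := is_derive_kernel_x two12 cos_gt0 0 x (ltrN10 _) s0.
by rewrite !add0r in d; apply: is_derive_eq.
Qed.

Lemma is_derive_gauss_slope s x : 0 < s -> is_derive x 1 (gauss_slope s) (Dp s x).
Proof.
move=> s0; have m1 : -1 < (1 : R) by lra.
have d := is_derive_kernel_x two12 cos_gt0 (pi / 2) x m1 s0.
apply: is_derive_eq; rewrite /stable_generator /GRing.scale/= -mulrN; congr (_ * _).
rewrite -splitr -kernelDpi//; last by lra.
by rewrite omega0 oppr0 add0r.
Qed.

Lemma moment_gaussE s x : 0 < s -> x * p s x = - (2 * s) * gauss_slope s x.
Proof.
move=> s0; rewrite /stable_density mulrCA density_kernel_recurrence//.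
rewrite omega0 oppr0 sub0r /gauss_slope omega0.
have half_turn : kernel 2 0 1 s (pi / 2) x = - kernel 2 0 1 s (- (pi / 2)) x.
  rewrite -kernelDpi ?cos0 ?two12//.
  by rewrite (_ : - (pi / 2) + pi = pi / 2); last lra.
by rewrite half_turn (_ : 2 - 1 = 1); [ring|lra].
Qed.

Lemma gauss_bound : exists M : R, [/\ forall s x, 1 <= s -> `|p s x| <= M * (1 + s) ^+ 4,
  forall s x, 1 <= s -> `|gauss_slope s x| <= M * (1 + s) ^+ 4 &
  forall s x, 1 <= s -> `|Dp s x| <= M * (1 + s) ^+ 4].
Proof.
have lt1 (k : R) : 0 <= k -> -1 < k by lra.
have [M0 M00 h0] := normalized_kernel_bound two12 cos_gt0 0 (lt1 _ (lexx 0)) (ltr01 (R := R)).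
have [M1 M10 h1] := normalized_kernel_bound two12 cos_gt0 (pi / 2) (lt1 _ ler01) ltr01.
have [M2 M20 h2] := normalized_kernel_bound two12 cos_gt0 (- (0 * pi / 2)) (lt1 _ (ler0n _ 2)) ltr01.
exists (M0 + M1 + M2).
have le4 (k s : R) : 1 <= s -> k <= M0 + M1 + M2 -> k <= (M0 + M1 + M2) * (1 + s) ^+ 4.
  move=> s1 /le_trans; apply; apply: ler_peMr; first by rewrite !addr_ge0.
  by rewrite exprn_ege1//; lra.
split=> s x s1; apply: le4 => //.
- by apply: le_trans (h0 s x s1) _; lra.
- by apply: le_trans (h1 s x s1) _; lra.
- by rewrite normrN; apply: le_trans (h2 s x s1) _; lra.
Qed.

Lemma gaussE x : p 1 x = (Num.sqrt (4 * pi))^-1 * expR (- (x ^+ 2 / 4)).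
Proof.
rewrite /stable_density omega0 gauss_kernelE// mulr1 divr1 mulrA; congr (_ * _).
rewrite sqrtrM// (_ : 4 = 2 ^+ 2); last by ring.
rewrite sqrtr_sqr ger0_norm// invfM.
have s0 : Num.sqrt pi != 0 :> R by rewrite gt_eqF// sqrtr_gt0 pi_gt0.
rewrite -{1}(sqr_sqrtr (pi_ge0 R)).
by move: (Num.sqrt _) s0 => q q0; field.
Qed.

Variables a lambda : R.
Hypothesis a_ge0 : 0 <= a.
Hypothesis lambda_gt0 : 0 < lambda.
Local Notation mix := (yule_mixture a lambda).

Lemma is_derive_gauss_mixture t x : 0 <= t ->
  is_derive x 1 (mix t p) (mix t gauss_slope x) /\
  is_derive x 1 (mix t gauss_slope) (mix t Dp x).
Proof.
move=> t0; have [M [M0 M1 M2]] := gauss_bound.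
have s1 k : 1 <= epoch a t k by exact: epoch_ge1.
have cw := progeny_cvg a_ge0 lambda_gt0 t0.
split; apply: (is_derive_mixture (M := M) s1 cw) => // s y hs.
- by apply: is_derive_gauss; lra.
- by apply: is_derive_gauss_slope; lra.
Qed.

(** x p_s(x) is the derivative of - 2 s p_s(x), which vanishes at - oo. *)
Lemma moment_primitive t x : 0 <= t ->
  \int[mu]_(z in `]-oo, x]) (z * mix t p z) = mix t jp x.
Proof.
move=> t0; have [M [M0 M1 M2]] := gauss_bound.
have s1 k : 1 <= epoch a t k by exact: epoch_ge1.
have cw := progeny_cvg a_ge0 lambda_gt0 t0.
have tx := tame_xdensity two12 cos_gt0.
have tj := tame_density_scaled two12 cos_gt0.
have E : (fun z => z * mix t p z) = mix t (fun s x => x * p s x).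
  by apply/funext => z; exact: moment_mixtureE.
under eq_Rintegral do rewrite (moment_mixtureE two12 cos_gt0 a_ge0 lambda_gt0 _ t0).
have [j0 jN] := mixture_cvg0 two12 s1 cw tj.
apply: primitive_Ny => //.
- move=> z; have [_ [C1 C10 h1]] := tj; have [_ [C2 C20 h2]] := tx.
  have bnd C r y : 0 <= C -> 1 <= r -> C <= C1 + C2 ->
      C * (1 + r) ^+ 4 * weight 2 y <= (C1 + C2) * (1 + r) ^+ 4.
    move=> C0 r1 hC; have r4 : 0 <= (1 + r) ^+ 4 by rewrite exprn_ge0//; lra.
    apply: (@le_trans _ _ (C * (1 + r) ^+ 4)); last by rewrite ler_wpM2r.
    by rewrite ler_piMr ?(weight_le1 two12)// mulr_ge0.
  apply: (is_derive_mixture (M := C1 + C2) s1 cw) => r y r1.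
  + have r0 : 0 < r by lra.
    have d := is_derive_gauss y r0.
    by apply: is_derive_eq; rewrite moment_gaussE.
  + by apply: le_trans (h1 _ _ r1) _; apply: bnd => //; lra.
  + by apply: le_trans (h2 _ _ r1) _; apply: bnd => //; lra.
- exact: (continuous_mixture two12 s1 cw tx).
- exact: (mixture_integrable two12 s1 cw tx).
- have [C C0 hC] := mixture_le s1 cw tx.
  have iw : L1 setT (weight (2 : R)) by apply: weight_integrable; lra.
  apply: (@le_Rintegrable _ _ _ mu _ _ (fun z => C * weight 2 z)) => //.
  + apply: continuous_measurable_fun => z.
    apply: (@continuous_comp _ _ _ (fun y : R => - y) (mix t (fun s x => x * p s x))).
      by apply: (@cvgN R R); exact: cvg_id.
    exact: (continuous_mixture two12 s1 cw tx).
  + by move=> z _; apply: le_trans (hC _) _; rewrite /weight normrN.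
  + exact: (@RintegrableZ _ _ _ mu _ _ C measurableT iw).
Qed.

End gaussian_case.

(** * The evolution equations *)

Section initial_time.
Context {R : realType}.

Lemma yule_mixture0 (a lambda : R) (K : R -> R -> R) x : yule_mixture a lambda 0 K x = K 1 x.
Proof.
apply: cvg_lim => //; rewrite -cvg_shiftS; apply: cvg_near_cst; near=> n.
rewrite /series/= big_nat_recl// big1 ?addr0 => [|k _].
  by rewrite /progeny /epoch !mulr0 oppr0 expR0 subrr addr0 expr0 !mul1r.
by rewrite /progeny mulr0 oppr0 expR0 subrr exprS mul0r mulr0 mul0r.
Unshelve. all: by end_near. Qed.

End initial_time.

Theorem theorem18 (R : realType) (d : measure_display) (T : measurableType d)
  (P : probability T R) (a lambda : R) (B : R -> {RV P >-> nat})
  (a_ge0 : 0 <= a) (lambda_gt0 : 0 < lambda) (yuleB : is_yule lambda B) :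
  (forall (alpha theta : R) (S : R -> {RV P >-> R}) (p : R -> R -> R),
    1 < alpha < 2 -> theta = 2 - alpha ->
    is_stable_levy alpha theta S -> is_transition_density S p ->
    independent_processes S B ->
    let u := yule_density a lambda p in
    let D := riesz_feller alpha theta in
    let O := frac_shift alpha theta 1 in
    let Dsym := riesz_feller_symbol alpha theta in
    let Osym := frac_shift_symbol alpha theta 1 in
    [/\ (forall t, 0 <= t -> is_density P (time_changed a S B t) (u^~ t)),
        (forall t, 0 <= t ->
          let xu := fun x => x * u x t in
          let J := feller_integral (1 - alpha) (alpha - 1) xu in
          [/\ symbol_image Dsym (u^~ t) (D (u^~ t)),
              symbol_image Osym (u^~ t) (O (u^~ t)),
              symbol_image (feller_symbol (1 - alpha) (alpha - 1)) xu J,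
              symbol_image Osym J (O J) &
              forall x, is_halfline_derive (u x) t
                (a * (D (u^~ t) x + lambda * t * (u x t - O (u^~ t) x))
                 + lambda / alpha * (J x - O J x))]) &
        forall x, u x 0 = p x 1])
  /\
  (forall (S : R -> {RV P >-> R}) (p : R -> R -> R),
    is_stable_levy 2 0 S -> is_transition_density S p ->
    independent_processes S B ->
    let u := yule_density a lambda p in
    let O := frac_shift 2 0 1 in
    let Osym := frac_shift_symbol 2 0 1 in
    [/\ (forall t, 0 <= t -> is_density P (time_changed a S B t) (u^~ t)),
        (forall t, 0 <= t ->
          let ut := (u^~ t) : R -> R in
          let J := fun x : R =>
            \int[@lebesgue_measure R]_(z in `]-oo, x]) (z * u z t) in
          [/\ (forall x, derivable ut x 1 /\ derivable (derive1 ut) x 1) /\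
                symbol_image (riesz_feller_symbol 2 0) ut (derive1n 2 ut),
              symbol_image Osym ut (O ut),
              (@lebesgue_measure R).-integrable setT
                (fun z => (z * u z t)%:E),
              symbol_image Osym J (O J) &
              forall x, is_halfline_derive (u x) t
                (a * (derive1n 2 ut x + lambda * t * (u x t - O ut x))
                 + lambda / 2 * (J x - O J x))]) &
        forall x, u x 0 = p x 1 /\
                  p x 1 = (Num.sqrt (4 * pi))^-1 * expR (- (x ^+ 2 / 4))]).
Proof.
split.
- move=> alpha theta S p alpha12 thE levyS densS indep u D O Dsym Osym.
  have al12 : 1 < alpha <= 2 by case/andP: alpha12 => h1 h2; rewrite h1 ltW.
  have al2 : alpha < 2 \/ cos (theta * pi / 2) = 1 by left; case/andP: alpha12.
  have cos0 : 0 < cos (theta * pi / 2).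
    have [h1 h2] := andP alpha12; have pi0 := pi_gt0 R.
    apply: cos_gt0_pihalf; rewrite thE; apply/andP; split.
      by apply: (@lt_le_trans _ _ 0); rewrite ?oppr_lt0 ?divr_ge0 ?mulr_ge0// ?divr_gt0//; lra.
    by rewrite ltr_pM2r ?invr_gt0// gtr_pMl//; lra.
  have uE t : 0 <= t -> u^~ t = yule_mixture a lambda t (stable_density alpha theta).
    by move=> t0; apply/funext => x; exact: (yule_density_mixture al12 cos0 levyS densS).
  split.
  + by move=> t t0; exact: (time_changed_density al12 cos0 levyS densS).
  + move=> t t0 xu J.
    have [imO EO] := shift_density_mixture al12 cos0 al2 a_ge0 lambda_gt0 t0.
    have [imOJ EOJ] := shift_moment_mixture al12 cos0 al2 a_ge0 lambda_gt0 t0.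
    have imD := generator_mixture al12 cos0 a_ge0 lambda_gt0 t0.
    have imJ := feller_mixture al12 cos0 a_ge0 lambda_gt0 thE t0.
    have xuE : xu = fun x => x * yule_mixture a lambda t (stable_density alpha theta) x.
      by apply/funext => x; rewrite /xu -uE.
    have JE : J = yule_mixture a lambda t (moment_kernel alpha theta).
      by rewrite /J xuE; exact: symbol_opE.
    have DE : D (u^~ t) = yule_mixture a lambda t (stable_generator alpha theta).
      by rewrite uE//; exact: symbol_opE.
    split.
    * by rewrite DE uE.
    * by rewrite uE.
    * by rewrite xuE JE.
    * by rewrite JE.
    * move=> x; apply: (is_derive_halfline t0 (g := fun y =>
        yule_mixture a lambda y (stable_density alpha theta) x)).
        by move=> y y0; rewrite -uE.
      have -> : u x t = yule_mixture a lambda t (stable_density alpha theta) x.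
        by rewrite -uE.
      rewrite DE JE uE// /O EOJ EO.
      exact: is_derive_yule_mixture.
  + move=> x; have -> : u x 0 = yule_mixture a lambda 0 (stable_density alpha theta) x.
      by rewrite -uE.
    rewrite yule_mixture0.
    by rewrite -(transition_densityE al12 cos0 levyS densS).
- move=> S p levyS densS indep u O Osym.
  have al12 : 1 < (2 : R) <= 2 by apply/andP; split; lra.
  have cos1 : cos (0 * pi / 2) = 1 :> R by exact: cos_angle0.
  have cos0 : 0 < cos (0 * pi / 2) :> R by rewrite cos1.
  have al2 : (2 : R) < 2 \/ cos (0 * pi / 2) = 1 :> R by right.
  have uE t : 0 <= t -> u^~ t = yule_mixture a lambda t (stable_density 2 0).
    by move=> t0; apply/funext => x; exact: (yule_density_mixture al12 cos0 levyS densS).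
  split.
  + by move=> t t0; exact: (time_changed_density al12 cos0 levyS densS).
  + move=> t t0 ut J.
    have [imO EO] := shift_density_mixture al12 cos0 al2 a_ge0 lambda_gt0 t0.
    have [imOJ EOJ] := shift_moment_mixture al12 cos0 al2 a_ge0 lambda_gt0 t0.
    have imD := generator_mixture al12 cos0 a_ge0 lambda_gt0 t0.
    have utE : ut = yule_mixture a lambda t (stable_density 2 0) by exact: uE.
    have uxE x : u x t = ut x by [].
    have JE : J = yule_mixture a lambda t (moment_kernel 2 0).
      apply/funext => x; rewrite /J -moment_primitive//.
      by apply: eq_Rintegral => z _; rewrite uxE utE.
    have d1 x := (is_derive_gauss_mixture a_ge0 lambda_gt0 x t0).1.
    have d2 x := (is_derive_gauss_mixture a_ge0 lambda_gt0 x t0).2.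
    have D1 : derive1 ut = yule_mixture a lambda t gauss_slope.
      by apply/funext => x; rewrite derive1E utE; have [_ ->] := d1 x.
    have D2 : derive1n 2 ut = yule_mixture a lambda t (stable_generator 2 0).
      apply/funext => x; rewrite /derive1n/= D1 derive1E.
      by have [_ ->] := d2 x.
    split.
    * split; last by rewrite D2 utE.
      move=> x; rewrite D1 utE; split; first by have [] := d1 x.
      by have [] := d2 x.
    * by rewrite utE.
    * under eq_fun do rewrite uxE utE.
      exact: moment_mixture_integrable.
    * by rewrite JE.
    * move=> x; apply: (is_derive_halfline t0 (g := fun y =>
        yule_mixture a lambda y (stable_density 2 0) x)).
        by move=> y y0; rewrite -uE.
      rewrite uxE D2 JE utE /O EOJ EO.
      exact: is_derive_yule_mixture.
  + move=> x; split.
      have -> : u x 0 = yule_mixture a lambda 0 (stable_density 2 0) x.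
        by rewrite -uE.
      rewrite yule_mixture0.
      by rewrite -(transition_densityE al12 cos0 levyS densS).
    by rewrite (transition_densityE al12 cos0 levyS densS)// gaussE.
Qed.
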